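(* Let $d\ge2$ and let $(\alpha_N)_{N\in\mathbb{N}}\subset(0,+\infty)$ with $\sup_N\alpha_N<+\infty$. There is a constant $C>0$ depending only on $d$ and $\sup_N\alpha_N$ such that for every $N\in\mathbb{N}$ and every $X\in\mathcal X_N$ with $\lambda_N(X)\le m_{\lambda,N}+\alpha_N$, $$\min_{z\in\mathbb{Z}^d}\#\big(X\,\Delta\,((B_{r_N}\cap\mathbb{Z}^d)+z)\big)\le C\,N\Big(N^{-\frac{1}{2d}}P_N(X)^{\frac12}+\alpha_N^{\frac12}+N^{-\frac1d}\Big).$$ In particular, if $X_N\in\mathcal X_N$ ($N\in\mathbb{N}$) satisfy $\sup_NP_N(X_N)<+\infty$ and $\lambda_N(X_N)\le m_{\lambda,N}+\alpha_N$ for all $N$, then there is $C'>0$ depending only on $d$, $\sup_N\alpha_N$ and $\sup_NP_N(X_N)$ such that for all $N$ $$\min_{z\in\mathbb{Z}^d}\#\big(X_N\,\Delta\,((B_{r_N}\cap\mathbb{Z}^d)+z)\big)\le C'N\big(N^{-\frac1{2d}}+\alpha_N^{\frac12}\big).$$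
   Context: $\mathcal{N}$ denotes the set of nearest-neighbour edges of $\mathbb{Z}^d$, i.e. unordered pairs $\{p,q\}\subset\mathbb{Z}^d$ with $|p-q|=1$, each edge counted once. For $u:\mathbb{Z}^d\to\mathbb{R}$, $D(u)=\sum_{\{i,j\}\in\mathcal N}|u(i)-u(j)|^2$. $\mathcal X_N$ is the family of subsets of $\mathbb{Z}^d$ with exactly $N$ elements. For $X\in\mathcal X_N$ and $u$ vanishing outside $X$, $E_N(u)=N^{-(d-2)/d}D(u)$, and $\lambda_N(X)=\min\{E_N(u): u:\mathbb{Z}^d\to\mathbb{R},\ u=0\text{ on }\mathbb{Z}^d\setminus X,\ \tfrac1N\sum_{i\in\mathbb{Z}^d}u(i)^2=1\}$; $m_{\lambda,N}=\inf\{\lambda_N(X):X\in\mathcal X_N\}$. For $X\subset\mathbb{Z}^d$ and $p\in X$, $\mathrm{val}(p)=\#\{q\in\mathbb{Z}^d\setminus X:|p-q|=1\}$, $P(X)=\sum_{p\in X}\mathrm{val}(p)$, and for $X\in\mathcal X_N$, $P_N(X)=N^{-(d-1)/d}P(X)$. $B_{r_N}$ is the closed Euclidean ball centered at $0$ with Lebesgue measure $|B_{r_N}|=N$. $\Delta$ is symmetric difference and $\#$ cardinality. *)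

(* Defs.v *)
From HB Require Import structures.
From mathcomp Require Import all_boot all_order all_algebra.
From mathcomp Require Import finmap.
From mathcomp Require Import all_classical all_reals all_analysis.
Unset Printing Implicit Defensive.
Import Order.TTheory GRing.Theory Num.Theory.
Local Open Scope classical_set_scope.
Local Open Scope ring_scope.

Notation pt d := 'rV[int]_d.

Definition dist2 (d : nat) (p q : pt d) : int :=
  \sum_(i < d) (p ord0 i - q ord0 i) ^+ 2.

Definition nbhd (d : nat) (X : {fset pt d}) : {fset pt d} :=
  fset_set [set q : pt d | exists2 p, p \in X & (dist2 d p q <= 1)%R].

(* Dirichlet energy D(u) = sum over nearest-neighbour edges {p,q}
   (|p - q| = 1, each edge counted once) of |u p - u q|^2, for u vanishing
   outside X: only edges meeting X contribute, and both endpoints of such an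
   edge lie in nbhd X; ordered pairs count each edge twice, hence the 1/2. *)
Definition Dir (R : realType) (d : nat) (X : {fset pt d}) (u : pt d -> R) : R :=
  2^-1 * \sum_(p <- nbhd d X) \sum_(q <- nbhd d X)
           (if dist2 d p q == 1 then (u p - u q) ^+ 2 else 0).

(* lambda_N(X) (a minimum, written here as an infimum) *)
Definition lambdaN (R : realType) (d N : nat) (X : {fset pt d}) : R :=
  inf [set E : R | exists u : pt d -> R,
         [/\ (forall p, p \notin X -> u p = 0),
             (N%:R)^-1 * \sum_(p <- X) u p ^+ 2 = 1 &
             E = powR (N%:R) (- ((d%:R - 2) / d%:R)) * Dir R d X u]].

Definition m_lambda (R : realType) (d N : nat) : R :=
  inf [set E : R | exists X : {fset pt d}, #|` X| = N /\ E = lambdaN R d N X].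

Definition valp (d : nat) (X : {fset pt d}) (p : pt d) : nat :=
  #|` fset_set [set q : pt d | q \notin X /\ dist2 d p q = 1] |.

Definition Per (d : nat) (X : {fset pt d}) : nat := \sum_(p <- X) valp d X p.

Definition PerN (R : realType) (d N : nat) (X : {fset pt d}) : R :=
  powR (N%:R) (- ((d%:R - 1) / d%:R)) * (Per d X)%:R.

(* Lebesgue measure of the unit ball of R^d: omega_0 = 1, omega_1 = 2,
   omega_(n+2) = 2 pi / (n+2) * omega_n  (= pi^(d/2) / Gamma(d/2 + 1)). *)
Fixpoint omega (R : realType) (d : nat) : R :=
  match d with
  | 0 => 1
  | 1 => 2
  | (n.+2) as m => 2 * pi / m%:R * omega R n
  end.

(* radius r_N with |B_{r_N}| = omega_d r_N^d = N *)
Definition rN (R : realType) (d N : nat) : R :=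
  powR (N%:R / omega R d) (d%:R)^-1.

Definition ball_lattice (R : realType) (d N : nat) (z : pt d) : set (pt d) :=
  [set p : pt d | ((dist2 d p z)%:~R : R) <= rN R d N ^+ 2].

(* # (X Δ S) for a finite set S *)
Definition card_symdiff (d : nat) (X : {fset pt d}) (S : set (pt d)) : nat :=
  #|` fset_set [set p : pt d | (p \in X) != `[< S p >] ] |.

(* Main.v *)
(** Counting the points of [X] in successive coordinate slices gives a Knothe map from [X] to the
    ball of the same volume whose difference quotients along the axes have a fixed product.  The
    AM-GM inequality then bounds [d * sum w] by [energy w / 2 + r^2 (N d / (d + 2) + 9 b) / 2],
    where [b] is the number of points at which lattice lines enter [X]: a Saint-Venant inequality
    for the discrete torsion, with an explicit deficit.  If the deficit is at most [N r^2 eps], the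
    gap in AM-GM and a one-dimensional Hardy inequality show that every coordinate of the map is
    close to a translation; hence the truncated second moment of [X] about some lattice point [z]
    exceeds that of the ball by [O(N r^2 eps)], and the bathtub principle gives
    [# (X Δ (B + z)) = O(N sqrt eps)].

    The eigenvalue is reduced to the torsion as in the Kohler-Jobin inequality.  The layers of a
    near minimiser [u], stretched, form a function [w] whose level sets satisfy the Saint-Venant
    inequality; integrating the Riccati equation of the radial eigenfunction along these levels
    shows that [energy u >= (xs / s^2) * sum u^2] up to a boundary term controlled by Hardy's
    inequality for means, where [s] is the radius of the ball having the torsion of [w] and [xs] is
    the first zero of a Bessel function.  A radial trial function on a lattice ball gives
    [xs / r^2 + O(r^-3)] as an upper bound for the minimal quotient.  So the torsion deficit
    is [O(alpha + b / N)], and [b / N <= Per / N = N^(-1/d) PerN]. *)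
Require Import Defs.
From HB Require Import structures.
From mathcomp Require Import all_boot all_order all_algebra.
From mathcomp Require Import finmap.
From mathcomp Require Import all_classical all_reals all_analysis.
From mathcomp Require Import ring lra zify.
Import Order.TTheory GRing.Theory Num.Theory.
Local Open Scope classical_set_scope.
Local Open Scope ring_scope.
Import numFieldNormedType.Exports.

(** * Angle functions and the volume of the ball *)

(** Three obstacles shape the argument. Level sets cannot be rearranged into Euclidean balls on the
    lattice: the lattice perimeter is anisotropic, and only the energy is isotropic to leading
    order. So the ball is reached by a transport map, whose moments are Euclidean. Such a map bounds
    torsion directly, because the source there is linear; it does not bound the eigenvalue, hence
    the detour.

    The level sets of a near minimiser may be rough, so their boundary counts are never estimated
    one by one. They occur weighted by the thickness of the layer, and this weighted sum is bounded
    by the energy through Cauchy-Schwarz. Only the entry count of [X] itself survives.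

    Discretisation, rounding of centres and lattice-point counts all cost a relative error of order
    [1/r]. A weak isoperimetric inequality gives [1/r <= b/N], so these errors are absorbed by the
    entry count.

    The square root is lost only in the last step: the deficit controls the second moment linearly,
    but the weight [r^2 - |p - z|^2] vanishes on the sphere. *)

Section RealCalculus.
Context {R : realType}.
Implicit Types (f g df dg : R -> R) (a b x : R).

Lemma is_derive_congr f x a b : is_derive x (1:R) f a -> a = b -> is_derive x (1:R) f b.
Proof. by move=> h <-. Qed.

Lemma is_derive_add f g x a b : is_derive x (1:R) f a -> is_derive x (1:R) g b ->
  is_derive x (1:R) (fun y => f y + g y) (a + b).
Proof. exact: is_deriveD. Qed.

Lemma is_derive_opp f x a : is_derive x (1:R) f a ->
  is_derive x (1:R) (fun y => - f y) (- a).
Proof. exact: is_deriveN. Qed.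

Lemma is_derive_mul f g x a b : is_derive x (1:R) f a -> is_derive x (1:R) g b ->
  is_derive x (1:R) (fun y => f y * g y) (a * g x + f x * b).
Proof.
move=> ha hb; apply: is_derive_congr (is_deriveM ha hb) _.
by rewrite /GRing.scale /= addrC; congr (_ + _); rewrite mulrC.
Qed.

Lemma is_derive_constmul f (k : R) x a : is_derive x (1:R) f a ->
  is_derive x (1:R) (fun y => k * f y) (k * a).
Proof.
move=> ha; apply: is_derive_congr (is_derive_mul (fun=> k) f x 0 a _ ha) _; ring.
Qed.

Lemma is_derive_mulconst f (k : R) x a : is_derive x (1:R) f a ->
  is_derive x (1:R) (fun y => f y * k) (a * k).
Proof.
move=> ha; apply: is_derive_congr (is_derive_mul f (fun=> k) x a 0 ha _) _; ring.
Qed.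

Lemma is_derive_addconst f (k : R) x a : is_derive x (1:R) f a ->
  is_derive x (1:R) (fun y => f y + k) a.
Proof.
move=> ha; apply: is_derive_congr (is_derive_add f (fun=> k) x a 0 ha _) _; ring.
Qed.

Lemma is_derive_exp f (n : nat) x a : is_derive x (1:R) f a ->
  is_derive x (1:R) (fun y => f y ^+ n.+1) (n.+1%:R * f x ^+ n * a).
Proof.
move=> ha; elim: n => [|n IH].
  by apply: is_derive_congr ha _; rewrite expr0 mulr1 mul1r.
have -> : (fun y => f y ^+ n.+2) = (fun y => f y * f y ^+ n.+1).
  by apply/funext => y; rewrite exprS.
apply: is_derive_congr (is_derive_mul f (fun y => f y ^+ n.+1) x _ _ ha IH) _.
by rewrite [in RHS]mulrSr exprS; ring.
Qed.

Lemma is_derive_chain f g x a b : is_derive x (1:R) f a -> is_derive (f x) (1:R) g b ->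
  is_derive x (1:R) (fun y => g (f y)) (b * a).
Proof.
by move=> ha hb; exact: (is_derive1_comp hb ha).
Qed.

Lemma is_derive_inv f x a : f x != 0 -> is_derive x (1:R) f a ->
  is_derive x (1:R) (fun y => (f y)^-1) (- a / f x ^+ 2).
Proof.
move=> fx0 ha; have h := @is_deriveV _ f x a 1 fx0 ha; apply: is_derive_congr h _.
by rewrite /GRing.scale /= -exprVn; ring.
Qed.

Lemma is_derive_continuous f x a : is_derive x (1:R) f a -> {for x, continuous f}.
Proof.
by case=> h _; apply: differentiable_continuous; apply/derivable1_diffP.
Qed.

Lemma is_derive_within_continuous f df a b :
  (forall x, a <= x <= b -> is_derive x (1:R) f (df x)) -> {within `[a, b], continuous f}.
Proof.
move=> h; apply: continuous_in_subspaceT => x; rewrite inE /= in_itv /= => hx.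
exact: is_derive_continuous (h _ hx).
Qed.

Lemma mean_value f df a b : a < b ->
  (forall x, a <= x <= b -> is_derive x (1:R) f (df x)) ->
  exists2 c, a < c < b & f b - f a = df c * (b - a).
Proof.
move=> ab h; have [|c] := @MVT R f df a b ab _ (is_derive_within_continuous f df a b h).
  by move=> x; rewrite in_itv /= => /andP[ax xb]; apply: h; rewrite !ltW.
by rewrite in_itv /=; exists c.
Qed.

Lemma mean_value_le f df a b : a <= b ->
  (forall x, a <= x <= b -> is_derive x (1:R) f (df x)) ->
  exists2 c, a <= c <= b & f b - f a = df c * (b - a).
Proof.
rewrite le_eqVlt => /predU1P[->|ab] h.
  by exists b; rewrite ?lexx // !subrr mulr0.
by have [c /andP[ac cb] e] := mean_value _ _ _ _ ab h; exists c; rewrite ?ltW.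
Qed.

Lemma is_derive_ge0_homo f df a b : a <= b ->
  (forall x, a <= x <= b -> is_derive x (1:R) f (df x)) ->
  (forall x, a <= x <= b -> 0 <= df x) -> f a <= f b.
Proof.
move=> ab h h0; have [c hc e] := mean_value_le _ _ _ _ ab h.
by rewrite -subr_ge0 e mulr_ge0 ?h0 ?subr_ge0.
Qed.

Lemma is_derive_le0_homo f df a b : a <= b ->
  (forall x, a <= x <= b -> is_derive x (1:R) f (df x)) ->
  (forall x, a <= x <= b -> df x <= 0) -> f b <= f a.
Proof.
move=> ab h h0; have [c hc e] := mean_value_le _ _ _ _ ab h.
by rewrite -subr_le0 e mulr_le0_ge0 ?h0 ?subr_ge0.
Qed.

(** Cross-multiplied, so that neither derivative has to be nonzero; the uses cancel a positive power
    of a cosine. *)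
Lemma cauchy_mean_value f df g dg a b : a < b ->
  (forall x, a <= x <= b -> is_derive x (1:R) f (df x)) ->
  (forall x, a <= x <= b -> is_derive x (1:R) g (dg x)) ->
  exists2 c, a < c < b & (f b - f a) * dg c = (g b - g a) * df c.
Proof.
move=> ab hf hg.
have [|c hc e] := mean_value (fun x => (f b - f a) * g x - (g b - g a) * f x)
  (fun x => (f b - f a) * dg x - (g b - g a) * df x) a b ab.
  move=> x hx; apply: is_derive_add; first exact/is_derive_constmul/hg.
  exact/is_derive_opp/is_derive_constmul/hf.
exists c => //; apply/eqP; rewrite -subr_eq0.
have : ((f b - f a) * dg c - (g b - g a) * df c) * (b - a) = 0 by rewrite -e; ring.
by move/eqP; rewrite mulf_eq0 (subr_eq0 b a) (gt_eqF ab) orbF.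
Qed.

Lemma intermediate_value f df a b v : a <= b ->
  (forall x, a <= x <= b -> is_derive x (1:R) f (df x)) ->
  f a <= v <= f b -> exists2 c, a <= c <= b & f c = v.
Proof.
move=> ab h /andP[av vb]; have [||c] := @IVT R f a b v ab.
- exact: is_derive_within_continuous h.
- by rewrite min_l ?max_r ?av // (le_trans av).
by rewrite in_itv /=; exists c.
Qed.

End RealCalculus.

Section CosinePowers.
Context {R : realType}.
Implicit Types th : R.

(** The primitive of [cos ^+ m] vanishing at 0, by the reduction formula. In the angle variable it
    is explicit for both parities, whereas in [y = sin th] half-integer powers of [1 - y^2] would
    appear. *)
Fixpoint cospow_int (m : nat) th : R :=
  match m with
  | 0 => th
  | 1 => sin th
  | (n.+2) as m' => (cos th ^+ n.+1 * sin th + n.+1%:R * cospow_int n th) / m'%:R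
  end.

Lemma is_derive_cospow_int m th : is_derive th (1:R) (cospow_int m) (cos th ^+ m).
Proof.
elim/ltn_ind: m => -[|[|n]] IH /=.
- exact: is_derive_id.
- exact: is_derive_sin.
apply: is_derive_congr.
  apply: is_derive_mulconst.
  apply: is_derive_add; last exact: (is_derive_constmul _ _ _ _ (IH n _)).
  exact: (is_derive_mul _ _ _ _ _ (is_derive_exp _ _ _ _ (is_derive_cos _)) (is_derive_sin _)).
have e : sin th * sin th = 1 - cos th ^+ 2 by rewrite -expr2 sin2cos2.
have n0 : (n.+2%:R : R) != 0 by rewrite pnatr_eq0.
apply: (mulIf n0); rewrite mulfVK // [n.+2%:R]mulrSr !exprS.
transitivity (n.+1%:R * cos th ^+ n * (1 - sin th * sin th) + cos th * cos th ^+ n * cos th).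
  by ring.
by rewrite e; ring.
Qed.

Definition cospow_tot (m : nat) : R := cospow_int m (pi / 2) - cospow_int m (- (pi / 2)).

Lemma cospow_tot0 : cospow_tot 0 = pi.
Proof. by rewrite /cospow_tot /=; lra. Qed.

Lemma cospow_tot1 : cospow_tot 1 = 2.
Proof. by rewrite /cospow_tot /= sinN sin_pihalf; ring. Qed.

Lemma cospow_totSS m : cospow_tot m.+2 = m.+1%:R / m.+2%:R * cospow_tot m.
Proof.
rewrite /cospow_tot /= cosN cos_pihalf !exprS !mul0r !add0r.
by have : (m.+2%:R : R) != 0 by []; set u := cospow_int _ _; set v := cospow_int _ _; move=> h; field.
Qed.

Lemma cospow_tot_gt0 m : 0 < cospow_tot m.
Proof.
elim/ltn_ind: m => -[|[|n]] IH; rewrite ?cospow_tot0 ?cospow_tot1 ?cospow_totSS //.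
  exact: pi_gt0.
by rewrite mulr_gt0 ?divr_gt0 ?ltr0n // IH.
Qed.

(** Slicing the ball: the section at height [sin th] has radius [cos th], and [dy = cos th dth] adds
    one more cosine. The proof matches two-step recursions. *)
Lemma omegaS k : omega R k.+1 = omega R k * cospow_tot k.+1.
Proof.
elim/ltn_ind: k => -[|[|n]] IH; first by rewrite cospow_tot1 /= mul1r.
  by rewrite cospow_totSS cospow_tot0 /=; field.
rewrite cospow_totSS.
have -> : omega R n.+3 = 2 * pi / n.+3%:R * omega R n.+1 by [].
have -> : omega R n.+2 = 2 * pi / n.+2%:R * omega R n by [].
have h2 : (n.+2%:R : R) != 0 by []; have h3 : (n.+3%:R : R) != 0 by [].
rewrite IH //; move: (n.+2%:R : R) (n.+3%:R : R) h2 h3 => a b a0 b0.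
by field; rewrite a0 b0.
Qed.

Lemma omega_gt0 k : 0 < omega R k.
Proof. by elim: k => [|k IH] //; rewrite omegaS mulr_gt0 ?cospow_tot_gt0. Qed.

Definition inhalf th := (- (pi / 2) <= th <= pi / 2).

Lemma pihalf_ge0 : 0 <= pi / 2 :> R.
Proof. by rewrite divr_ge0 ?pi_ge0. Qed.

Lemma cos_ge0_half th : inhalf th -> 0 <= cos th.
Proof. by move=> h; exact: cos_ge0_pihalf. Qed.

Lemma sin_homo_half a b : a <= b -> - (pi / 2) <= a -> b <= pi / 2 -> sin a <= sin b :> R.
Proof.
move=> ab ha hb; apply: (is_derive_ge0_homo sin cos) => // x /andP[h1 h2].
by apply: cos_ge0_half; rewrite /inhalf (le_trans ha) ?(le_trans _ hb).
Qed.

Lemma sin_lt_half a b : a < b -> - (pi / 2) <= a -> b <= pi / 2 -> sin a < sin b :> R.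
Proof.
move=> ab ha hb; rewrite lt_neqAle (sin_homo_half _ _ (ltW ab) ha hb) andbT.
apply/eqP => e; move: (ab); rewrite (@sin_inj R a b) ?ltxx // in_itv /=.
  by rewrite ha (le_trans (ltW ab)).
by rewrite hb (le_trans ha (ltW ab)).
Qed.

(* The distribution function, in the angle [th] with [y = sin th], of a coordinate of
   a uniform point of the unit ball in dimension [k]. *)
Definition ballcdf (k : nat) th : R :=
  (cospow_int k th - cospow_int k (- (pi / 2))) / cospow_tot k.

Lemma is_derive_ballcdf k th :
  is_derive th (1:R) (ballcdf k) (cos th ^+ k / cospow_tot k).
Proof.
exact/is_derive_mulconst/is_derive_addconst/is_derive_cospow_int.
Qed.

Lemma ballcdfN k : ballcdf k (- (pi / 2)) = 0.
Proof. by rewrite /ballcdf subrr mul0r. Qed.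

Lemma ballcdf1 k : ballcdf k (pi / 2) = 1.
Proof. by rewrite /ballcdf -/(cospow_tot k) divff // gt_eqF ?cospow_tot_gt0. Qed.

Lemma ballcdf_homo k a b : a <= b -> - (pi / 2) <= a -> b <= pi / 2 ->
  ballcdf k a <= ballcdf k b.
Proof.
move=> ab ha hb; apply: (is_derive_ge0_homo _ (fun th => cos th ^+ k / cospow_tot k)) => //.
  by move=> x _; exact: is_derive_ballcdf.
move=> x /andP[h1 h2]; apply: divr_ge0; last exact/ltW/cospow_tot_gt0.
by apply/exprn_ge0/cos_ge0_half; rewrite /inhalf (le_trans ha) ?(le_trans _ hb).
Qed.

Lemma ballcdf_surj k p : 0 <= p <= 1 -> exists2 th, inhalf th & ballcdf k th = p.
Proof.
move=> hp; apply: (intermediate_value _ (fun th => cos th ^+ k / cospow_tot k)).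
- by have := pihalf_ge0; lra.
- by move=> x _; exact: is_derive_ballcdf.
- by rewrite ballcdfN ballcdf1.
Qed.

Lemma ballcdf_reflect_lt k a b : inhalf a -> inhalf b -> ballcdf k a < ballcdf k b -> a < b.
Proof.
move=> /andP[a1 a2] /andP[b1 b2]; rewrite ltNge; apply: contraNlt => h.
exact: ballcdf_homo.
Qed.

End CosinePowers.

(** * Finite sums and Cauchy-Schwarz *)

Section FsetSums.
Context {R : realType} {T : choiceType}.
Implicit Types (X Y : {fset T}) (F G : T -> R).

Lemma ler_sum_fset X F G : (forall x, x \in X -> F x <= G x) ->
  \sum_(x <- X) F x <= \sum_(x <- X) G x.
Proof. by move=> h; rewrite big_seq [leRHS]big_seq; apply: ler_sum. Qed.

Lemma eq_sum_fset X F G : (forall x, x \in X -> F x = G x) ->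
  \sum_(x <- X) F x = \sum_(x <- X) G x.
Proof. by move=> h; rewrite big_seq [RHS]big_seq; apply: eq_bigr. Qed.

Lemma sumr_fset_ge0 X F : (forall x, x \in X -> 0 <= F x) -> 0 <= \sum_(x <- X) F x.
Proof. by move=> h; rewrite big_seq; apply: sumr_ge0. Qed.

Lemma sumr_fset_const X (c : R) : \sum_(x <- X) c = #|` X|%:R * c.
Proof. by rewrite big_const_seq count_predT iter_addr_0 mulr_natl. Qed.

Lemma sum_indic_card X (P : pred T) :
  \sum_(x <- X) (P x)%:R = #|` [fset x in X | P x]%fset|%:R :> R.
Proof.
rewrite -[RHS]mulr1 -sumr_fset_const -big_fset_condE /= [RHS]big_mkcond /=.
by apply: eq_bigr => x _; case: (P x).
Qed.

Lemma ler_sum_fset_incl X Y F : {subset X <= Y} ->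
  (forall x, x \in Y -> x \notin X -> 0 <= F x) -> \sum_(x <- X) F x <= \sum_(x <- Y) F x.
Proof.
move=> sXY h; rewrite [leRHS](big_fsetID _ (mem X)) /=.
have -> : [fset x in Y | x \in X]%fset = X.
  by apply/fsetP => x; rewrite !inE /= andbC; case: (boolP (x \in X)) => // /sXY.
by rewrite lerDl; apply: sumr_fset_ge0 => x; rewrite !inE /= => /andP[]; exact: h.
Qed.

Lemma ler_sum_term X F a : a \in X -> (forall x, x \in X -> 0 <= F x) ->
  F a <= \sum_(x <- X) F x.
Proof.
move=> aX h; rewrite (big_fsetD1 a) //= lerDl; apply: sumr_fset_ge0 => x.
by rewrite !inE => /andP[_]; exact: h.
Qed.

Lemma sum_image_le (S : choiceType) (X : {fset T}) (Y : {fset S}) (h : T -> S) (F : S -> R) :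
  {in X &, injective h} -> (forall x, x \in X -> h x \in Y) -> (forall y, y \in Y -> 0 <= F y) ->
  \sum_(x <- X) F (h x) <= \sum_(y <- Y) F y.
Proof.
move=> hi hXY F0.
have -> : \sum_(x <- X) F (h x) = \sum_(y <- [fset h x | x in X]%fset) F y.
  by rewrite big_imfset.
have sub : {subset [fset h x | x in X]%fset <= Y} by move=> y /imfsetP[x /= xX ->]; exact: hXY.
rewrite [leRHS](big_fsetID _ (mem [fset h x | x in X]%fset)) /=.
have -> : [fset x in Y | x \in [fset h x | x in X]%fset]%fset = [fset h x | x in X]%fset.
  by apply/fsetP => y; rewrite !inE /= andbC; case: (boolP (y \in _)) => // /sub.
by rewrite lerDl big_seq; apply: sumr_ge0 => y; rewrite !inE /= => /andP[/F0].
Qed.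

Lemma card_le_inj (S : choiceType) (X : {fset T}) (Y : {fset S}) (h : T -> S) :
  {in X &, injective h} -> (forall x, x \in X -> h x \in Y) -> (#|` X| <= #|` Y|)%N.
Proof.
move=> hi hXY; have /eqP <- : #|` [fset h x | x in X]%fset| == #|` X| by apply/card_in_imfsetP.
by apply/fsubset_leq_card/fsubsetP => y /imfsetP[x /= xX ->]; exact: hXY.
Qed.

Lemma cauchy_schwarz_fset X F G :
  (\sum_(x <- X) F x * G x) ^+ 2 <= (\sum_(x <- X) F x ^+ 2) * (\sum_(x <- X) G x ^+ 2).
Proof.
set a := \sum_(x <- X) F x ^+ 2; set b := \sum_(x <- X) F x * G x.
set c := \sum_(x <- X) G x ^+ 2.
have key t : 0 <= t ^+ 2 * a + 2 * t * b + c.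
  have -> : t ^+ 2 * a + 2 * t * b + c = \sum_(x <- X) (t * F x + G x) ^+ 2.
    rewrite /a /b /c !mulr_sumr -!big_split /=; apply: eq_bigr => x _; ring.
  by apply: sumr_ge0 => x _; exact: sqr_ge0.
have a0 : 0 <= a by apply: sumr_ge0 => x _; exact: sqr_ge0.
have [az|an0] := eqVneq a 0.
  have F0 x : x \in X -> F x = 0.
    move=> xX; apply/eqP; rewrite -sqrf_eq0 eq_le sqr_ge0 andbT -az.
    by apply: (ler_sum_term _ (fun x => F x ^+ 2)) => // y _; exact: sqr_ge0.
  by rewrite /b (eq_sum_fset _ _ (fun=> 0)) => [|x /F0 ->]; rewrite ?mul0r // big1 // az mul0r expr0n.
have ap : 0 < a by rewrite lt_neqAle eq_sym an0.
have := key (- b / a).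
have -> : (- b / a) ^+ 2 * a + 2 * (- b / a) * b + c = c - b ^+ 2 / a by field.
by rewrite subr_ge0 ler_pdivrMr // mulrC.
Qed.

End FsetSums.

(** * Slices and entry points of a lattice set *)

Section Lattice.
Context {R : realType} {d : nat}.
Implicit Types (X Y : {fset pt d}) (x y : pt d) (i j : 'I_d).

Definition ev j : pt d := delta_mx ord0 j.

Lemma ev_coord j i : ev j ord0 i = (i == j)%:R.
Proof. by rewrite /ev mxE eqxx. Qed.

Lemma subev_coord x j i : (x - ev j) ord0 i = x ord0 i - (i == j)%:R.
Proof. by rewrite !mxE eqxx. Qed.

Lemma addev_coord x j i : (x + ev j) ord0 i = x ord0 i + (i == j)%:R.
Proof. by rewrite !mxE eqxx. Qed.

Lemma subev_same x j : (x - ev j) ord0 j = x ord0 j - 1.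
Proof. by rewrite subev_coord eqxx. Qed.

Lemma subev_other x i j : i != j -> (x - ev j) ord0 i = x ord0 i.
Proof. by move=> /negPf h; rewrite subev_coord h subr0. Qed.

(* The number of points of [X] through which a lattice line in direction [j] enters [X]. *)
Definition entries X j : R := \sum_(x <- X) (x - ev j \notin X)%:R.

Definition slice X i (t : int) : {fset pt d} := [fset x in X | x ord0 i == t]%fset.

Lemma in_slice X i t x : (x \in slice X i t) = (x \in X) && (x ord0 i == t).
Proof. by rewrite !inE. Qed.

Lemma sum_slice X i t (F : pt d -> R) :
  \sum_(x <- slice X i t) F x = \sum_(x <- X | x ord0 i == t) F x.
Proof. by rewrite [RHS]big_fset_condE. Qed.

Lemma slice_decomp X i : exists (t0 : int) (n : nat),
  (forall x, x \in X -> exists2 k : nat, (k < n)%N & x ord0 i = t0 + k%:Z) /\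
  forall F : pt d -> R, \sum_(x <- X) F x = \sum_(k < n) \sum_(x <- slice X i (t0 + k%:Z)) F x.
Proof.
pose K : nat := (\sum_(x <- X) absz (x ord0 i))%N.
have bd x : x \in X -> (`|x ord0 i| <= K)%N.
  by move=> xX; rewrite /K (big_fsetD1 x) //=; exact: leq_addr.
have rep x : x \in X -> exists2 k : nat, (k < K.*2.+1)%N & x ord0 i = - K%:Z + k%:Z.
  move=> /bd h; exists (absz (x ord0 i + K%:Z)%R); first by lia.
  lia.
exists (- K%:Z), K.*2.+1; split => // F.
transitivity (\sum_(x <- X) \sum_(k < K.*2.+1) (if x ord0 i == - K%:Z + k%:Z then F x else 0)).
  apply: eq_sum_fset => x /rep[k hk e].
  rewrite (bigD1 (Ordinal hk)) //= e eqxx big1 ?addr0 // => l.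
  rewrite -val_eqE /= => hl; case: eqP => // /addrI [e2].
  by rewrite e2 eqxx in hl.
rewrite exchange_big /=; apply: eq_bigr => k _.
by rewrite sum_slice [RHS]big_mkcond.
Qed.

Lemma entries_ge0 X j : 0 <= entries X j.
Proof. by apply: sumr_ge0 => x _. Qed.

Lemma entries_slice X i j t : i != j ->
  entries (slice X i t) j = \sum_(x <- slice X i t) (x - ev j \notin X)%:R.
Proof.
move=> ij; apply: eq_sum_fset => x; rewrite in_slice => /andP[_ xt].
by rewrite in_slice subev_other // xt andbT.
Qed.

(** A lattice line meeting the slice has entered [X] at that level or below, and distinct points of
    the slice lie on distinct lines. *)
Lemma card_slice_le_entries X i t : #|` slice X i t|%:R <= entries X i.
Proof.
have [t0 [n [rep _]]] := slice_decomp X i.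
(* Levels are counted from [t0 - 1], so that the recursion starts at an empty slice. *)
pose g k := \sum_(x <- slice X i (t0 - 1 + k%:Z)) (x - ev i \notin X)%:R : R.
have step k : #|` slice X i (t0 - 1 + k.+1%:Z)|%:R <= #|` slice X i (t0 - 1 + k%:Z)|%:R + g k.+1.
  rewrite -[leLHS]mulr1 -sumr_fset_const.
  apply: (@le_trans _ _ (\sum_(x <- slice X i (t0 - 1 + k.+1%:Z))
     ((x - ev i \in X)%:R + (x - ev i \notin X)%:R))).
    by apply: ler_sum_fset => x _; case: (_ \in X); rewrite ?addr0 ?add0r.
  rewrite big_split /= lerD2r sum_indic_card ler_nat.
  apply: (card_le_inj _ _ _ (fun x => x - ev i)); first by move=> x y _ _ /addIr.
  move=> x; rewrite !inE /= => /andP[/andP[_ /eqP xt] hX].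
  by rewrite hX subev_same xt /=; apply/eqP; lia.
have acc k : #|` slice X i (t0 - 1 + k%:Z)|%:R <= \sum_(l < k.+1) g l.
  elim: k => [|k IH].
    rewrite big_ord1 /g.
    suff -> : slice X i (t0 - 1 + 0%:Z) = fset0.
      by rewrite cardfs0; apply: sumr_ge0 => x _.
    apply/fsetP => x; rewrite in_slice in_fset0; apply/negP => /andP[/rep[k _ ->] /eqP].
    lia.
  by rewrite big_ord_recr /=; apply: le_trans (step k) _; rewrite lerD2r.
have tot k : \sum_(l < k) g l <= entries X i.
  rewrite /entries /g; under eq_bigr do rewrite sum_slice big_mkcond /=.
  rewrite exchange_big /=; apply: ler_sum_fset => x xX.
  have [h|h] := boolP (x - ev i \in X).
    by rewrite big1 // => l _; rewrite if_same.
  rewrite -big_mkcond /= sumr_const ler_nat.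
  have : (#|[pred l : 'I_k | (x ord0 i == t0 - 1 + l%:Z)%R]| <= 1)%N.
    apply/card_le1_eqP => l m; rewrite !inE => /eqP hl /eqP hm.
    by apply/val_inj => /=; lia.
  by [].
have [e|] := eqVneq (slice X i t) fset0; first by rewrite e cardfs0 entries_ge0.
case/fset0Pn => x; rewrite in_slice => /andP[/rep[k _ ->] /eqP <-].
have -> : t0 + k%:Z = t0 - 1 + k.+1%:Z by lia.
exact: le_trans (acc _) (tot _).
Qed.

End Lattice.
Arguments ev {d} j.

(** * The Knothe map *)

Section BallCells.
Context {R : realType}.
Implicit Types th : R.

Lemma cos_gt0_between (a b c : R) : inhalf a -> inhalf b -> a < c < b -> 0 < cos c.
Proof.
move=> /andP[a1 a2] /andP[b1 b2] /andP[ac cb]; apply: cos_gt0_pihalf.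
by rewrite (le_lt_trans a1) ?(lt_le_trans cb).
Qed.

Lemma ballcdf_lt k (a b : R) : inhalf a -> inhalf b -> a < b -> ballcdf k a < ballcdf k b.
Proof.
move=> ha hb ab; have [|c hc e] := mean_value (ballcdf k) (fun th => cos th ^+ k / cospow_tot k) a b ab.
  by move=> x _; exact: is_derive_ballcdf.
rewrite -subr_gt0 e mulr_gt0 ?subr_gt0 // divr_gt0 ?cospow_tot_gt0 // exprn_gt0 //.
exact: cos_gt0_between hc.
Qed.

Lemma ballcdf_reflect_le k (a b : R) : inhalf a -> inhalf b -> ballcdf k a <= ballcdf k b -> a <= b.
Proof.
move=> ha hb h; rewrite leNgt; apply/negP => ba.
by have := ballcdf_lt k _ _ hb ha ba; rewrite ltNge h.
Qed.

(** A primitive of the second moment density of a coordinate under [ballcdf k], since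
    [sin^2 cos^k = cos^k - cos^(k+2)]. *)
Definition ballmom (k : nat) th : R := (cospow_int k th - cospow_int k.+2 th) / cospow_tot k.

Lemma is_derive_ballmom k th :
  is_derive th (1:R) (ballmom k) (sin th ^+ 2 * cos th ^+ k / cospow_tot k).
Proof.
apply: is_derive_congr.
  apply: is_derive_mulconst; apply: is_derive_add; first exact: is_derive_cospow_int.
  exact/is_derive_opp/is_derive_cospow_int.
by rewrite sin2cos2 !exprS; ring.
Qed.

Lemma ballmom_homo k (a b : R) : inhalf a -> inhalf b -> a <= b -> ballmom k a <= ballmom k b.
Proof.
move=> /andP[h1 _] /andP[_ h2] ab.
apply: (is_derive_ge0_homo _ (fun th => sin th ^+ 2 * cos th ^+ k / cospow_tot k)) => //.
  by move=> x _; exact: is_derive_ballmom.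
move=> x /andP[x1 x2]; rewrite divr_ge0 ?(ltW (cospow_tot_gt0 _)) // mulr_ge0 ?sqr_ge0 //.
by apply/exprn_ge0/cos_ge0_half; rewrite /inhalf (le_trans h1) ?(le_trans x2).
Qed.

Lemma ballmom_tot k : ballmom k (pi / 2) - ballmom k (- (pi / 2)) = k.+2%:R^-1.
Proof.
have -> : ballmom k (pi / 2) - ballmom k (- (pi / 2)) = (cospow_tot k - cospow_tot k.+2) / cospow_tot k.
  by rewrite /ballmom /cospow_tot; ring.
rewrite cospow_totSS; have t0 := gt_eqF (@cospow_tot_gt0 R k).
have h : (k.+2%:R : R) != 0 by [].
rewrite -[k.+1%:R in LHS](addrK 1) -mulrSr.
by move: (cospow_tot k) (k.+2%:R : R) t0 h => a b /negbT a0 b0; field; rewrite a0 b0.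
Qed.

(** Cauchy's mean value theorem for [ballcdf] against [sin] finds a height [c] whose section, of
    radius [cos c], times the height of the cell is exactly the mass of the cell. Mapping the slice
    to the ball of that radius keeps the product of difference quotients exact. Squares of sines
    inside a cell differ by at most twice its height, which gives the last two bounds. *)
Lemma ballcell n (a b : R) : inhalf a -> inhalf b -> a < b ->
  let p := ballcdf n.+1 b - ballcdf n.+1 a in
  exists c, [/\ a < c < b, 0 < cos c, p = (sin b - sin a) * cos c ^+ n / cospow_tot n.+1,
    sin c ^+ 2 * p <= (ballmom n.+1 b - ballmom n.+1 a) + 2 * (sin b - sin a) * p
  & sin b ^+ 2 <= sin c ^+ 2 + 2 * (sin b - sin a)].
Proof.
move=> ha hb ab p; have hac x : a < x < b -> 0 < cos x by exact: cos_gt0_between.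
have [a1 b2] : - (pi / 2) <= a /\ b <= pi / 2 by move: ha hb => /andP[? _] /andP[_ ?].
have hs x : a < x < b -> sin a <= sin x <= sin b.
  by case/andP=> ax xb; rewrite !sin_homo_half ?(ltW ax) ?(ltW xb) // ?(le_trans _ b2) ?(ltW xb) // (le_trans a1) ?(ltW ax).
have sb x y : a < x < b -> a < y < b -> sin x ^+ 2 <= sin y ^+ 2 + 2 * (sin b - sin a).
  move=> /hs hx /hs hy; have := sin_le1 x; have := sin_geN1 x; have := sin_le1 y; have := sin_geN1 y.
  move=> *; rewrite -subr_ge0.
  suff : (sin x - sin y) * (sin x + sin y) <= 2 * (sin b - sin a) by lra.
  apply: le_trans (ler_norm _) _; rewrite normrM mulrC; apply: ler_pM => //.
    rewrite ler_norml; lra.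
  rewrite ler_norml; lra.
have [|c hc e] := cauchy_mean_value (ballcdf n.+1) (fun th => cos th ^+ n.+1 / cospow_tot n.+1) sin cos a b ab.
  by move=> x _; exact: is_derive_ballcdf.
have [||c' hc' e'] := cauchy_mean_value (ballcdf n.+1) (fun th => cos th ^+ n.+1 / cospow_tot n.+1)
   (ballmom n.+1) (fun th => sin th ^+ 2 * cos th ^+ n.+1 / cospow_tot n.+1) a b ab.
- by move=> x _; exact: is_derive_ballcdf.
- by move=> x _; exact: is_derive_ballmom.
have cc := hac _ hc; have cc' := hac _ hc'.
have p0 : 0 < p by rewrite subr_gt0 ballcdf_lt.
exists c; split => //.
- apply: (mulIf (lt0r_neq0 cc)); rewrite e exprS; ring.
- have -> : ballmom n.+1 b - ballmom n.+1 a = sin c' ^+ 2 * p.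
    have g0 : 0 < cos c' ^+ n.+1 / cospow_tot n.+1 by rewrite divr_gt0 ?cospow_tot_gt0 // exprn_gt0.
    apply: (mulIf (lt0r_neq0 g0)); rewrite -e' /p; ring.
  rewrite -mulrDl; apply: ler_wpM2r; [exact: ltW | exact: sb].
- have /hs h1 := hc; have := sin_le1 b; have := sin_geN1 b; have := sin_le1 c; have := sin_geN1 c.
  move=> *; suff : (sin b - sin c) * (sin b + sin c) <= 2 * (sin b - sin a) by lra.
  rewrite mulrC; apply: le_trans (ler_norm _) _; rewrite normrM; apply: ler_pM => //.
    rewrite ler_norml; lra.
  rewrite ler_norml; lra.
Qed.

End BallCells.

Section Knothe.
Context {R : realType} {d : nat}.
Implicit Types (X Y : {fset pt d}) (x y : pt d) (i j : 'I_d) (s : seq 'I_d).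
Implicit Types (T : 'I_d -> pt d -> R) (rho : R).

Lemma telescope_int (f : int -> R) (t0 : int) n :
  \sum_(k < n) (f (t0 + k%:Z) - f (t0 + k%:Z - 1)) = f (t0 + n%:Z - 1) - f (t0 - 1).
Proof.
elim: n => [|n IH]; first by rewrite big_ord0 addr0 subrr.
rewrite big_ord_recr /= IH.
have -> : t0 + n.+1%:Z - 1 = t0 + n%:Z by lia.
ring.
Qed.

Definition cumul Y i (t : int) : R := \sum_(x <- Y) ((x ord0 i <= t)%R)%:R.

Lemma cumul_slice Y i t : cumul Y i t = cumul Y i (t - 1) + #|` slice Y i t|%:R.
Proof.
rewrite /slice -sum_indic_card -big_split /=; apply: eq_bigr => x _.
have -> : (x ord0 i <= t - 1) = (x ord0 i < t) by lia.
by case: (ltgtP (x ord0 i) t) => _; rewrite ?addr0 ?add0r.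
Qed.

Lemma cumul_ge0 Y i t : 0 <= cumul Y i t.
Proof. by apply: sumr_ge0. Qed.

Lemma cumul_le_card Y i t : cumul Y i t <= #|` Y|%:R.
Proof.
rewrite -[leRHS]mulr1 -sumr_fset_const; apply: ler_sum => x _.
by case: (x ord0 i <= t); rewrite ?lexx ?ler01.
Qed.

Lemma cumul_homo Y i t t' : t <= t' -> cumul Y i t <= cumul Y i t'.
Proof.
move=> h; apply: ler_sum => x _; rewrite ler_nat.
by case: (leP (x ord0 i) t) => // h2; rewrite (le_trans h2 h).
Qed.

Definition backdiff T j x : R := T j x - T j (x - ev j).

(** A triangular map has the product of its diagonal as Jacobian, here with backward differences in
    place of derivatives. The bound on [T] is required off [Y] too, because a difference at an entry
    point uses a value outside. [size s / (size s + 2)] is the mean of [|y|^2] over the unit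
    ball. *)
Definition knothe_field s Y rho T : Prop :=
  [/\ forall j x, `|T j x| <= rho,
      forall j x, j \in s -> x \in Y -> 0 < backdiff T j x,
      forall x, x \in Y ->
        \prod_(j <- s) backdiff T j x = omega R (size s) * rho ^+ size s / #|` Y|%:R,
      \sum_(x <- Y) \sum_(j <- s) T j x ^+ 2
        <= #|` Y|%:R * ((size s)%:R / (size s).+2%:R) * rho ^+ 2
           + 4 * rho * \sum_(x <- Y) \sum_(j <- s) backdiff T j x
    & forall j, j \in s -> \sum_(x <- Y) backdiff T j x <= 2 * rho * entries Y j].

(** The first coordinate rearranges the slice masses monotonically onto the ball; each slice is then
    sent by induction to the ball of radius [rho * cos (c t)], with [c t] the height from
    [ballcell]. *)
Lemma knothe_cons i s Y rho : i \notin s -> 0 < rho -> Y != fset0 ->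
  (forall t rho', slice Y i t != fset0 -> 0 < rho' ->
     exists T, knothe_field s (slice Y i t) rho' T) ->
  exists T (th : int -> R), [/\ knothe_field (i :: s) Y rho T,
    forall t, inhalf (th t) /\ ballcdf (size s).+1 (th t) = cumul Y i t / #|` Y|%:R
  & forall x, T i x = rho * sin (th (x ord0 i))].
Proof.
move=> nis rho0 Y0 IH; pose n := size s; pose N : R := #|` Y|%:R.
have N0 : 0 < N by rewrite ltr0n cardfs_gt0.
pose m t : R := #|` slice Y i t|%:R.
have /choice[th hth] : forall t, exists th, inhalf th /\ ballcdf n.+1 th = cumul Y i t / N.
  move=> t; have [|th h1 h2] := ballcdf_surj n.+1 (cumul Y i t / N); last by exists th.
  by rewrite divr_ge0 ?cumul_ge0 ?(ltW N0) //= ler_pdivrMr // mul1r cumul_le_card.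
have thh t : inhalf (th t) by case: (hth t).
have th_homo t : th (t - 1) <= th t.
  apply: (ballcdf_reflect_le n.+1) => //; rewrite (hth _).2 (hth _).2.
  by rewrite ler_pM2r ?invr_gt0 // cumul_homo //; lia.
have th_lt t : slice Y i t != fset0 -> th (t - 1) < th t.
  move=> h; apply: (ballcdf_reflect_lt n.+1) => //; rewrite (hth _).2 (hth _).2.
  by rewrite ltr_pM2r ?invr_gt0 // [ltRHS]cumul_slice ltrDl ltr0n cardfs_gt0.
pose D t := sin (th t) - sin (th (t - 1)).
pose DH t := ballmom n.+1 (th t) - ballmom n.+1 (th (t - 1)).
have D0 t : 0 <= D t.
  have /andP[h1 _] := thh (t - 1); have /andP[_ h2] := thh t.
  by rewrite subr_ge0 sin_homo_half.
have DH0 t : 0 <= DH t by rewrite subr_ge0 ballmom_homo.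
have /choice[c hc] : forall t, exists c, slice Y i t != fset0 ->
   [/\ 0 < cos c, m t / N = D t * cos c ^+ n / cospow_tot n.+1,
       sin c ^+ 2 * (m t / N) <= DH t + 2 * D t * (m t / N) & sin (th t) ^+ 2 <= sin c ^+ 2 + 2 * D t].
  (* Empty slices get an arbitrary height, and below the zero field. *)
  move=> t; have [e|h] := eqVneq (slice Y i t) fset0; first by exists 0.
  have [c] := ballcell n _ _ (thh _) (thh _) (th_lt _ h).
  have -> : ballcdf n.+1 (th t) - ballcdf n.+1 (th (t - 1)) = m t / N.
    by rewrite (hth _).2 (hth _).2 [cumul Y i t]cumul_slice; ring.
  by case=> *; exists c.
have /choice[T' hT'] : forall t, exists T', (forall j x, `|T' j x| <= rho) /\
   (slice Y i t != fset0 -> knothe_field s (slice Y i t) (rho * cos (c t)) T').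
  move=> t; have [e|h] := eqVneq (slice Y i t) fset0.
    by exists (fun _ _ => 0); split => // j x; rewrite normr0 ltW.
  have [c0 _ _ _] := hc _ h; have [|T' k] := IH t (rho * cos (c t)) h; first exact: mulr_gt0.
  exists T'; split => // j x; case: k => /(_ j x) k _ _ _ _; apply: le_trans k _.
  by rewrite ler_piMr ?(ltW rho0) // cos_le1.
pose T j x := if j == i then rho * sin (th (x ord0 i)) else T' (x ord0 i) j x.
have Ti x : T i x = rho * sin (th (x ord0 i)) by rewrite /T eqxx.
have bdi x : backdiff T i x = rho * D (x ord0 i) by rewrite /backdiff !Ti subev_same -mulrBr.
have Tj j x : j \in s -> T j x = T' (x ord0 i) j x.
  by move=> js; rewrite /T; case: eqP => // e; rewrite -e js in nis.
have nj j : j \in s -> i != j by move=> js; apply: contraNneq nis => ->.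
have bdj j x : j \in s -> backdiff T j x = backdiff (T' (x ord0 i)) j x.
  by move=> js; rewrite /backdiff !Tj // subev_other // nj.
have inY x : x \in Y -> x \in slice Y i (x ord0 i) by move=> xY; rewrite in_slice xY eqxx.
have sl0 x t : x \in slice Y i t -> slice Y i t != fset0.
  by move=> h; apply/fset0Pn; exists x.
exists T, th; split => //; split.
- move=> j x; rewrite /T; case: eqP => _; last exact: (hT' _).1.
  rewrite normrM (gtr0_norm rho0) ler_piMr ?(ltW rho0) // ler_norml.
  by rewrite sin_geN1 sin_le1.
- move=> j x; rewrite inE => /predU1P[->|js] xY.
    rewrite bdi mulr_gt0 // subr_gt0; have h := th_lt _ (sl0 _ _ (inY _ xY)).
    by have /andP[? _] := thh (x ord0 i - 1); have /andP[_ ?] := thh (x ord0 i); apply: sin_lt_half.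
  by rewrite bdj //; have [_ /(_ j x js (inY _ xY))] := (hT' (x ord0 i)).2 (sl0 _ _ (inY _ xY)).
- move=> x xY; rewrite big_cons bdi; have h := sl0 _ _ (inY _ xY).
  have -> : \prod_(j <- s) backdiff T j x = \prod_(j <- s) backdiff (T' (x ord0 i)) j x.
    by rewrite big_seq [RHS]big_seq; apply: eq_bigr => j js; rewrite bdj.
  have [_ _ /(_ _ (inY _ xY)) -> _ _] := (hT' (x ord0 i)).2 h.
  rewrite -[size (i :: s)]/n.+1 -/n -/N -/(m _) omegaS exprMn exprS.
  have [c0 e _ _] := hc _ h.
  have m0 : m (x ord0 i) != 0 by rewrite /m pnatr_eq0 -lt0n cardfs_gt0.
  have t0 : cospow_tot n.+1 != 0 :> R by rewrite gt_eqF // cospow_tot_gt0.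
  have e2 : D (x ord0 i) * cos (c (x ord0 i)) ^+ n = m (x ord0 i) / N * cospow_tot n.+1 by rewrite e divfK.
  transitivity (rho * (omega R n * rho ^+ n) * (D (x ord0 i) * cos (c (x ord0 i)) ^+ n) / m (x ord0 i)); first ring.
  by rewrite e2; have N00 := lt0r_neq0 N0; field; rewrite N00.
- have [t0 [n0 [rep dec]]] := @slice_decomp R d Y i.
  rewrite /= -/n -/N; set kap : R := n%:R / n.+2%:R.
  have kap01 : 1 - kap = 2 / n.+2%:R.
    rewrite /kap; have : (n.+2%:R : R) != 0 by [].
    by rewrite -[n.+2]addn2 natrD => h; field.
  (* Per point the moment is [rho^2 (sin^2 + kap cos^2) = rho^2 (kap + (1 - kap) sin^2)] up to the
     cell error. The [sin^2] part adds up to at most [N / (n+3)], and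
     [kap + (1 - kap) / (n+3) = (n+1) / (n+3)]. *)
  have key t : \sum_(x <- slice Y i t) \sum_(j <- i :: s) T j x ^+ 2 <=
      m t * rho ^+ 2 * kap + (1 - kap) * rho ^+ 2 * N * DH t
      + 4 * rho * \sum_(x <- slice Y i t) \sum_(j <- i :: s) backdiff T j x.
    have k1 : 0 <= 1 - kap by rewrite kap01 divr_ge0.
    have [e|h] := eqVneq (slice Y i t) fset0.
      rewrite /m e cardfs0 !big_seq_fset0 !mul0r mulr0 add0r addr0.
      by apply: mulr_ge0 (DH0 t); apply: mulr_ge0 (ltW N0); apply: mulr_ge0 k1 (sqr_ge0 _).
    have [c0 e1 e2 e3] := hc _ h.
    have [_ pos _ mom _] := (hT' t).2 h.
    have xt x : x \in slice Y i t -> x ord0 i = t by rewrite in_slice => /andP[_ /eqP].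
    have -> : \sum_(x <- slice Y i t) \sum_(j <- i :: s) T j x ^+ 2 =
       m t * (rho ^+ 2 * sin (th t) ^+ 2) + \sum_(x <- slice Y i t) \sum_(j <- s) T' t j x ^+ 2.
      rewrite /m -sumr_fset_const -big_split /=; apply: eq_sum_fset => x /xt ex.
      rewrite big_cons Ti ex exprMn; congr (_ + _).
      by rewrite big_seq [RHS]big_seq; apply: eq_bigr => j js; rewrite Tj // ex.
    have -> : \sum_(x <- slice Y i t) \sum_(j <- i :: s) backdiff T j x =
       m t * (rho * D t) + \sum_(x <- slice Y i t) \sum_(j <- s) backdiff (T' t) j x.
      rewrite /m -sumr_fset_const -big_split /=; apply: eq_sum_fset => x /xt ex.
      rewrite big_cons bdi ex; congr (_ + _).
      by rewrite big_seq [RHS]big_seq; apply: eq_bigr => j js; rewrite bdj // ex.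
    move: mom; rewrite -/n -/(m t) -/kap.
    set A := \sum_(x <- _) _; set B := \sum_(x <- _) _ => mom.
    have B0 : 0 <= B.
      apply: sumr_fset_ge0 => x hx; rewrite big_seq; apply: sumr_ge0 => j js.
      exact/ltW/pos.
    have m0 : 0 <= m t by rewrite /m ler0n.
    have r2 : 0 <= rho ^+ 2 by rewrite sqr_ge0.
    have i1 : A <= m t * kap * rho ^+ 2 * (1 - sin (c t) ^+ 2) + 4 * rho * B.
      apply: le_trans mom _; rewrite -cos2sin2; apply: lerD.
        by rewrite exprMn !mulrA.
      by rewrite ler_wpM2r // ler_wpM2l // ler_piMr ?(ltW rho0) // cos_le1.
    have i2 : m t * (rho ^+ 2 * sin (th t) ^+ 2) <= m t * rho ^+ 2 * (sin (c t) ^+ 2 + 2 * D t).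
      by rewrite mulrA ler_wpM2l // mulr_ge0.
    have i3 : m t * sin (c t) ^+ 2 <= N * DH t + 2 * D t * m t.
      have := ler_wpM2l (ltW N0) e2; rewrite mulrDr.
      have -> : N * (sin (c t) ^+ 2 * (m t / N)) = m t * sin (c t) ^+ 2.
        by have N00 := lt0r_neq0 N0; field.
      by have -> : N * (2 * D t * (m t / N)) = 2 * D t * m t
        by have N00 := lt0r_neq0 N0; field.
    have i4 := ler_wpM2l (mulr_ge0 k1 r2) i3.
    have i5 : kap * (m t * rho ^+ 2 * D t) >= 0.
      by rewrite mulr_ge0 ?divr_ge0 // mulr_ge0 // mulr_ge0.
    apply: le_trans (lerD i2 i1) _.
    have -> : m t * rho ^+ 2 * (sin (c t) ^+ 2 + 2 * D t) + (m t * kap * rho ^+ 2 * (1 - sin (c t) ^+ 2) + 4 * rho * B)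
      = m t * rho ^+ 2 * kap + (1 - kap) * rho ^+ 2 * (m t * sin (c t) ^+ 2) + 2 * (m t * rho ^+ 2 * D t) + 4 * rho * B by ring.
    have -> : 4 * rho * (m t * (rho * D t) + B) = 4 * (m t * rho ^+ 2 * D t) + 4 * rho * B by ring.
    have e4 : (1 - kap) * rho ^+ 2 * (N * DH t + 2 * D t * m t) =
      (1 - kap) * rho ^+ 2 * N * DH t + 2 * (m t * rho ^+ 2 * D t) - 2 * (kap * (m t * rho ^+ 2 * D t)) by ring.
    rewrite e4 in i4.
    lra.
  rewrite dec [in X in _ <= X]dec.
  apply: (@le_trans _ _ (\sum_(k < n0) (m (t0 + k%:Z) * rho ^+ 2 * kap + (1 - kap) * rho ^+ 2 * N * DH (t0 + k%:Z)
      + 4 * rho * \sum_(x <- slice Y i (t0 + k%:Z)) \sum_(j <- i :: s) backdiff T j x))).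
    by apply: ler_sum => k _; exact: key.
  rewrite !big_split /= -!mulr_sumr -!mulr_suml lerD2r.
  have -> : \sum_(k < n0) m (t0 + k%:Z) = N.
    rewrite -[N]mulr1 -sumr_fset_const dec; apply: eq_bigr => k _.
    by rewrite sumr_fset_const mulr1.
  have : \sum_(k < n0) DH (t0 + k%:Z) <= n.+3%:R^-1.
    rewrite (telescope_int (fun t => ballmom n.+1 (th t))) -(@ballmom_tot R n.+1).
    have pih := @pihalf_ge0 R.
    have hp : inhalf (pi / 2 : R) by rewrite /inhalf lexx andbT; lra.
    have hm : inhalf (- (pi / 2) : R) by rewrite /inhalf lexx /=; lra.
    apply: lerB; apply: ballmom_homo => //.
      by have /andP[_ ->] := thh (t0 + n0%:Z - 1).
    by have /andP[-> _] := thh (t0 - 1).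
  rewrite kap01 => hDH.
  have h0 : 0 <= 2 / n.+2%:R * rho ^+ 2 * N.
    by rewrite !mulr_ge0 ?divr_ge0 ?(ltW N0) ?exprn_ge0 ?(ltW rho0).
  apply: le_trans (lerD (lexx _) (ler_wpM2l h0 hDH)) _.
  rewrite le_eqVlt; apply/orP; left; apply/eqP; rewrite /kap.
  have h2 : (n.+2%:R : R) != 0 by []. have h3 : (n.+3%:R : R) != 0 by [].
  move: h2 h3; rewrite -[n.+3]addn3 -[n.+2]addn2 -[n.+1]addn1 !natrD => h2 h3.
  by field; rewrite h2 h3.
- have [t0 [n0 [rep dec]]] := @slice_decomp R d Y i.
  move=> j; rewrite inE => /predU1P[->|js].
    (* No slice has more points than there are entries in direction [i], and [sin] grows by at most
       2 in total. *)
    rewrite dec; apply: (@le_trans _ _ (\sum_(k < n0) (rho * entries Y i * D (t0 + k%:Z)))).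
      apply: ler_sum => k _.
      rewrite (eq_sum_fset _ _ (fun=> rho * D (t0 + k%:Z))); last first.
        by move=> x; rewrite in_slice bdi => /andP[_ /eqP ->].
      rewrite sumr_fset_const mulrCA -mulrA ler_wpM2l ?(ltW rho0) // ler_wpM2r //.
      exact: card_slice_le_entries.
    rewrite -mulr_sumr (telescope_int (fun t => sin (th t))).
    rewrite -mulrA mulrCA [leRHS]mulrC mulrA [leRHS]mulrC -!mulrA.
    have h0 : 0 <= rho * entries Y i by rewrite mulr_ge0 ?entries_ge0 ?(ltW rho0).
    have : sin (th (t0 + n0%:Z - 1)) - sin (th (t0 - 1)) <= 2.
      by have := sin_le1 (th (t0 + n0%:Z - 1)); have := sin_geN1 (th (t0 - 1)); lra.
    by move/(ler_wpM2l h0); lra.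
  rewrite dec /entries [in X in _ <= X]dec mulr_sumr; apply: ler_sum => k _.
  set t := t0 + k%:Z.
  have [e|h] := eqVneq (slice Y i t) fset0.
    by rewrite e !big_seq_fset0 mulr0.
  have [_ _ _ _ /(_ j js)] := (hT' t).2 h.
  rewrite entries_slice ?nj // => hh.
  rewrite (eq_sum_fset _ _ (backdiff (T' t) j)); last first.
    by move=> x; rewrite in_slice bdj // => /andP[_ /eqP ->].
  apply: le_trans hh _; apply: ler_wpM2r; first by apply: sumr_ge0.
  by rewrite ler_wpM2l // ler_piMr ?(ltW rho0) // cos_le1.
Qed.

(** The last hypothesis puts [Y] in a translate of the coordinate subspace of [s], so the induction
    ends at a single point, where the empty product is 1. *)
Lemma knothe_exists s Y rho : uniq s -> 0 < rho -> Y != fset0 ->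
  (forall x y j, x \in Y -> y \in Y -> j \notin s -> x ord0 j = y ord0 j) ->
  exists T, knothe_field s Y rho T.
Proof.
elim: s Y rho => [|i s IH] Y rho /=.
  move=> _ rho0 /fset0Pn[x xY] ag.
  have -> : Y = [fset x]%fset.
    apply/fsetP => y; rewrite !inE; apply/idP/eqP => [yY|-> //].
    by apply/matrixP => a b; rewrite ord1; exact: ag.
  exists (fun _ _ => 0); split => //.
  - by move=> j z; rewrite normr0 ltW.
  - by move=> z _; rewrite big_nil cardfs1 /= expr0 mulr1 divr1.
  - have z0 (F : 'I_d -> pt d -> R) : \sum_(z <- [fset x]%fset) \sum_(j <- [::]) F j z = 0.
      by apply: big1 => z _; rewrite big_nil.
    rewrite (z0 (fun j z => 0 ^+ 2)) (z0 (backdiff _)) /= mulr0 addr0.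
    by rewrite mulr_ge0 ?sqr_ge0 // mulr_ge0.
move=> /andP[nis us] rho0 Y0 ag.
have [|T [th [h _ _]]] := knothe_cons i s Y rho nis rho0 Y0; last by exists T.
move=> t rho' h rho'0; apply: IH => // x y j; rewrite !in_slice => /andP[xY /eqP xt] /andP[yY /eqP yt] js.
have [->|ji] := eqVneq j i; first by rewrite xt yt.
by apply: ag => //; rewrite inE negb_or ji.
Qed.

(** Only the first coordinate of a Knothe map depends on its own variable alone. Taking [i] first,
    with a new map for each direction, is what reduces stability to one dimension. *)
Lemma knothe_full Y i rho : 0 < rho -> Y != fset0 ->
  exists T (th : int -> R) (s : seq 'I_d), [/\ perm_eq (i :: s) (enum 'I_d), knothe_field (i :: s) Y rho T,
    forall t, inhalf (th t) /\ ballcdf d (th t) = cumul Y i t / #|` Y|%:R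
  & forall x, T i x = rho * sin (th (x ord0 i))].
Proof.
move=> rho0 Y0; pose s := rem i (enum 'I_d).
have pe : perm_eq (i :: s) (enum 'I_d) by rewrite perm_sym perm_to_rem ?mem_enum.
have /andP[nis us] : uniq (i :: s) by rewrite (perm_uniq pe) enum_uniq.
have sz : (size s).+1 = d by rewrite -[LHS]/(size (i :: s)) (perm_size pe) size_enum_ord.
have [|T [th [h1 h2 h3]]] := knothe_cons i s Y rho nis rho0 Y0.
  move=> t rho' h rho'0; apply: knothe_exists => // x y j.
  rewrite !in_slice => /andP[_ /eqP xt] /andP[_ /eqP yt] js.
  have : j \in i :: s by rewrite (perm_mem pe) mem_enum.
  by rewrite inE (negPf js) orbF => /eqP ->; rewrite xt yt.
by exists T, th, s; split => // t; have := h2 t; rewrite sz.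
Qed.

End Knothe.

(** * The Saint-Venant inequality *)

Section Gap.
Context {R : realType}.

Lemma sqr_normr (x : R) : `|x| ^+ 2 = x ^+ 2.
Proof. exact: real_normK (num_real x). Qed.

(** The AM-GM excess caused by a single factor [t]: up to a constant the smaller of [(t - 1)^2 / t]
    and [|t - 1|], hence quadratic near 1 and only linear far away. *)
Definition gap (n : nat) (t : R) : R :=
  (4 ^+ n)^-1 * (t * Num.min ((t^-1 - 1) ^+ 2) `|t^-1 - 1|).

Lemma gap_ge0 n t : 0 < t -> 0 <= gap n t.
Proof.
move=> t0; rewrite mulr_ge0 ?invr_ge0 ?exprn_ge0 // mulr_ge0 ?(ltW t0) //.
by rewrite le_min sqr_ge0 normr_ge0.
Qed.

Lemma amgm_poly n (s : R) :
  1 + n%:R * s ^+ n.+1 - n.+1%:R * s ^+ n = \sum_(m < n) m.+1%:R * s ^+ m * (s - 1) ^+ 2.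
Proof.
elim: n => [|n IH]; first by rewrite big_ord0 expr0; ring.
by rewrite big_ord_recr /= -IH !exprS; ring.
Qed.

Lemma pow_sub1_le n (s : R) : 0 <= s <= 2 -> `|s ^+ n - 1| <= 2 ^+ n * `|s - 1|.
Proof.
move=> /andP[s0 s2]; suff : `|s ^+ n - 1| <= (2 ^+ n - 1) * `|s - 1|.
  by move/le_trans; apply; rewrite ler_wpM2r // gerBl.
elim: n => [|n IH]; first by rewrite !expr0 !subrr normr0 mul0r.
have -> : s ^+ n.+1 - 1 = s * (s ^+ n - 1) + (s - 1) by rewrite exprS; ring.
apply: le_trans (ler_normD _ _) _; rewrite normrM (ger0_norm s0).
have h : s * `|s ^+ n - 1| <= 2 * ((2 ^+ n - 1) * `|s - 1|) by apply: ler_pM.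
by apply: le_trans (lerD h (lexx _)) _; rewrite [2 ^+ n.+1]exprS; lra.
Qed.

(** By [amgm_poly] the right side has a double root at 1 with positive cofactor. For [s <= 2] the
    lowest term of the cofactor suffices, for [s > 2] the highest; the constant is the square of the
    [2 ^+ n.+1] from [pow_sub1_le]. *)
Lemma amgm_pow_gap n (s : R) : 0 < s ->
  (4 ^+ n.+1)^-1 * Num.min ((s ^+ n.+1 - 1) ^+ 2) `|s ^+ n.+1 - 1|
  <= 1 + n.+1%:R * s ^+ n.+2 - n.+2%:R * s ^+ n.+1.
Proof.
move=> s0; rewrite amgm_poly; set m := Num.min _ _.
have m0 : 0 <= m by rewrite le_min sqr_ge0 normr_ge0.
have t0 (k : 'I_n.+1) : 0 <= k.+1%:R * s ^+ k * (s - 1) ^+ 2.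
  by rewrite mulr_ge0 ?sqr_ge0 // mulr_ge0 // exprn_ge0 // ltW.
have p4 : 0 < (4 : R) ^+ n.+1 by rewrite exprn_gt0.
rewrite mulrC ler_pdivrMr //.
have [s2|s2] := leP s 2.
  apply: (@le_trans _ _ ((s - 1) ^+ 2 * 4 ^+ n.+1)).
    have : m <= (s ^+ n.+1 - 1) ^+ 2 by rewrite ge_min lexx.
    move/le_trans; apply.
    have -> : (s - 1) ^+ 2 * 4 ^+ n.+1 = (2 ^+ n.+1 * `|s - 1|) ^+ 2.
      rewrite exprMn sqr_normr mulrC -exprM mulnC exprM; congr (_ ^+ _ * _); ring.
    rewrite -[leLHS]sqr_normr ler_pXn2r ?nnegrE ?mulr_ge0 ?exprn_ge0 //.
    by apply: pow_sub1_le; rewrite (ltW s0).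
  rewrite ler_pM2r // big_ord_recl /= expr0 !mul1r lerDl.
  by apply: sumr_ge0 => k _; exact: (t0 (lift ord0 k)).
apply: (@le_trans _ _ (s ^+ n * (s - 1) ^+ 2 * 4 ^+ n.+1)); last first.
  rewrite ler_pM2r // big_ord_recr /=.
  apply: (@le_trans _ _ (n.+1%:R * s ^+ n * (s - 1) ^+ 2)).
    rewrite ler_wpM2r ?sqr_ge0 // ler_peMl ?exprn_ge0 ?(ltW s0) //.
    by rewrite ler1n.
  by rewrite lerDr; apply: sumr_ge0 => k _; exact: (t0 (widen_ord (leqnSn n) k)).
have hm : m <= s ^+ n.+1.
  have h1 : 1 <= s ^+ n.+1 by apply: exprn_ege1; lra.
  apply: (@le_trans _ _ `|s ^+ n.+1 - 1|); first by rewrite ge_min lexx orbT.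
  rewrite ger0_norm ?subr_ge0 //; lra.
apply: le_trans hm _; rewrite [s ^+ n.+1]exprSr -!mulrA; apply: ler_wpM2l; first by rewrite exprn_ge0 // ltW.
have h4 : 4 <= (4 : R) ^+ n.+1 by rewrite exprS ler_peMr // exprn_ege1 //; lra.
have h5 : (s - 1) ^+ 2 * 4 <= (s - 1) ^+ 2 * 4 ^+ n.+1.
  by apply: ler_wpM2l h4; exact: sqr_ge0.
rewrite mulrA -expr2; apply: le_trans _ h5.
nra.
Qed.

(** AM-GM on the other factors reduces the claim to one variable [s], their geometric mean, with
    [a i = s^-(d-1)]. *)
Lemma amgm_gap (d : nat) (i : 'I_d) (a : 'I_d -> R) : (2 <= d)%N ->
  (forall j, 0 < a j) -> \prod_j a j = 1 -> gap d (a i) <= \sum_j a j - d%:R.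
Proof.
case: d i a => [|[|n]] // i a _ a0 pr.
pose S := (\sum_(j | j != i) a j) / n.+1%:R.
have S0 : 0 <= S by rewrite divr_ge0 // sumr_ge0 // => j _; exact: ltW.
have card : #|[pred j | j != i]| = n.+1.
  by have := cardC1 i; rewrite card_ord => /= h; rewrite -[RHS]h; apply: eq_card => j; rewrite !inE.
have prS : (a i)^-1 <= S ^+ n.+1.
  have := leif_AGM (A := [pred j | j != i]) (E := a) (fun j _ => ltW (a0 j)).
  rewrite card => -[+ _]; rewrite (bigD1 i) //= in pr.
  have e : \prod_(j | j != i) a j = (a i)^-1.
    by apply: (mulfI (lt0r_neq0 (a0 i))); rewrite pr divff // lt0r_neq0.
  by rewrite e.
pose s := powR (a i)^-1 (n.+1%:R)^-1.
have ai0 : 0 < (a i)^-1 by rewrite invr_gt0.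
have s0 : 0 < s by rewrite powR_gt0.
have es : s ^+ n.+1 = (a i)^-1.
  by rewrite /s -powR_mulrn ?powR_ge0 // -powRrM mulVf // powRr1 // ltW.
have sS : s <= S by rewrite -(@ler_pXn2r _ n.+1) ?nnegrE ?(ltW s0) // es.
have := amgm_pow_gap n s s0; rewrite es => h.
rewrite (bigD1 i) //= -[\sum_(j | _) _](@divfK _ n.+1%:R) // -/S.
have : gap n.+2 (a i) <= a i * (1 + n.+1%:R * s ^+ n.+2 - n.+2%:R * (a i)^-1).
  have m0 : 0 <= Num.min (((a i)^-1 - 1) ^+ 2) `|(a i)^-1 - 1| by rewrite le_min sqr_ge0 normr_ge0.
  rewrite /gap mulrCA ler_pM2l //; apply: le_trans h.
  rewrite ler_wpM2r // lef_pV2 ?posrE ?exprn_gt0 // [leRHS]exprS ler_peMl ?exprn_ge0 //.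
  by lra.
move/le_trans; apply.
have e1 : a i * (a i)^-1 = 1 by rewrite divff // lt0r_neq0.
have -> : a i * (1 + n.+1%:R * s ^+ n.+2 - n.+2%:R * (a i)^-1)
   = a i + n.+1%:R * s * (a i * s ^+ n.+1) - n.+2%:R * (a i * (a i)^-1).
  by rewrite [s ^+ n.+2]exprS; ring.
rewrite es e1 !mulr1 lerD2r lerD2l mulrC ler_wpM2r //.
Qed.

End Gap.

Section Energy.
Context {R : realType} {d : nat}.
Implicit Types (X : {fset pt d}) (x y : pt d) (i j : 'I_d) (u w : pt d -> R).

Definition grad j w y : R := w (y + ev j) - w y.

(** Base points of the edges in direction [j] that meet [X], each edge occurring once. *)
Definition edom X j : {fset pt d} := (X `|` [fset x - ev j | x in X])%fset.

Definition energy X w : R := \sum_(j < d) \sum_(y <- edom X j) grad j w y ^+ 2.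

Lemma in_edom X j y : (y \in edom X j) = (y \in X) || (y + ev j \in X).
Proof.
rewrite inE; congr (_ || _); apply/imfsetP/idP => [[x /= xX ->]|h]; first by rewrite subrK.
by exists (y + ev j) => //; rewrite addrK.
Qed.

Lemma sum_edom_l X j (F : pt d -> R) : (forall x, x \notin X -> F x = 0) ->
  \sum_(y <- edom X j) F y = \sum_(x <- X) F x.
Proof.
move=> F0; apply/esym/big_fset_incl; first exact: fsubsetUl.
by move=> x _; exact: F0.
Qed.

Lemma sum_edom_r X j (F : pt d -> R) : (forall x, x \notin X -> F x = 0) ->
  \sum_(y <- edom X j) F (y + ev j) = \sum_(x <- X) F x.
Proof.
move=> F0; transitivity (\sum_(y <- [fset x - ev j | x in X]%fset) F (y + ev j)).
  apply/esym/big_fset_incl; first exact: fsubsetUr.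
  move=> y _ h; apply: F0; apply: contra h => h; apply/imfsetP.
  by exists (y + ev j) => //=; rewrite addrK.
rewrite big_imfset /=; last by move=> x y _ _ /addIr.
by apply: eq_bigr => x _; rewrite subrK.
Qed.

(** The base points outside [X] are exactly the predecessors of entry points; this is how [entries]
    gets into the estimates. *)
Lemma sum_edom X j (F : pt d -> R) :
  \sum_(y <- edom X j) F y = \sum_(x <- X) F x + \sum_(x <- X) (x - ev j \notin X)%:R * F (x - ev j).
Proof.
have -> : \sum_(x <- X) F x = \sum_(y <- edom X j) (y \in X)%:R * F y.
  rewrite sum_edom_l; last by move=> x /negPf ->; rewrite mul0r.
  by apply: eq_sum_fset => x ->; rewrite mul1r.
have -> : \sum_(x <- X) (x - ev j \notin X)%:R * F (x - ev j) =
   \sum_(y <- edom X j) (y + ev j \in X)%:R * ((y + ev j - ev j \notin X)%:R * F (y + ev j - ev j)).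
  rewrite (sum_edom_r X j (fun x => (x \in X)%:R * ((x - ev j \notin X)%:R * F (x - ev j)))).
    by apply: eq_sum_fset => x ->; rewrite mul1r.
  by move=> x /negPf ->; rewrite mul0r.
rewrite -big_split /=; apply: eq_sum_fset => y; rewrite in_edom addrK => h.
by case: (boolP (y \in X)) h => /= [_ _|_ ->]; rewrite ?mul1r ?mul0r ?mulr0 ?addr0 ?add0r.
Qed.

Lemma sum_by_parts X j w (f : pt d -> R) : (forall x, x \notin X -> w x = 0) ->
  \sum_(x <- X) w x * (f x - f (x - ev j)) = - \sum_(y <- edom X j) grad j w y * f y.
Proof.
move=> w0; have -> : \sum_(x <- X) w x * (f x - f (x - ev j)) =
  \sum_(x <- X) w x * f x - \sum_(x <- X) w x * f (x - ev j).
  by rewrite -sumrB; apply: eq_bigr => x _; rewrite mulrBr.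
have -> : \sum_(x <- X) w x * f x = \sum_(y <- edom X j) w y * f y.
  by rewrite sum_edom_l // => x /w0 ->; rewrite mul0r.
have -> : \sum_(x <- X) w x * f (x - ev j) = \sum_(y <- edom X j) w (y + ev j) * f (y + ev j - ev j).
  by rewrite (sum_edom_r X j (fun x => w x * f (x - ev j))) // => x /w0 ->; rewrite mul0r.
rewrite -sumrB -sumrN; apply: eq_bigr => y _; rewrite addrK /grad; ring.
Qed.

Definition entries_tot X : R := \sum_(j < d) entries X j.

Lemma entries_tot_ge0 X : 0 <= entries_tot X.
Proof. by apply: sumr_ge0 => j _; exact: entries_ge0. Qed.

(** The mean of [|y|^2] over the unit ball of dimension [n]. *)
Definition cdim (n : nat) : R := n%:R / n.+2%:R.

Lemma backdiff_total X i rho : (2 <= d)%N -> 0 < rho -> X != fset0 ->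
  omega R d * rho ^+ d = #|` X|%:R ->
  exists T (th : int -> R), [/\ forall j x, `|T j x| <= rho,
    forall j x, x \in X -> 0 < backdiff T j x,
    forall x, x \in X -> gap d (backdiff T i x) <= \sum_j backdiff T j x - d%:R,
    \sum_j \sum_(x <- X) T j x ^+ 2 <= #|` X|%:R * cdim d * rho ^+ 2 + 8 * rho ^+ 2 * entries_tot X
  & [/\ \sum_j \sum_(x <- X) backdiff T j x <= 2 * rho * entries_tot X,
     forall t, inhalf (th t) /\ ballcdf d (th t) = cumul X i t / #|` X|%:R
  & forall x, T i x = rho * sin (th (x ord0 i))]].
Proof.
move=> hd rho0 X0 vol.
have [T [th [s [pe [bd pos pr mom dv] hth hT]]]] := knothe_full X i rho rho0 X0.
have sz : size (i :: s) = d by rewrite (perm_size pe) size_enum_ord.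
have perms (F : 'I_d -> R) : \sum_(j <- i :: s) F j = \sum_j F j.
  by rewrite (perm_big _ pe) /= big_enum.
have permp (F : 'I_d -> R) : \prod_(j <- i :: s) F j = \prod_j F j.
  by rewrite (perm_big _ pe) /= big_enum.
have mem j : j \in i :: s by rewrite (perm_mem pe) mem_enum.
have N0 : #|` X|%:R != 0 :> R by rewrite pnatr_eq0 cardfs_eq0.
have dvt : \sum_j \sum_(x <- X) backdiff T j x <= 2 * rho * entries_tot X.
  by rewrite /entries_tot mulr_sumr; apply: ler_sum => j _; exact: dv.
exists T, th; split => //.
- by move=> j x xX; exact: pos.
- move=> x xX; apply: (amgm_gap d i (fun j => backdiff T j x)) => //; first by move=> j; exact: pos.
  by have := pr x xX; rewrite permp sz vol divff.
- have permx (F : 'I_d -> pt d -> R) : \sum_(x <- X) \sum_(j <- i :: s) F j x = \sum_(x <- X) \sum_j F j x.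
    by apply: eq_bigr => x _; exact: perms.
  rewrite (permx (fun j x => T j x ^+ 2)) (permx (backdiff T)) sz in mom.
  rewrite exchange_big /=; apply: le_trans mom _; rewrite lerD2l exchange_big /=.
  have -> : 8 * rho ^+ 2 * entries_tot X = 4 * rho * (2 * rho * entries_tot X) by ring.
  by rewrite ler_wpM2l // mulr_ge0 // ltW.
Qed.

(** The squares [(grad w + T)^2] are expanded and the cross term summed by parts: it becomes [w]
    times the divergence of the Knothe field, which exceeds [d] by at least the gap. Both quantities
    in the deficit, a square and the gaps, are kept for the direction [i] only. *)
Lemma saint_venant X w i rho : (2 <= d)%N -> 0 < rho -> X != fset0 ->
  omega R d * rho ^+ d = #|` X|%:R ->
  (forall x, x \notin X -> w x = 0) -> (forall x, 0 <= w x) ->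
  exists th : int -> R, let T0 t := rho * sin (th t) in
  [/\ forall t, inhalf (th t) /\ ballcdf d (th t) = cumul X i t / #|` X|%:R,
      forall x, x \in X -> 0 < T0 (x ord0 i) - T0 (x ord0 i - 1),
      \sum_(x <- X) (T0 (x ord0 i) - T0 (x ord0 i - 1)) <= 2 * rho * entries_tot X
    & 2^-1 * (\sum_(y <- edom X i) (grad i w y + T0 (y ord0 i)) ^+ 2)
      + \sum_(x <- X) w x * gap d (T0 (x ord0 i) - T0 (x ord0 i - 1))
      <= 2^-1 * energy X w - d%:R * \sum_(x <- X) w x
         + 2^-1 * rho ^+ 2 * (#|` X|%:R * cdim d + 9 * entries_tot X)].
Proof.
move=> hd rho0 X0 vol w0 wge.
have [T [th [bd pos gp mom [dv hth hT]]]] := backdiff_total X i rho hd rho0 X0 vol.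
have bdi x : backdiff T i x = rho * sin (th (x ord0 i)) - rho * sin (th (x ord0 i - 1)).
  by rewrite /backdiff !hT subev_same.
exists th; split => //; first by move=> x xX; rewrite -bdi; exact: pos.
  under eq_bigr do rewrite -bdi; apply: le_trans dv; rewrite (bigD1 i) //= lerDl.
  by apply: sumr_ge0 => j _; apply: sumr_fset_ge0 => x xX; exact/ltW/pos.
have e1 : \sum_(x <- X) w x * (\sum_j backdiff T j x) = - \sum_j \sum_(y <- edom X j) grad j w y * T j y.
  under eq_bigr do rewrite mulr_sumr.
  rewrite exchange_big /= -sumrN; apply: eq_bigr => j _; exact: sum_by_parts.
have e2 : \sum_j \sum_(y <- edom X j) (grad j w y + T j y) ^+ 2 =
  energy X w + 2 * (\sum_j \sum_(y <- edom X j) grad j w y * T j y) + \sum_j \sum_(y <- edom X j) T j y ^+ 2.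
  rewrite /energy mulr_sumr -!big_split /=; apply: eq_bigr => j _.
  rewrite mulr_sumr -!big_split /=; apply: eq_bigr => y _; ring.
(* [9 = 8 + 1]: the discretised moment costs 8 per entry, the value of [T] just before an entry
   costs 1. *)
have e3 : \sum_j \sum_(y <- edom X j) T j y ^+ 2 <= rho ^+ 2 * (#|` X|%:R * cdim d + 9 * entries_tot X).
  apply: (@le_trans _ _ (\sum_j \sum_(x <- X) T j x ^+ 2 + rho ^+ 2 * entries_tot X)); last by lra.
  rewrite /entries_tot mulr_sumr -big_split /=; apply: ler_sum => j _.
  rewrite sum_edom lerD2l /entries mulr_sumr; apply: ler_sum_fset => x _.
  rewrite mulrC ler_wpM2r // -sqr_normr ler_pXn2r ?nnegrE ?(ltW rho0) //.
have e4 : \sum_(x <- X) w x * gap d (rho * sin (th (x ord0 i)) - rho * sin (th (x ord0 i - 1))) <=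
   \sum_(x <- X) w x * (\sum_j backdiff T j x) - d%:R * \sum_(x <- X) w x.
  rewrite mulr_sumr -sumrB; apply: ler_sum_fset => x xX; rewrite -bdi.
  by have := ler_wpM2l (wge x) (gp x xX); lra.
have e5 : \sum_(y <- edom X i) (grad i w y + rho * sin (th (y ord0 i))) ^+ 2 <=
   \sum_j \sum_(y <- edom X j) (grad j w y + T j y) ^+ 2.
  rewrite (bigD1 i) //=; under [leLHS]eq_bigr do rewrite -hT.
  by rewrite lerDl; apply: sumr_ge0 => j _; apply: sumr_ge0 => y _; exact: sqr_ge0.
by rewrite e1 in e4; rewrite e2 in e5; lra.
Qed.

Lemma torsion_bound X w rho : (2 <= d)%N -> 0 < rho -> X != fset0 ->
  omega R d * rho ^+ d = #|` X|%:R ->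
  (forall x, x \notin X -> w x = 0) -> (forall x, 0 <= w x) ->
  d%:R * (\sum_(x <- X) w x) <= 2^-1 * energy X w
     + 2^-1 * rho ^+ 2 * (#|` X|%:R * cdim d + 9 * entries_tot X).
Proof.
move=> hd rho0 X0 vol w0 wge; pose i : 'I_d := Ordinal (leq_trans (isT : 0 < 2)%N hd).
have [th [_ pos _ h]] := saint_venant X w i rho hd rho0 X0 vol w0 wge.
have h1 : 0 <= \sum_(y <- edom X i) (grad i w y + rho * sin (th (y ord0 i))) ^+ 2.
  by apply: sumr_ge0 => y _; exact: sqr_ge0.
have h2 : 0 <= \sum_(x <- X) w x * gap d (rho * sin (th (x ord0 i)) - rho * sin (th (x ord0 i - 1))).
  by apply: sumr_fset_ge0 => x xX; rewrite mulr_ge0 // gap_ge0 // pos.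
lra.
Qed.

(** The divergence of the Knothe field is at least [d >= 2] at each point and at most [2 * rho] per
    entry in total. The use of this weak form is [1 / rho <= entries_tot X / N]. *)
Lemma isoperimetric X rho : (2 <= d)%N -> 0 < rho -> X != fset0 ->
  omega R d * rho ^+ d = #|` X|%:R -> #|` X|%:R <= rho * entries_tot X.
Proof.
move=> hd rho0 X0 vol; pose i : 'I_d := Ordinal (leq_trans (isT : 0 < 2)%N hd).
have [T [th [bd pos gp mom [dv hth hT]]]] := backdiff_total X i rho hd rho0 X0 vol.
have : #|` X|%:R * d%:R <= \sum_j \sum_(x <- X) backdiff T j x.
  rewrite exchange_big /= -sumr_fset_const; apply: ler_sum_fset => x xX.
  by have := gp x xX; have := gap_ge0 d _ (pos i x xX); lra.
have : #|` X|%:R * 2 <= #|` X|%:R * d%:R :> R by rewrite ler_wpM2l // ler_nat.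
lra.
Qed.

End Energy.

(** * Stability in one coordinate *)

Section TailWeight.
Context {R : realType}.

(* [tailw d th] is the integral of [y] against the coordinate law of the unit ball over [y >= sin th]. *)
Definition tailw (d : nat) (th : R) : R := cos th ^+ d.+1 / (d.+1%:R * cospow_tot d).

Lemma is_derive_tailw d th : is_derive th (1:R) (tailw d) (- (sin th * cos th ^+ d / cospow_tot d)).
Proof.
apply: is_derive_congr; first exact/is_derive_mulconst/is_derive_exp.
have h : (d.+1%:R : R) != 0 by [].
have := lt0r_neq0 (@cospow_tot_gt0 R d).
by move: (d.+1%:R : R) (cospow_tot d) h => a b a0 b0; field; rewrite a0 b0.
Qed.

Lemma tailw_ge0 d th : inhalf th -> 0 <= tailw d th.
Proof.
move=> h; rewrite divr_ge0 ?exprn_ge0 ?cos_ge0_half // mulr_ge0 //.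
exact/ltW/cospow_tot_gt0.
Qed.

Lemma tailwN d : tailw d (- (pi / 2)) = 0.
Proof. by rewrite /tailw cosN cos_pihalf expr0n mul0r. Qed.

Lemma tailw_pihalf d : tailw d (pi / 2) = 0.
Proof. by rewrite /tailw cos_pihalf expr0n mul0r. Qed.

Lemma tailw_opp d th : tailw d (- th) = tailw d th.
Proof. by rewrite /tailw cosN. Qed.

Lemma cospow_intN k (th : R) : cospow_int k (- th) = - cospow_int k th.
Proof.
elim/ltn_ind: k => -[|[|n]] IH //=; first exact: sinN.
by rewrite IH // cosN sinN; ring.
Qed.

Lemma ballcdfN_compl k (th : R) : ballcdf k (- th) = 1 - ballcdf k th.
Proof.
have t0 := lt0r_neq0 (@cospow_tot_gt0 R k).
rewrite /ballcdf -{2}(divff t0) -mulrBl; congr (_ / _).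
by rewrite /cospow_tot !cospow_intN; ring.
Qed.

(* Near the pole both sides vanish and the derivative of the right side is larger as soon as
   [C sin th >= 1]; away from the pole the weight is bounded below. *)
Lemma tail_le_tailw d : exists2 C : R, 1 <= C & forall th, inhalf th ->
  (0 <= th -> 1 - ballcdf d th <= C * tailw d th) /\
  (th <= 0 -> ballcdf d th <= C * tailw d th).
Proof.
set k : R := d.+1%:R * cospow_tot d.
have k0 : 0 < k by rewrite mulr_gt0 ?cospow_tot_gt0.
pose C : R := 2 + 2 ^+ d.+1 * k.
have C2 : 2 <= C by rewrite lerDl mulr_ge0 ?exprn_ge0 ?(ltW k0).
have pos th : inhalf th -> 0 <= th -> 1 - ballcdf d th <= C * tailw d th.
  move=> hth th0; have /andP[_ th1] := hth.
  have s0 : 0 <= sin th by rewrite -[0](sin0 R) sin_homo_half // oppr_le0 pihalf_ge0.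
  have [h|h] := leP 1 (C * sin th).
    have : C * tailw d (pi / 2) + ballcdf d (pi / 2) <= C * tailw d th + ballcdf d th.
      have der x : is_derive x (1:R) (fun t => C * tailw d t + ballcdf d t)
          (C * - (sin x * cos x ^+ d / cospow_tot d) + cos x ^+ d / cospow_tot d).
        by apply: is_derive_add (is_derive_ballcdf d x); exact/is_derive_constmul/is_derive_tailw.
      apply: (is_derive_le0_homo _ _ _ _ th1 (fun x _ => der x)).
      move=> x /andP[x1 x2].
      have -> : C * - (sin x * cos x ^+ d / cospow_tot d) + cos x ^+ d / cospow_tot d =
        (1 - C * sin x) * (cos x ^+ d / cospow_tot d) by ring.
      rewrite mulr_le0_ge0 //; last first.
        rewrite divr_ge0 ?(ltW (cospow_tot_gt0 _)) // exprn_ge0 // cos_ge0_half //.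
        by rewrite /inhalf x2 andbT (le_trans _ x1) // (le_trans _ th0) // oppr_le0 pihalf_ge0.
      rewrite subr_le0 (le_trans h) // ler_wpM2l //; first by lra.
      by rewrite sin_homo_half //; have := @pihalf_ge0 R; lra.
    by rewrite tailw_pihalf ballcdf1; lra.
  have g0 : 0 <= ballcdf d th.
    by rewrite -(ballcdfN d) ballcdf_homo //; have := @pihalf_ge0 R; lra.
  suff : 1 <= C * tailw d th by lra.
  have c0 : 0 <= cos th by exact: cos_ge0_half.
  have c1 : 2^-1 <= cos th.
    have : sin th < 2^-1 by nra.
    have := cos2Dsin2 th; nra.
  rewrite /tailw mulrA ler_pdivlMr -/k // mul1r.
  have : (2^-1) ^+ d.+1 <= cos th ^+ d.+1 by rewrite ler_pXn2r ?nnegrE.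
  have p2 : 0 < (2 : R) ^+ d.+1 by rewrite exprn_gt0.
  rewrite exprVn => h2; have : 2 ^+ d.+1 * (2 ^+ d.+1)^-1 <= 2 ^+ d.+1 * cos th ^+ d.+1 by rewrite ler_pM2l.
  rewrite divff ?lt0r_neq0 // /C => h3.
  have := ler_wpM2r (ltW k0) h3.
  have : 0 <= 2 * cos th ^+ d.+1 by rewrite mulr_ge0 // exprn_ge0.
  lra.
exists C; first lra; move=> th hth; split; first exact: pos.
move=> th0; have := pos (- th); rewrite tailw_opp ballcdfN_compl => h.
suff : 1 - (1 - ballcdf d th) <= C * tailw d th by lra.
by apply: h; [case/andP: hth => *; apply/andP; split; lra | lra].
Qed.

End TailWeight.

Section HardyLevels.
Context {R : realType} {T : choiceType}.
Implicit Types (S : {fset T}) (kap : T -> nat) (tau V : nat -> R).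

Lemma gap_alt d (t : R) : 0 < t ->
  (t - 1) ^+ 2 = t * (4 ^+ d * gap d t) \/ `|t - 1| = 4 ^+ d * gap d t.
Proof.
move=> t0; rewrite /gap.
have p4 : (4 : R) ^+ d != 0 by rewrite expf_neq0.
have e4 (y : R) : 4 ^+ d * ((4 ^+ d)^-1 * y) = y by rewrite mulrA divff // mul1r.
rewrite !e4; have tn0 := lt0r_neq0 t0.
have e : t * (t^-1 - 1) = 1 - t by rewrite mulrBr divff // mulr1.
case: leP => h.
  by left; rewrite mulrA -expr2 -exprMn e; ring.
by right; rewrite -{2}(gtr0_norm t0) -normrM e distrC.
Qed.

(** Indices are split by which branch of [gap] is active. The quadratic branch goes by
    Cauchy-Schwarz with weights [tau], of sum at most [L]; the linear branch is summed directly, and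
    the truncation at [L^2] covers the case where its sum exceeds [L]. *)
Lemma trunc_drift_le d n tau (L : R) : (forall k, (k < n)%N -> 0 < tau k) ->
  \sum_(k < n) tau k <= L ->
  Num.min ((\sum_(k < n) (tau k - 1)) ^+ 2) (L ^+ 2)
    <= 2 * L * \sum_(k < n) (4 ^+ d * gap d (tau k)).
Proof.
move=> tp hL; pose g k := 4 ^+ d * gap d (tau k).
have g0 (k : 'I_n) : 0 <= g k by rewrite mulr_ge0 ?exprn_ge0 // gap_ge0 // tp.
pose q (k : 'I_n) := (tau k - 1) ^+ 2 == tau k * g k.
pose A := \sum_(k < n | q k) (tau k - 1); pose B := \sum_(k < n | ~~ q k) (tau k - 1).
have L0 : 0 <= L by apply: le_trans hL; apply: sumr_ge0 => k _; exact/ltW/tp.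
have -> : \sum_(k < n) (tau k - 1) = A + B by rewrite (bigID q).
have hB : `|B| <= \sum_(k < n | ~~ q k) g k.
  apply: le_trans (ler_norm_sum _ _ _) _; apply: ler_sum => k hk.
  by case: (gap_alt d (tau k) (tp k (ltn_ord k))) => [/eqP e|->//]; rewrite /q /g e in hk.
have hA : A ^+ 2 <= L * \sum_(k < n | q k) g k.
  have hA1 : `|A| <= \sum_(k < n | q k) (Num.sqrt (tau k) * Num.sqrt (g k)).
    apply: le_trans (ler_norm_sum _ _ _) _; apply: ler_sum => k /eqP e.
    by rewrite -sqrtr_sqr e sqrtrM // ltW // tp.
  apply: (@le_trans _ _ ((\sum_(k < n | q k) tau k) * (\sum_(k < n | q k) g k))); last first.
    rewrite ler_wpM2r ?sumr_ge0 //; apply: le_trans hL.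
    by rewrite [leRHS](bigID q) /= lerDl sumr_ge0 // => k _; exact/ltW/tp.
  have nn : 0 <= \sum_(k < n | q k) (Num.sqrt (tau k) * Num.sqrt (g k)).
    by apply: sumr_ge0 => k _; rewrite mulr_ge0 ?sqrtr_ge0.
  apply: (@le_trans _ _ ((\sum_(k < n | q k) (Num.sqrt (tau k) * Num.sqrt (g k))) ^+ 2)).
    by rewrite -sqr_normr ler_pXn2r ?nnegrE.
  pose K := [fset k in [seq k <- enum 'I_n | q k]]%fset.
  have eK (F : 'I_n -> R) : \sum_(k < n | q k) F k = \sum_(k <- K) F k.
    rewrite -big_filter /=; apply: perm_big; apply: uniq_perm.
    - by rewrite filter_uniq // index_enum_uniq.
    - exact: fset_uniq.
    - by move=> k; rewrite mem_filter !inE /= mem_filter mem_index_enum mem_enum.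
  rewrite !eK; apply: le_trans (cauchy_schwarz_fset _ _ _) _.
  rewrite le_eqVlt; apply/orP; left; apply/eqP; congr (_ * _).
    by apply: eq_bigr => k _; rewrite sqr_sqrtr // ltW // tp.
  by apply: eq_bigr => k _; rewrite sqr_sqrtr.
have -> : \sum_(k < n) 4 ^+ d * gap d (tau k) = \sum_(k < n | q k) g k + \sum_(k < n | ~~ q k) g k.
  by rewrite (bigID q).
set SA := \sum_(k < n | q k) g k in hA *; set SB := \sum_(k < n | ~~ q k) g k in hB *.
have hAB : (A + B) ^+ 2 <= 2 * A ^+ 2 + 2 * B ^+ 2 by have := sqr_ge0 (A - B); nra.
have SB0 : 0 <= SB by apply: sumr_ge0.
have SA0 : 0 <= SA by apply: sumr_ge0.
have nb := normr_ge0 B; have eb : `|B| ^+ 2 = B ^+ 2 by exact: sqr_normr.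
have [hBL|hBL] := leP `|B| L.
  rewrite ge_min; apply/orP; left.
  have : B ^+ 2 <= L * SB by rewrite -eb expr2; apply: ler_pM.
  nra.
rewrite ge_min; apply/orP; right.
have : L < SB by apply: lt_le_trans hB.
nra.
Qed.

(** A point [x] lies [kap x] levels from the centre and its drift [F x] accumulates along them.
    Exchanging sums, the gap at level [k] is charged once per point beyond [k], and there are at
    most [c * V k / L] of these. From the first level with at most [e] points beyond it, each such
    point pays the truncation [L^2] instead. *)
Lemma hardy_levels d S kap (F : T -> R) tau V n (L c e D : R) : 0 <= L -> 0 <= c -> 0 <= e ->
  (forall x, x \in S -> (kap x <= n)%N) ->
  (forall x, x \in S -> `|F x| = `|\sum_(k < kap x) (tau k - 1)|) ->
  (forall k, (k <= n)%N -> \sum_(l < k) tau l <= L) ->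
  (forall k, (k < n)%N -> \sum_(x <- S) (k < kap x)%:R <= e \/
     0 < tau k /\ L * (\sum_(x <- S) (k < kap x)%:R) <= c * V k) ->
  (forall k, 0 <= V k) ->
  \sum_(k < n | 0 < tau k) V k * gap d (tau k) <= D ->
  \sum_(x <- S) Num.min (F x ^+ 2) (L ^+ 2) <= L ^+ 2 * e + 2 * c * 4 ^+ d * D.
Proof.
move=> L0 c0 e0 hn hF hL alt V0 hD.
pose bad k := (n <= k)%N || (\sum_(x <- S) (k < kap x)%:R <= e).
have exb : exists k, bad k by exists n; rewrite /bad leqnn.
have [k0 hk0 mk0] := ex_minnP exb.
have k0n : (k0 <= n)%N by apply: mk0; rewrite /bad leqnn.
have good k : (k < k0)%N -> 0 < tau k /\ L * (\sum_(x <- S) (k < kap x)%:R) <= c * V k.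
  move=> kk0; have nb : ~~ bad k by apply/negP => /mk0; rewrite leqNgt kk0.
  have kn : (k < n)%N by exact: leq_trans kk0 k0n.
  case: (alt k kn) => // h; move: nb; by rewrite /bad h orbT.
have badm : \sum_(x <- S) (k0 < kap x)%:R <= e.
  case/orP: hk0 => // nk; rewrite big_seq big1 // => x /hn h.
  by rewrite ltnNge (leq_trans h nk).
pose g k := 4 ^+ d * gap d (tau k).
have pt x : x \in S -> Num.min (F x ^+ 2) (L ^+ 2) <=
   L ^+ 2 * (k0 < kap x)%:R + \sum_(k < k0) 2 * L * g k * (k < kap x)%:R.
  move=> xS; have s0 : 0 <= \sum_(k < k0) 2 * L * g k * (k < kap x)%:R.
    apply: sumr_ge0 => k _; apply: mulr_ge0 => //; apply: mulr_ge0; first exact: mulr_ge0.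
    by apply: mulr_ge0; [exact: exprn_ge0 | apply: gap_ge0; case: (good k (ltn_ord k))].
  have [h|h] := ltnP k0 (kap x).
    rewrite mulr1; apply: (@le_trans _ _ (L ^+ 2)); first by rewrite ge_min lexx orbT.
    by rewrite lerDl.
  rewrite mulr0 add0r -sqr_normr hF // sqr_normr.
  apply: le_trans (trunc_drift_le d (kap x) tau L _ _) _.
  - by move=> k kx; case: (good k (leq_trans kx h)).
  - by apply: hL; exact: leq_trans h k0n.
  rewrite mulr_sumr (big_ord_widen _ (fun k => 2 * L * g k) h) [leLHS]big_mkcond.
  by apply: ler_sum => k _; case: ifP => _; rewrite ?mulr1 ?mulr0.
apply: le_trans (ler_sum_fset _ _ _ pt) _.
rewrite big_split /= -mulr_sumr; apply: lerD; first by rewrite ler_wpM2l ?exprn_ge0.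
rewrite exchange_big /=; under eq_bigr do rewrite -mulr_sumr.
apply: (@le_trans _ _ (\sum_(k < k0) 2 * c * 4 ^+ d * (V k * gap d (tau k)))).
  apply: ler_sum => k _; have [tk hk] := good k (ltn_ord k).
  have gk : 0 <= g k by rewrite mulr_ge0 ?exprn_ge0 // gap_ge0.
  have := ler_wpM2l gk hk; rewrite /g; set m := \sum_(x <- S) _; lra.
rewrite -mulr_sumr ler_wpM2l ?mulr_ge0 ?exprn_ge0 //; apply: le_trans hD.
rewrite (big_ord_widen n (fun k => V k * gap d (tau k)) k0n) [leLHS]big_mkcond [leRHS]big_mkcond /=.
apply: ler_sum => k _; case: ifP => [kk0|_].
  by have [-> _] := good k kk0.
by case: ifP => // tk; rewrite mulr_ge0 // gap_ge0.
Qed.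

End HardyLevels.

Section Marginal.
Context {R : realType} {d : nat}.
Variables (X : {fset pt d}) (i : 'I_d) (th : int -> R).
Hypothesis X0 : X != fset0.
Hypothesis hth : forall t, inhalf (th t) /\ ballcdf d (th t) = cumul X i t / #|` X|%:R.
Implicit Types (t : int) (x y : pt d).

Let N : R := #|` X|%:R.

Let N0 : 0 < N. Proof. by rewrite ltr0n cardfs_gt0. Qed.

Let thh t : inhalf (th t). Proof. by case: (hth t). Qed.

Lemma th_mono t t' : t <= t' -> th t <= th t'.
Proof.
move=> tt'; apply: (ballcdf_reflect_le d) => //; rewrite (hth _).2 (hth _).2.
by rewrite ler_pM2r ?invr_gt0 // cumul_homo.
Qed.

Lemma tailw_cell (a b : R) : inhalf a -> inhalf b -> a <= b ->
  sin a * (ballcdf d b - ballcdf d a) <= tailw d a - tailw d b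
  <= sin b * (ballcdf d b - ballcdf d a).
Proof.
move=> ha hb ab; have /andP[a1 a2] := ha; have /andP[b1 b2] := hb.
have der (k x : R) : is_derive x (1:R) (fun s => tailw d s + k * ballcdf d s)
   (- (sin x * cos x ^+ d / cospow_tot d) + k * (cos x ^+ d / cospow_tot d)).
  by apply: is_derive_add (is_derive_tailw d x) _; exact/is_derive_constmul/is_derive_ballcdf.
have cx (x : R) : a <= x <= b -> 0 <= cos x ^+ d / cospow_tot d.
  move=> /andP[x1 x2]; rewrite divr_ge0 ?(ltW (cospow_tot_gt0 _)) //.
  by apply/exprn_ge0/cos_ge0_half; rewrite /inhalf (le_trans a1) ?(le_trans x2).
have eq k (x : R) : - (sin x * cos x ^+ d / cospow_tot d) + k * (cos x ^+ d / cospow_tot d)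
  = (k - sin x) * (cos x ^+ d / cospow_tot d) by ring.
apply/andP; split.
  have : tailw d b + sin a * ballcdf d b <= tailw d a + sin a * ballcdf d a; last by lra.
  apply: (is_derive_le0_homo _ _ _ _ ab (fun (x : R) _ => der (sin a) x)) => x hx.
  rewrite eq mulr_le0_ge0 ?cx // subr_le0.
  by case/andP: hx => x1 x2; rewrite sin_homo_half // (le_trans x2).
have : tailw d a + sin b * ballcdf d a <= tailw d b + sin b * ballcdf d b; last by lra.
apply: (is_derive_ge0_homo _ _ _ _ ab (fun (x : R) _ => der (sin b) x)) => x hx.
rewrite eq mulr_ge0 ?cx // subr_ge0.
by case/andP: hx => x1 x2; rewrite sin_homo_half // (le_trans a1).
Qed.

Lemma tailw_level t :
  N * (tailw d (th (t - 1)) - tailw d (th t)) <= #|` slice X i t|%:R * sin (th t) /\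
  N * (tailw d (th t) - tailw d (th (t - 1))) <= #|` slice X i t|%:R * - sin (th (t - 1)).
Proof.
have m : #|` slice X i t|%:R = N * (ballcdf d (th t) - ballcdf d (th (t - 1))).
  rewrite (hth _).2 (hth _).2 [cumul X i t]cumul_slice -/N.
  by have := lt0r_neq0 N0 => h; field.
have h : th (t - 1) <= th t by apply: th_mono; lia.
have /andP[h1 h2] := tailw_cell _ _ (thh _) (thh _) h.
rewrite m -!mulrA !ler_pM2l // mulrN; split; lra.
Qed.

Lemma tailw_cumul0 t : cumul X i t = 0 :> R -> tailw d (th t) = 0.
Proof.
move=> h; suff -> : th t = - (pi / 2) by exact: tailwN.
apply/eqP; rewrite eq_le; have /andP[-> _] := thh t; rewrite andbT.
apply: (ballcdf_reflect_le d) => //; first by rewrite /inhalf lexx /=; have := @pihalf_ge0 R; lra.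
by rewrite (hth _).2 h mul0r ballcdfN.
Qed.

Lemma th_cumul1 t : cumul X i t = N -> th t = pi / 2.
Proof.
move=> h; apply/eqP; rewrite eq_le; have /andP[_ ->] := thh t => /=.
apply: (ballcdf_reflect_le d) => //; first by rewrite /inhalf lexx andbT; have := @pihalf_ge0 R; lra.
by rewrite (hth _).2 h divff ?lt0r_neq0 // ballcdf1.
Qed.

Lemma tailw_cumul1 t : cumul X i t = N -> tailw d (th t) = 0.
Proof. by move=> /th_cumul1 ->; exact: tailw_pihalf. Qed.

Lemma sum_coord_levels (F : int -> R) : exists (t0 : int) (n : nat),
  [/\ forall t, t < t0 -> cumul X i t = 0 :> R, forall t, t0 + n%:Z <= t + 1 -> cumul X i t = N
   & \sum_(x <- X) F (x ord0 i) = \sum_(k < n) #|` slice X i (t0 + k%:Z)|%:R * F (t0 + k%:Z)].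
Proof.
have [t0 [n [rep dec]]] := @slice_decomp R d X i; exists t0, n; split.
- move=> t tt0; rewrite /cumul big_seq big1 // => x /rep[k _ ->].
  by have -> : (t0 + k%:Z <= t) = false by lia.
- move=> t tt0; rewrite /N -[RHS]mulr1 -sumr_fset_const; apply: eq_sum_fset => x /rep[k hk ->].
  by have -> : (t0 + k%:Z <= t) = true by lia.
- rewrite dec; apply: eq_bigr => k _; rewrite -sumr_fset_const; apply: eq_sum_fset => x.
  by rewrite in_slice => /andP[_ /eqP ->].
Qed.

(** The tail integral [tailw] against a Riemann sum with [sin] at the right end of each cell.
    [lower_moment] has to use the left end instead. *)
Lemma upper_moment t :
  N * tailw d (th (t - 1)) <= \sum_(x <- X) ((t <= x ord0 i)%R)%:R * sin (th (x ord0 i)).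
Proof.
have [t0 [n [lo hi ->]]] := sum_coord_levels (fun s => ((t <= s)%R)%:R * sin (th s)).
(* The maximum freezes [f] below [t - 1], so levels under [t] contribute nothing to the telescoping
   sum. *)
pose f s := - (N * tailw d (th (Num.max s (t - 1)))).
apply: (@le_trans _ _ (\sum_(k < n) (f (t0 + k%:Z) - f (t0 + k%:Z - 1)))).
  rewrite telescope_int /f.
  have -> : tailw d (th (Num.max (t0 + n%:Z - 1) (t - 1))) = 0.
    apply/tailw_cumul1/hi; have : t0 + n%:Z - 1 <= Num.max (t0 + n%:Z - 1) (t - 1) by rewrite le_max lexx.
    lia.
  rewrite mulr0 oppr0 sub0r opprK; case: (leP (t0 - 1) (t - 1)) => // h.
  by rewrite (tailw_cumul0 (t - 1)) ?(tailw_cumul0 (t0 - 1)) // lo //; lia.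
apply: ler_sum => k _; set s := t0 + k%:Z; rewrite /f.
case: (leP t s) => h.
  have -> : Num.max s (t - 1) = s by apply/max_idPl; lia.
  have -> : Num.max (s - 1) (t - 1) = s - 1 by apply/max_idPl; lia.
  by rewrite mul1r; have [h1 _] := tailw_level s; lra.
have -> : Num.max s (t - 1) = t - 1 by apply/max_idPr; lia.
have -> : Num.max (s - 1) (t - 1) = t - 1 by apply/max_idPr; lia.
by rewrite subrr mul0r mulr0.
Qed.

Lemma lower_moment t :
  N * tailw d (th (t - 1)) <= \sum_(x <- X) ((x ord0 i < t)%R)%:R * - sin (th (x ord0 i - 1)).
Proof.
have [t0 [n [lo hi ->]]] := sum_coord_levels (fun s => ((s < t)%R)%:R * - sin (th (s - 1))).
pose f s := N * tailw d (th (Num.min s (t - 1))).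
apply: (@le_trans _ _ (\sum_(k < n) (f (t0 + k%:Z) - f (t0 + k%:Z - 1)))).
  rewrite telescope_int /f.
  have -> : tailw d (th (Num.min (t0 - 1) (t - 1))) = 0.
    apply/tailw_cumul0/lo; have : Num.min (t0 - 1) (t - 1) <= t0 - 1 by rewrite ge_min lexx.
    lia.
  rewrite mulr0 subr0; case: (leP (t0 + n%:Z - 1) (t - 1)) => // h.
  by rewrite (tailw_cumul1 (t - 1)) ?(tailw_cumul1 (t0 + n%:Z - 1)) // hi //; lia.
apply: ler_sum => k _; set s := t0 + k%:Z; rewrite /f.
case: (ltP s t) => h.
  have -> : Num.min s (t - 1) = s by apply/min_idPl; lia.
  have -> : Num.min (s - 1) (t - 1) = s - 1 by apply/min_idPl; lia.
  by rewrite mul1r; have [_ h1] := tailw_level s; lra.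
have -> : Num.min s (t - 1) = t - 1 by apply/min_idPr; lia.
have -> : Num.min (s - 1) (t - 1) = t - 1 by apply/min_idPr; lia.
by rewrite subrr mul0r mulr0.
Qed.

Lemma upper_mass t : \sum_(x <- X) ((t <= x ord0 i)%R)%:R = N * (1 - ballcdf d (th (t - 1))).
Proof.
rewrite (hth _).2 -/N mulrBr mulr1 mulrCA divff ?lt0r_neq0 // mulr1.
apply/eqP; rewrite eq_sym subr_eq -[N]mulr1 -sumr_fset_const -big_split /=; apply/eqP.
apply: eq_bigr => x _; have -> : (x ord0 i <= t - 1) = ~~ (t <= x ord0 i) by lia.
by case: (t <= x ord0 i); rewrite ?addr0 ?add0r.
Qed.

Lemma lower_mass t : \sum_(x <- X) ((x ord0 i < t)%R)%:R = N * ballcdf d (th (t - 1)).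
Proof.
rewrite (hth _).2 -/N mulrCA divff ?lt0r_neq0 // mulr1.
by apply: eq_bigr => x _; have -> : (x ord0 i <= t - 1) = (x ord0 i < t) by lia.
Qed.

Lemma center_level : exists t, th (t - 1) <= 0 <= th t.
Proof.
have [t0 [n [lo hi _]]] := sum_coord_levels (fun=> 0).
have pih := @pihalf_ge0 R.
have ex : exists k : nat, 0 <= th (t0 + k%:Z).
  by exists n; rewrite th_cumul1 // hi //; lia.
have [k hk mk] := ex_minnP ex; exists (t0 + k%:Z); rewrite hk andbT.
case: k hk mk => [|k] hk mk.
  have e : cumul X i (t0 + 0%:Z - 1) = 0 :> R by apply: lo; lia.
  apply: (ballcdf_reflect_le d) => //; first by rewrite /inhalf; apply/andP; lra.
  rewrite (hth _).2 e mul0r; have := ballcdf_homo d (- (pi / 2)) (0 : R).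
  by rewrite ballcdfN; apply; lra.
have -> : t0 + k.+1%:Z - 1 = t0 + k%:Z by lia.
by rewrite leNgt; apply/negP => /ltW /mk; rewrite ltnn.
Qed.

Variable w : pt d -> R.
Hypothesis w0 : forall x, x \notin X -> w x = 0.

Definition levelsum t : R := \sum_(x <- slice X i t) w x.

Lemma levelsumE t : levelsum t = \sum_(x <- X) w x * ((t <= x ord0 i)%R%:R - (t <= (x - ev i) ord0 i)%R%:R).
Proof.
rewrite /levelsum sum_slice big_mkcond /=; apply: eq_bigr => x _; rewrite subev_same.
have -> : (t <= x ord0 i - 1) = (t < x ord0 i) by lia.
by case: (ltgtP t (x ord0 i)) => _; rewrite ?subr0 ?subrr ?mulr1 ?mulr0.
Qed.

(** The gradient telescopes along lattice lines, so the slice sum is read off from either side of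
    the level. The side away from the equator is the useful one: its mass is at most [C * tailw] per
    point of [X]. *)
Lemma levelsum_up t : levelsum t = - \sum_(y <- edom X i) grad i w y * ((t <= y ord0 i)%R)%:R.
Proof. by rewrite levelsumE (sum_by_parts X i w (fun y => ((t <= y ord0 i)%R)%:R)). Qed.

Lemma levelsum_down t : levelsum t = \sum_(y <- edom X i) grad i w y * ((y ord0 i < t)%R)%:R.
Proof.
rewrite levelsum_up; have := sum_by_parts X i w (fun=> 1) w0.
rewrite big1 => [|x _]; last by rewrite subrr mulr0.
move/eqP; rewrite eq_sym oppr_eq0 => /eqP h.
apply/eqP; rewrite eq_sym -subr_eq0 opprK -big_split /= -[X in _ == X]h; apply/eqP.
by apply: eq_bigr => y _; rewrite ltNge; case: (t <= y ord0 i); rewrite ?mulr1 ?mulr0 ?addr0 ?add0r.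
Qed.

End Marginal.

Section Coordinate.
Context {R : realType} {d : nat}.
Implicit Types (X : {fset pt d}) (i : 'I_d) (th : int -> R) (w : pt d -> R) (x y : pt d) (t : int).

Lemma sqr_le_ge (x a : R) : 0 <= a -> x ^+ 2 <= a ^+ 2 -> - a <= x.
Proof. by move=> a0 h; rewrite leNgt; apply/negP => h2; nra. Qed.

(** With the margin 100 the boundary loss is at most 3 percent of [N * rho * q] and the
    Cauchy-Schwarz error at most a quarter, so half of the main term remains. *)
Lemma levelsum_core (N rho q eps C b A E : R) : 0 < N -> 0 < rho -> 1 <= C -> 0 <= eps ->
  100 * C * eps <= q -> 0 <= b -> b <= N * eps -> N * rho * q - 3 * rho * b <= A ->
  E ^+ 2 <= 2 * N * rho ^+ 2 * eps * (N * (C * q) + b) -> 2^-1 * (N * rho * q) <= A + E.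
Proof.
move=> N0 rho0 C1 e0 hq b0 hb hA hE.
have q0 : 0 <= q by apply: le_trans hq; rewrite mulr_ge0 // mulr_ge0 //; lra.
have i1 : 100 * (C * eps) <= q by rewrite mulrA.
have Ce : eps <= C * eps by rewrite ler_peMl.
have b1 : 100 * b <= N * q.
  apply: (@le_trans _ _ (N * (100 * eps))); first lra.
  by rewrite ler_pM2l //; lra.
have rb : 100 * (rho * b) <= N * rho * q.
  by have := ler_wpM2l (ltW rho0) b1; lra.
have Nr0 : 0 <= N * rho by rewrite mulr_ge0 // ltW.
have E2 : E ^+ 2 <= (N * rho * q / 4) ^+ 2.
  apply: le_trans hE _.
  have j1 : 100 * (eps * (C * q)) <= q ^+ 2.
    have -> : 100 * (eps * (C * q)) = 100 * (C * eps) * q by ring.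
    by rewrite expr2 ler_wpM2r.
  have j2 : 100 * 100 * (eps * b) <= N * q ^+ 2.
    have -> : 100 * 100 * (eps * b) = (100 * eps) * (100 * b) by ring.
    apply: (@le_trans _ _ (q * (N * q))); last by rewrite expr2; lra.
    by apply: ler_pM => //; rewrite ?mulr_ge0 //; lra.
  have k : 0 <= N * rho ^+ 2 by rewrite mulr_ge0 ?(ltW N0) ?exprn_ge0 ?(ltW rho0).
  have j3 : eps * (N * (C * q) + b) <= N * q ^+ 2 / 32.
    have : N * (100 * (eps * (C * q))) <= N * q ^+ 2 by rewrite ler_pM2l.
    have : 0 <= N * q ^+ 2 by rewrite mulr_ge0 ?exprn_ge0 ?(ltW N0).
    lra.
  have := ler_wpM2l k j3; lra.
have := sqr_le_ge E (N * rho * q / 4) _ E2.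
have : 0 <= N * rho * q by rewrite mulr_ge0.
move=> h /(_ _) h2; have : - (N * rho * q / 4) <= E by apply: h2; lra.
lra.
Qed.

Section LevelsumLower.
Variables (X : {fset pt d}) (i : 'I_d) (th : int -> R) (w : pt d -> R) (rho eps C b : R).
Hypothesis X0 : X != fset0.
Hypothesis hth : forall t, inhalf (th t) /\ ballcdf d (th t) = cumul X i t / #|` X|%:R.
Hypothesis w0 : forall x, x \notin X -> w x = 0.
Hypotheses (rho0 : 0 < rho) (C1 : 1 <= C) (e0 : 0 <= eps).
Hypothesis tail : forall th : R, inhalf th ->
  (0 <= th -> 1 - ballcdf d th <= C * tailw d th) /\ (th <= 0 -> ballcdf d th <= C * tailw d th).
Let N : R := #|` X|%:R.
Let T0 t := rho * sin (th t).
Hypotheses (hb : entries X i <= b) (hbN : b <= N * eps).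
Hypothesis drift : \sum_(x <- X) (T0 (x ord0 i) - T0 (x ord0 i - 1)) <= 2 * rho * b.
Hypothesis up : forall x, x \in X -> 0 < T0 (x ord0 i) - T0 (x ord0 i - 1).
Hypothesis err : \sum_(y <- edom X i) (grad i w y + T0 (y ord0 i)) ^+ 2 <= 2 * N * rho ^+ 2 * eps.

Let N0 : 0 < N. Proof. by rewrite ltr0n cardfs_gt0. Qed.

Let T0_bound t : `|T0 t| <= rho.
Proof.
rewrite normrM (gtr0_norm rho0) ler_piMr ?(ltW rho0) // ler_norml.
by rewrite sin_geN1 sin_le1.
Qed.

Lemma levelsum_err_bound (f : int -> bool) (m : R) :
  \sum_(x <- X) (f (x ord0 i))%:R <= m ->
  (\sum_(y <- edom X i) (grad i w y + T0 (y ord0 i)) * (f (y ord0 i))%:R) ^+ 2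
    <= 2 * N * rho ^+ 2 * eps * (m + b).
Proof.
move=> hm; apply: le_trans (cauchy_schwarz_fset _ _ _) _.
apply: ler_pM => //; try by apply: sumr_ge0 => y _; exact: sqr_ge0.
have e y : ((f (y ord0 i))%:R : R) ^+ 2 = (f (y ord0 i))%:R by case: (f _); rewrite ?expr1n ?expr0n.
under eq_bigr do rewrite e.
rewrite (sum_edom X i (fun y => (f (y ord0 i))%:R)); apply: lerD => //.
apply: le_trans hb; rewrite /entries; apply: ler_sum_fset => x _.
by rewrite ler_piMr //; case: (f _).
Qed.

Lemma levelsum_bdry_bound (f : int -> bool) :
  `|\sum_(x <- X) (x - ev i \notin X)%:R * ((f ((x - ev i) ord0 i))%:R * T0 ((x - ev i) ord0 i))| <= rho * b.
Proof.
apply: le_trans (ler_norm_sum _ _ _) _; apply: (@le_trans _ _ (rho * entries X i)); last first.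
  by rewrite ler_wpM2l // ltW.
rewrite /entries mulr_sumr; apply: ler_sum_fset => x _.
rewrite 2!normrM mulrC !normr_nat ler_wpM2r //; case: (f _) => /=.
  by rewrite mul1r; exact: T0_bound.
by rewrite mul0r ltW.
Qed.

(** A small deficit makes [grad i w] close to [- T0] in mean square. The slice sum is therefore
    nearly the sum of [T0] beyond the level, of size [N * rho * tailw]; the error is controlled by
    Cauchy-Schwarz over the tail. *)
Lemma levelsum_lower t : 100 * C * eps <= tailw d (th (t - 1)) ->
  2^-1 * (N * rho * tailw d (th (t - 1))) <= levelsum X i w t.
Proof.
move=> hq; have hb0 : 0 <= b by exact: le_trans (entries_ge0 _ _) hb.
have hinh : inhalf (th (t - 1)) by case: (hth (t - 1)).
have rb0 : 0 <= rho * b by rewrite mulr_ge0 // ltW.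
have [h|h] := leP 0 (th (t - 1)).
  pose f s := (t <= s)%R.
  have -> : levelsum X i w t = \sum_(y <- edom X i) (f (y ord0 i))%:R * T0 (y ord0 i)
       + - \sum_(y <- edom X i) (grad i w y + T0 (y ord0 i)) * (f (y ord0 i))%:R.
    rewrite levelsum_up // -[X in _ = _ + X]sumrN -sumrN -big_split /=; apply: eq_bigr => y _; rewrite /f; ring.
  apply: (levelsum_core N rho _ eps C b) => //.
    rewrite (sum_edom X i (fun y => (f (y ord0 i))%:R * T0 (y ord0 i))).
    have := levelsum_bdry_bound f; rewrite ler_norml => /andP[h1 _].
    have := upper_moment X i th X0 hth t; rewrite -/N => h2.
    have := ler_wpM2l (ltW rho0) h2; rewrite mulr_sumr.
    have -> : \sum_(x <- X) rho * (((t <= x ord0 i)%R)%:R * sin (th (x ord0 i))) =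
       \sum_(x <- X) (f (x ord0 i))%:R * T0 (x ord0 i) by apply: eq_bigr => x _; rewrite /T0 mulrCA.
    lra.
  rewrite sqrrN; apply: levelsum_err_bound; rewrite (upper_mass X i th X0 hth) ler_pM2l //.
  exact: (tail _ hinh).1.
(* Below the equator the moment bound has sines at left ends; [drift] pays for moving them to the
   right ends. *)
pose f s := (s < t)%R.
have -> : levelsum X i w t = - (\sum_(y <- edom X i) (f (y ord0 i))%:R * T0 (y ord0 i))
     + \sum_(y <- edom X i) (grad i w y + T0 (y ord0 i)) * (f (y ord0 i))%:R.
  rewrite levelsum_down // -sumrN -big_split /=; apply: eq_bigr => y _; rewrite /f; ring.
apply: (levelsum_core N rho _ eps C b) => //.
  rewrite (sum_edom X i (fun y => (f (y ord0 i))%:R * T0 (y ord0 i))).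
  have := levelsum_bdry_bound f; rewrite ler_norml => /andP[_ h1].
  have := lower_moment X i th X0 hth t; rewrite -/N => h2.
  have := ler_wpM2l (ltW rho0) h2.
  have : rho * \sum_(x <- X) ((x ord0 i < t)%R)%:R * - sin (th (x ord0 i - 1)) <=
     - (\sum_(x <- X) (f (x ord0 i))%:R * T0 (x ord0 i)) + 2 * rho * b.
    apply: le_trans (lerD (lexx _) drift); rewrite mulr_sumr -sumrN -big_split /=.
    apply: ler_sum_fset => x xX; have := up x xX; rewrite /T0 /f.
    by case: (x ord0 i < t); rewrite ?mul1r ?mul0r ?mulr0; lra.
  lra.
apply: levelsum_err_bound; rewrite (lower_mass X i th X0 hth) ler_pM2l //.
by apply: (tail _ hinh).2; exact: ltW.
Qed.

End LevelsumLower.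

End Coordinate.

Section Clip.
Context {R : realType}.
Implicit Types (rho a c : R).

(** Projection onto [[-rho, rho]]. Clipped coordinates keep the cost of points far from the centre
    bounded, as the truncated Hardy estimate requires. *)
Definition clip rho a : R := Num.max (- rho) (Num.min rho a).

Lemma clip_bound rho a : 0 <= rho -> `|clip rho a| <= rho.
Proof.
move=> r0; rewrite ler_norml /clip le_max lexx /= ge_max ge_min lexx andbT.
by rewrite (le_trans _ r0) // oppr_le0.
Qed.

Lemma clip_step rho a : clip rho a - clip rho (a - 1) <= 1.
Proof.
rewrite /clip; case: (leP rho a) => h1; case: (leP rho (a - 1)) => h2; case: (leP (- rho) rho) => h3;
  case: (leP (- rho) a) => h4; case: (leP (- rho) (a - 1)) => h5; lra.
Qed.

Lemma clip_id rho a : `|a| <= rho -> clip rho a = a.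
Proof. by rewrite ler_norml => /andP[h1 h2]; rewrite /clip (min_idPr h2) (max_idPr h1). Qed.

Lemma clip_out rho a : 0 <= rho -> rho < `|a| -> clip rho a ^+ 2 = rho ^+ 2.
Proof.
move=> r0; rewrite /clip lter_normr /= => /orP[] h.
  by rewrite (min_idPl (ltW h)) (max_idPr _) // (le_trans _ r0) // oppr_le0.
have h2 : a < - rho by rewrite ltrNr.
by rewrite (min_idPr _) ?(max_idPl _) ?sqrrN //; lra.
Qed.

Lemma clip_dist rho a c : `|c| <= rho -> `|c - clip rho a| <= `|c - a|.
Proof.
rewrite ler_norml => /andP[h1 h2]; rewrite /clip.
case: (leP rho a) => h3.
  by rewrite (max_idPr _); [rewrite (ler0_norm (_ : c - rho <= 0)) ?(ler0_norm (_ : c - a <= 0)); lra | lra].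
case: (leP (- rho) a) => h4 //.
by rewrite (ger0_norm (_ : 0 <= c - - rho)) ?(ger0_norm (_ : 0 <= c - a)); lra.
Qed.

Lemma clip_near rho a a' c : 0 <= rho -> `|c| <= rho -> `|a - a'| <= 1 ->
  (c - clip rho a) ^+ 2 <= 2 * Num.min ((c - a') ^+ 2) ((2 * rho) ^+ 2) + 2.
Proof.
move=> r0 hc haa.
have h1 : `|c - clip rho a| <= `|c - a'| + 1.
  apply: le_trans (clip_dist _ a _ hc) _.
  have -> : c - a = (c - a') + (a' - a) by ring.
  by apply: le_trans (ler_normD _ _) _; rewrite lerD2l distrC.
have h2 : `|c - clip rho a| <= 2 * rho.
  apply: le_trans (ler_normB _ _) _; have := clip_bound rho a r0; lra.
rewrite -sqr_normr; have u0 := normr_ge0 (c - clip rho a).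
case: (leP ((c - a') ^+ 2) ((2 * rho) ^+ 2)) => _; last by nra.
rewrite -[(c - a') ^+ 2]sqr_normr; set v := `|c - a'| in h1 *; set u := `|_| in u0 h1 h2 *.
have : u * u <= (v + 1) * (v + 1) by apply: ler_pM.
by have := sqr_ge0 (v - 1); lra.
Qed.

End Clip.

Section SideBound.
Context {R : realType} {d : nat}.
Variables (X S : {fset pt d}) (i : 'I_d) (th : int -> R) (w : pt d -> R) (rho eps C b : R).
Hypothesis X0 : X != fset0.
Hypothesis hth : forall t, inhalf (th t) /\ ballcdf d (th t) = cumul X i t / #|` X|%:R.
Hypothesis w0 : forall x, x \notin X -> w x = 0.
Hypothesis wge : forall x, 0 <= w x.
Hypotheses (rho0 : 0 < rho) (C1 : 1 <= C) (e0 : 0 <= eps).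
Hypothesis tail : forall th : R, inhalf th ->
  (0 <= th -> 1 - ballcdf d th <= C * tailw d th) /\ (th <= 0 -> ballcdf d th <= C * tailw d th).
Let N : R := #|` X|%:R.
Let T0 t := rho * sin (th t).
Hypotheses (hb : entries X i <= b) (hbN : b <= N * eps).
Hypothesis drift : \sum_(x <- X) (T0 (x ord0 i) - T0 (x ord0 i - 1)) <= 2 * rho * b.
Hypothesis up : forall x, x \in X -> 0 < T0 (x ord0 i) - T0 (x ord0 i - 1).
Hypothesis err : \sum_(y <- edom X i) (grad i w y + T0 (y ord0 i)) ^+ 2 <= 2 * N * rho ^+ 2 * eps.
Hypothesis gaps : \sum_(x <- X) w x * gap d (T0 (x ord0 i) - T0 (x ord0 i - 1)) <= N * rho ^+ 2 * eps.
Variables (lev : nat -> int) (n : nat) (kap : pt d -> nat) (F : pt d -> R).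
Let tau k := T0 (lev k) - T0 (lev k - 1).
Hypothesis lev_inj : injective lev.
Hypothesis hkap : forall x, x \in S -> (kap x <= n)%N.
Hypothesis hF : forall x, x \in S -> `|F x| = `|\sum_(k < kap x) (tau k - 1)|.
Hypothesis htau : forall k, (k <= n)%N -> \sum_(l < k) tau l <= 2 * rho.
Hypothesis hmass : forall k, \sum_(x <- S) (k < kap x)%:R <= N * (C * tailw d (th (lev k - 1))).

(** [hardy_levels] with the slice sums of [w] as weights [V]. Where the tail weight is at least
    [100 * C * eps], [levelsum_lower] gives [2 * rho * mass <= 4 * C * V k]; elsewhere few points
    remain. *)
Lemma side_bound : \sum_(x <- S) Num.min (F x ^+ 2) ((2 * rho) ^+ 2) <=
  (2 * rho) ^+ 2 * (N * (C * (100 * C * eps))) + 2 * (4 * C) * 4 ^+ d * (N * rho ^+ 2 * eps).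
Proof.
have N0 : 0 < N by rewrite ltr0n cardfs_gt0.
have C0 : 0 <= C := le_trans ler01 C1.
have W0 t : 0 <= levelsum X i w t by apply: sumr_ge0 => x _; exact: wge.
apply: (hardy_levels d S kap F tau (fun k => levelsum X i w (lev k)) n) => //.
- by rewrite mulr_ge0 // ltW.
- by rewrite mulr_ge0.
- by rewrite !mulr_ge0 ?(ltW N0).
- move=> k kn; have [h|h] := leP (100 * C * eps) (tailw d (th (lev k - 1))); last first.
    left; apply: le_trans (hmass k) _; rewrite ler_pM2l // ler_wpM2l //; exact: ltW.
  have := levelsum_lower X i th w rho eps C b X0 hth w0 rho0 C1 e0 tail hb hbN drift up err (lev k) h.
  rewrite -/N => hW; have q0 : 0 <= tailw d (th (lev k - 1)) by apply: tailw_ge0; case: (hth (lev k - 1)).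
  have mass : 2 * rho * (\sum_(x <- S) (k < kap x)%:R) <= 4 * C * levelsum X i w (lev k).
    have h1 := ler_wpM2l (mulr_ge0 (ler0n R 2) (ltW rho0)) (hmass k).
    have h2 := ler_wpM2l C0 hW; lra.
  (* An empty slice has slice sum 0, and the lower bound then leaves no point beyond it. *)
  have [s0|sne] := eqVneq (slice X i (lev k)) fset0.
    left; have z : levelsum X i w (lev k) = 0 by rewrite /levelsum s0 big_seq_fset0.
    have h1 : 2 * rho * (\sum_(x <- S) (k < kap x)%:R) <= 0 by rewrite z mulr0 in mass.
    have : \sum_(x <- S) (k < kap x)%:R <= 0 :> R.
      by move: h1; rewrite pmulr_rle0 // mulr_gt0.
    by move/le_trans; apply; rewrite !mulr_ge0 ?(ltW N0).
  right; split => //; case/fset0Pn: sne => x; rewrite in_slice => /andP[xX /eqP xt]; rewrite /tau -xt; exact: up.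
- apply: le_trans gaps.
  apply: (@le_trans _ _ (\sum_(k < n) \sum_(x <- X) (x ord0 i == lev k)%:R * (w x * gap d (T0 (x ord0 i) - T0 (x ord0 i - 1))))).
    rewrite big_mkcond /=; apply: ler_sum => k _.
    have e : \sum_(x <- X) (x ord0 i == lev k)%:R * (w x * gap d (T0 (x ord0 i) - T0 (x ord0 i - 1))) =
       levelsum X i w (lev k) * gap d (tau k).
      rewrite /levelsum sum_slice mulr_suml [RHS]big_mkcond /=; apply: eq_bigr => x _.
      by case: eqP => [->|]; rewrite ?mul1r ?mul0r.
    rewrite e; case: ifP => // tk; rewrite -e; apply: sumr_fset_ge0 => x xX.
    by rewrite mulr_ge0 // mulr_ge0 // gap_ge0 // up.
  rewrite exchange_big /=; apply: ler_sum_fset => x xX; rewrite -mulr_suml.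
  apply: ler_piMl; first by rewrite mulr_ge0 // gap_ge0 // up.
  rewrite -natr_sum -[leRHS]/(1%:R) ler_nat.
  have [/existsP[k /eqP e]|/existsPn ne] := boolP [exists k : 'I_n, x ord0 i == lev k].
    rewrite (bigD1 k) //= e eqxx big1 // => l lk.
    by case: eqP => // /lev_inj e2; case/negP: lk; apply/eqP/val_inj.
  by rewrite big1 // => k _; rewrite (negPf (ne k)).
Qed.

End SideBound.

Section CoordinateStability.
Context {R : realType} {d : nat}.

Lemma sum_split3 (X : {fset pt d}) (i : 'I_d) (tc : int) (F : pt d -> R) :
  (forall x : pt d, x ord0 i = tc -> F x = 0) ->
  \sum_(x <- X) F x = \sum_(x <- [fset x in X | (tc < x ord0 i)%R]%fset) F x
    + \sum_(x <- [fset x in X | (x ord0 i < tc)%R]%fset) F x.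
Proof.
move=> F0; rewrite -!big_fset_condE /= [X in _ = X + _]big_mkcond [X in _ = _ + X]big_mkcond -big_split /=.
by apply: eq_bigr => x _; case: ltgtP => h; rewrite ?addr0 ?add0r // F0.
Qed.

Lemma floor_near (a : R) : `|(Num.floor a)%:~R - a| <= 1.
Proof.
have h1 := floor_le_tmp a; have h2 := floorD1_gt a.
by rewrite rmorphD /= in h2; rewrite ler_norml; apply/andP; split; lra.
Qed.

Lemma int_dist_gt (a b : int) (k : nat) : b < a ->
  [/\ b + (absz (a - b)%R)%:Z = a, (absz (a - b)%R)%:Z = a - b
    & (k < absz (a - b)%R)%N -> b + k.+1%:Z <= a].
Proof. by split; lia. Qed.

Lemma int_dist_lt (a b : int) (k : nat) : a < b ->
  [/\ b - (absz (a - b)%R)%:Z = a, (absz (a - b)%R)%:Z = b - a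
    & (k < absz (a - b)%R)%N -> a < b - k%:Z].
Proof. by split; lia. Qed.

(** The drift of [T0] from a translation is estimated on each side of the level where [th] changes
    sign. Truncation at [(2 * rho)^2] is harmless because [T0] and the clipped translation both take
    values in [[-rho, rho]]. *)
Lemma coordinate_stability : (2 <= d)%N -> exists2 K : R, 0 < K &
  forall (X : {fset pt d}) (i : 'I_d) (w : pt d -> R) (rho eps : R),
  X != fset0 -> 0 < rho -> omega R d * rho ^+ d = #|` X|%:R ->
  (forall x, x \notin X -> w x = 0) -> (forall x, 0 <= w x) -> 0 <= eps <= 1 ->
  entries_tot X <= #|` X|%:R * eps ->
  2^-1 * energy X w - d%:R * (\sum_(x <- X) w x)
    + 2^-1 * rho ^+ 2 * (#|` X|%:R * cdim d + 9 * entries_tot X) <= #|` X|%:R * rho ^+ 2 * eps ->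
  exists z : int, \sum_(y <- edom X i) (grad i w y + clip rho (y ord0 i - z)%:~R) ^+ 2
    <= K * (#|` X|%:R * rho ^+ 2 * eps).
Proof.
move=> hd; have [C C1 tail] := @tail_le_tailw R d.
have C0 : 0 <= C := le_trans ler01 C1.
pose K1 : R := 4 * (C * (100 * C)) + 2 * (4 * C) * 4 ^+ d.
have K10 : 0 <= K1 by rewrite addr_ge0 // !mulr_ge0 // exprn_ge0.
exists (4 + 2 * (4 * K1 + 6)); first lra.
move=> X i w rho eps X0 rho0 vol w0 wge /andP[e0 e1] hb hJ.
set N : R := #|` X|%:R in hb hJ *; have N0 : 0 < N by rewrite ltr0n cardfs_gt0.
have [th [hth up drift sv]] := saint_venant X w i rho hd rho0 X0 vol w0 wge.
set T0 := fun t => rho * sin (th t) in up drift sv.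
have iso := isoperimetric X rho hd rho0 X0 vol.
(* By isoperimetry and [hb]; hence a constant error per point, such as the rounding of the centre,
   is at most [rho^2 * eps]. *)
have re : 1 <= rho * eps.
  have : N * 1 <= N * (rho * eps) by rewrite mulr1; apply: le_trans iso _; have := ler_wpM2l (ltW rho0) hb; lra.
  by rewrite ler_pM2l.
have re2 : 1 <= rho ^+ 2 * eps.
  have : 1 <= rho by apply: le_trans re _; rewrite ler_piMr // ltW.
  nra.
have sv0 : 0 <= \sum_(x <- X) w x * gap d (T0 (x ord0 i) - T0 (x ord0 i - 1)).
  by apply: sumr_fset_ge0 => x xX; rewrite mulr_ge0 // gap_ge0 // up.
have err : \sum_(y <- edom X i) (grad i w y + T0 (y ord0 i)) ^+ 2 <= 2 * N * rho ^+ 2 * eps by rewrite -/N in sv; lra.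
have err0 : 0 <= \sum_(y <- edom X i) (grad i w y + T0 (y ord0 i)) ^+ 2.
  by apply: sumr_ge0 => y _; exact: sqr_ge0.
have gaps : \sum_(x <- X) w x * gap d (T0 (x ord0 i) - T0 (x ord0 i - 1)) <= N * rho ^+ 2 * eps by rewrite -/N in sv; lra.
have hbi : entries X i <= entries_tot X :> R.
  by rewrite /entries_tot (bigD1 i) //= lerDl sumr_ge0 // => j _; exact: entries_ge0.
have T0b t : `|T0 t| <= rho.
  rewrite normrM (gtr0_norm rho0) ler_piMr ?(ltW rho0) // ler_norml.
  by rewrite sin_geN1 sin_le1.
have T0d s t : T0 s - T0 t <= 2 * rho.
  by have := T0b s; have := T0b t; rewrite !ler_norml => /andP[? ?] /andP[? ?]; lra.
have [tc /andP[tc1 tc2]] := center_level X i th X0 hth.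
have [M hM] : exists M : nat, forall x, x \in X -> (absz (x ord0 i - tc)%R <= M)%N.
  exists (\sum_(x <- X) absz (x ord0 i - tc)%R)%N => x xX.
  by rewrite (big_fsetD1 x) //=; exact: leq_addr.
(* The displacement from the translation that agrees with [T0] at the central level [tc]. *)
pose F (x : pt d) := T0 (x ord0 i) - ((x ord0 i)%:~R - (tc%:~R - T0 tc)).
(* The shift comes from backward differences: the step from [tc + k] to [tc + k + 1] belongs to its
   upper end, and so does the step from [tc - k - 1] to [tc - k]. *)
pose lr k : int := tc + k.+1%:Z; pose ll k : int := tc - k%:Z.
have tele (f : nat -> R) k : \sum_(l < k) (f l.+1 - f l) = f k - f 0%N.
  by rewrite -(big_mkord predT (fun l => f l.+1 - f l)) telescope_sumr.
have bR : \sum_(x <- [fset x in X | (tc < x ord0 i)%R]%fset) Num.min (F x ^+ 2) ((2 * rho) ^+ 2) <=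
  (2 * rho) ^+ 2 * (N * (C * (100 * C * eps))) + 2 * (4 * C) * 4 ^+ d * (N * rho ^+ 2 * eps).
  have trE k : \sum_(l < k) (T0 (lr l) - T0 (lr l - 1)) = T0 (tc + k%:Z) - T0 tc.
    rewrite -[X in _ - T0 X]addr0 -(tele (fun l => T0 (tc + l%:Z))); apply: eq_bigr => l _.
    have -> : lr l - 1 = tc + l%:Z by rewrite /lr; clear; lia.
    by [].
  apply: (side_bound X _ i th w rho eps C (entries_tot X) X0 hth w0 wge rho0 C1 e0 tail hbi hb drift up err gaps lr M
     (fun x => absz (x ord0 i - tc)%R)).
  - by move=> k l; rewrite /lr; clear; lia.
  - by move=> x; rewrite !inE /= => /andP[xX _]; exact: hM.
  - move=> x; rewrite !inE /= => /andP[xX xt]; rewrite sumrB trE sumr_const card_ord.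
    congr (`| _ |); rewrite /F.
    have -> : tc + (absz (x ord0 i - tc)%R)%:Z = x ord0 i by case: (int_dist_gt _ _ 0 xt).
    rewrite [1 *+ _]pmulrn (_ : Posz _ = x ord0 i - tc); last by case: (int_dist_gt _ _ 0 xt).
    by rewrite rmorphB /=; ring.
  - by move=> k _; rewrite trE.
  - move=> k; have hlr : 0 <= th (lr k - 1).
      by apply: le_trans tc2 _; apply: (th_mono X i th X0 hth); rewrite /lr; clear; lia.
    have hin : inhalf (th (lr k - 1)) by case: (hth (lr k - 1)).
    apply: (@le_trans _ _ (N * (1 - ballcdf d (th (lr k - 1))))); last first.
      by rewrite ler_pM2l //; apply: (tail _ hin).1.
    rewrite -(upper_mass X i th X0 hth) -big_fset_condE /= big_mkcond /=.
    apply: ler_sum => x _; case: ifP => // h.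
    by rewrite ler_nat; case: (ltnP k _) => // h2; have -> : (lr k <= x ord0 i) by case: (int_dist_gt _ _ k h) => _ _; apply.
have bL : \sum_(x <- [fset x in X | (x ord0 i < tc)%R]%fset) Num.min (F x ^+ 2) ((2 * rho) ^+ 2) <=
  (2 * rho) ^+ 2 * (N * (C * (100 * C * eps))) + 2 * (4 * C) * 4 ^+ d * (N * rho ^+ 2 * eps).
  have trE k : \sum_(l < k) (T0 (ll l) - T0 (ll l - 1)) = T0 tc - T0 (tc - k%:Z).
    have -> : T0 tc - T0 (tc - k%:Z) = - T0 (tc - k%:Z) - - T0 (tc - 0%:Z) by rewrite subr0; ring.
    rewrite -(tele (fun l => - T0 (tc - l%:Z))); apply: eq_bigr => l _.
    have -> : ll l - 1 = tc - l.+1%:Z by rewrite /ll; clear; lia.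
    by rewrite opprK addrC.
  apply: (side_bound X _ i th w rho eps C (entries_tot X) X0 hth w0 wge rho0 C1 e0 tail hbi hb drift up err gaps ll M
     (fun x => absz (x ord0 i - tc)%R)).
  - by move=> k l; rewrite /ll; clear; lia.
  - by move=> x; rewrite !inE /= => /andP[xX _]; exact: hM.
  - move=> x; rewrite !inE /= => /andP[xX xt]; rewrite sumrB trE sumr_const card_ord.
    rewrite -[RHS]normrN; congr (`| _ |); rewrite /F.
    have -> : tc - (absz (x ord0 i - tc)%R)%:Z = x ord0 i by case: (int_dist_lt _ _ 0 xt).
    rewrite [1 *+ _]pmulrn (_ : Posz _ = tc - x ord0 i); last by case: (int_dist_lt _ _ 0 xt).
    by rewrite rmorphB /=; ring.
  - by move=> k _; rewrite trE.
  - move=> k; have hll : th (ll k - 1) <= 0.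
      by apply: le_trans tc1; apply: (th_mono X i th X0 hth); rewrite /ll; clear; lia.
    have hin : inhalf (th (ll k - 1)) by case: (hth (ll k - 1)).
    apply: (@le_trans _ _ (N * ballcdf d (th (ll k - 1)))); last first.
      by rewrite ler_pM2l //; apply: (tail _ hin).2.
    rewrite -(lower_mass X i th X0 hth) -big_fset_condE /= big_mkcond /=.
    apply: ler_sum => x _; case: ifP => // h.
    by rewrite ler_nat; case: (ltnP k _) => // h2; have -> : (x ord0 i < ll k) by case: (int_dist_lt _ _ k h) => _ _; apply.
have Ftc (x : pt d) : x ord0 i = tc -> Num.min (F x ^+ 2) ((2 * rho) ^+ 2) = 0.
  move=> e; have -> : F x = 0 by rewrite /F e; ring.
  by rewrite expr0n /=; apply/min_idPl; exact: sqr_ge0.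
have tot := sum_split3 X i tc (fun x => Num.min (F x ^+ 2) ((2 * rho) ^+ 2)) Ftc.
(* Rounding the real centre moves the translation by at most 1, which [clip_near] allows. *)
pose z := Num.floor (tc%:~R - T0 tc); exists z.
have hz : `|z%:~R - (tc%:~R - T0 tc)| <= 1 := floor_near _.
have cl t : (T0 t - clip rho (t - z)%:~R) ^+ 2 <= 2 * Num.min ((T0 t - (t%:~R - (tc%:~R - T0 tc))) ^+ 2) ((2 * rho) ^+ 2) + 2.
  apply: clip_near => //; first exact: ltW.
  rewrite rmorphB /=; have -> : t%:~R - z%:~R - (t%:~R - (tc%:~R - T0 tc)) = - (z%:~R - (tc%:~R - T0 tc)) by ring.
  by rewrite normrN.
have s1 : \sum_(x <- X) (T0 (x ord0 i) - clip rho (x ord0 i - z)%:~R) ^+ 2 <= (4 * K1 + 2) * (N * rho ^+ 2 * eps).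
  apply: (@le_trans _ _ (\sum_(x <- X) (2 * Num.min (F x ^+ 2) ((2 * rho) ^+ 2) + 2))).
    by apply: ler_sum_fset => x _; exact: cl.
  rewrite big_split /= -mulr_sumr tot sumr_fset_const -/N.
  have := ler_wpM2l (ltW N0) re2; rewrite /K1; lra.
have s2 : \sum_(y <- edom X i) (T0 (y ord0 i) - clip rho (y ord0 i - z)%:~R) ^+ 2 <= (4 * K1 + 6) * (N * rho ^+ 2 * eps).
  rewrite (sum_edom X i (fun y => (T0 (y ord0 i) - clip rho (y ord0 i - z)%:~R) ^+ 2)).
  have : \sum_(x <- X) (x - ev i \notin X)%:R * (T0 ((x - ev i) ord0 i) - clip rho ((x - ev i) ord0 i - z)%:~R) ^+ 2
     <= (2 * rho) ^+ 2 * entries X i.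
    rewrite /entries mulr_sumr; apply: ler_sum_fset => x _; rewrite mulrC ler_wpM2r //.
    rewrite -sqr_normr ler_pXn2r ?nnegrE ?mulr_ge0 ?(ltW rho0) //.
    apply: le_trans (ler_normB _ _) _; have := T0b ((x - ev i) ord0 i).
    by have := clip_bound rho ((x - ev i) ord0 i - z)%:~R (ltW rho0); lra.
  have : (2 * rho) ^+ 2 * entries X i <= (2 * rho) ^+ 2 * (N * eps).
    by rewrite ler_wpM2l ?sqr_ge0 // (le_trans hbi).
  lra.
apply: (@le_trans _ _ (\sum_(y <- edom X i) (2 * (grad i w y + T0 (y ord0 i)) ^+ 2
    + 2 * (T0 (y ord0 i) - clip rho (y ord0 i - z)%:~R) ^+ 2))).
  apply: ler_sum => y _; set a := grad i w y; set u := T0 _; set v := clip _ _.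
  have := sqr_ge0 (a + u + (u - v)); nra.
rewrite big_split /= -!mulr_sumr.
lra.
Qed.

End CoordinateStability.

(** * Second moments *)

Section Moment.
Context {R : realType} {d : nat}.

(** The field of clipped coordinates has divergence at most [d]. Expanding the squares, its moment
    is at most the stability error plus twice [d * \sum w - energy / 2], which [torsion_bound]
    controls. The centres come from separate Knothe maps and are just assembled into one point. *)
Lemma clipped_moment_bound : (2 <= d)%N -> exists2 K : R, 0 < K &
  forall (X : {fset pt d}) (w : pt d -> R) (rho eps : R),
  X != fset0 -> 0 < rho -> omega R d * rho ^+ d = #|` X|%:R ->
  (forall x, x \notin X -> w x = 0) -> (forall x, 0 <= w x) -> 0 <= eps <= 1 ->
  entries_tot X <= #|` X|%:R * eps ->
  2^-1 * energy X w - d%:R * (\sum_(x <- X) w x)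
    + 2^-1 * rho ^+ 2 * (#|` X|%:R * cdim d + 9 * entries_tot X) <= #|` X|%:R * rho ^+ 2 * eps ->
  exists z : pt d, \sum_(x <- X) \sum_i clip rho (x ord0 i - z ord0 i)%:~R ^+ 2
    <= #|` X|%:R * rho ^+ 2 * cdim d + K * (#|` X|%:R * rho ^+ 2 * eps).
Proof.
move=> hd; have [K K0 stab] := @coordinate_stability R d hd.
exists (d%:R * K + 9); first by rewrite addr_gt0 // mulr_gt0 // ltr0n (leq_trans _ hd).
move=> X w rho eps X0 rho0 vol w0 wge he hb hJ.
have /choice[z hz] : forall i, exists z : int, \sum_(y <- edom X i) (grad i w y + clip rho (y ord0 i - z)%:~R) ^+ 2
    <= K * (#|` X|%:R * rho ^+ 2 * eps).
  by move=> i; exact: stab.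
exists (\row_i z i); under eq_bigr do under eq_bigr do rewrite mxE.
pose xi i (y : pt d) := clip rho (y ord0 i - z i)%:~R.
set N : R := #|` X|%:R in hb hJ hz *.
have sumb : \sum_i \sum_(y <- edom X i) (grad i w y + xi i y) ^+ 2 <= d%:R * (K * (N * rho ^+ 2 * eps)).
  rewrite -[d in d%:R]card_ord mulr_natl -sumr_const; apply: ler_sum => i _; exact: hz.
have expand : \sum_i \sum_(y <- edom X i) (grad i w y + xi i y) ^+ 2 =
  energy X w + 2 * (\sum_i \sum_(y <- edom X i) grad i w y * xi i y) + \sum_i \sum_(y <- edom X i) xi i y ^+ 2.
  rewrite /energy mulr_sumr -!big_split /=; apply: eq_bigr => j _.
  rewrite mulr_sumr -!big_split /=; apply: eq_bigr => y _; ring.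
have lower : \sum_(x <- X) \sum_i xi i x ^+ 2 <= \sum_i \sum_(y <- edom X i) xi i y ^+ 2.
  rewrite exchange_big /=; apply: ler_sum => i _.
  apply: ler_sum_fset_incl => [y yX|y _ _]; last exact: sqr_ge0.
  by rewrite in_edom yX.
have parts : - (\sum_i \sum_(y <- edom X i) grad i w y * xi i y) <= d%:R * \sum_(x <- X) w x.
  rewrite -sumrN -[d in d%:R]card_ord mulr_natl -sumr_const; apply: ler_sum => i _.
  rewrite -sum_by_parts //; apply: ler_sum_fset => x _; rewrite ler_piMr // /xi subev_same.
  have -> : (x ord0 i - 1 - z i)%:~R = (x ord0 i - z i)%:~R - 1 :> R by rewrite !rmorphB /= rmorph1; ring.
  exact: clip_step.
have tb := torsion_bound X w rho hd rho0 X0 vol w0 wge; rewrite -/N in tb.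
have : rho ^+ 2 * (9 * entries_tot X) <= rho ^+ 2 * (9 * (N * eps)) by rewrite ler_wpM2l ?sqr_ge0 // ler_wpM2l.
rewrite expand in sumb; rewrite -/(\sum_(x <- X) \sum_i xi i x ^+ 2).
lra.
Qed.

End Moment.

(** * Nearest neighbours, Dirichlet energy and perimeter *)

Section Discrete.
Context {R : realType} {d : nat}.
Implicit Types (X : {fset pt d}) (p q x y : pt d) (i j : 'I_d).

Lemma dist2C p q : dist2 d p q = dist2 d q p.
Proof. by apply: eq_bigr => i _; rewrite -sqrrN opprB. Qed.

Lemma dist2_sub p q : dist2 d p q = \sum_i ((q - p) ord0 i) ^+ 2.
Proof. by apply: eq_bigr => i _; rewrite !mxE -sqrrN opprB. Qed.

Lemma dist2_ev p j : dist2 d p (p + ev j) = 1.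
Proof.
rewrite dist2_sub addrAC subrr add0r (bigD1 j) //= big1 => [|i ij]; rewrite ev_coord.
  by rewrite eqxx expr1n addr0.
by rewrite (negPf ij) expr0n.
Qed.

Lemma int_sqr_eq1 (a : int) : a ^+ 2 = 1 -> a = 1 \/ a = -1.
Proof. by move/eqP; rewrite sqrf_eq1 => /orP[] /eqP; [left | right]. Qed.

Lemma int_sqr_ge1 (a : int) : a != 0 -> 1 <= a ^+ 2.
Proof. by move=> a0; rewrite -gtz0_ge1 exprn_even_gt0. Qed.

Lemma dist2_le1 p q : dist2 d p q <= 1 -> q = p \/ exists j, q = p + ev j \/ q = p - ev j.
Proof.
rewrite dist2_sub; set v := q - p => h.
have -> : q = p + v by rewrite /v addrC subrK.
have [->|vn0] := eqVneq v 0; first by left; rewrite addr0.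
right; have [j vj] : exists j, v ord0 j != 0.
  apply/existsP; apply: contraNT vn0 => /existsPn nv; apply/eqP/matrixP => a b.
  by rewrite ord1 (eqP (negbNE (nv b))) mxE.
have rest : \sum_(i | i != j) v ord0 i ^+ 2 = 0.
  apply/eqP; rewrite eq_le; apply/andP; split; last by apply: sumr_ge0 => i _; exact: sqr_ge0.
  move: h; rewrite (bigD1 j) //=; have := int_sqr_ge1 _ vj.
  set u := v ord0 j ^+ 2; set S := \sum_(i | _) _; lia.
have vi i : i != j -> v ord0 i = 0.
  move=> ij; apply/eqP; rewrite -sqrf_eq0 eq_le sqr_ge0 andbT -rest (bigD1 i) //= lerDl.
  by apply: sumr_ge0 => k _; exact: sqr_ge0.
have v1 : v ord0 j ^+ 2 = 1.
  apply/eqP; rewrite eq_le int_sqr_ge1 // andbT; move: h.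
  by rewrite (bigD1 j) //= rest addr0.
have vE i : v ord0 i = v ord0 j * (ev j ord0 i).
  by rewrite ev_coord; have [->|ij] := eqVneq i j; [rewrite mulr1 | rewrite mulr0 vi].
exists j; case: (int_sqr_eq1 _ v1) => e; [left|right]; congr (_ + _); apply/matrixP => a b.
  by rewrite ord1 vE e mul1r.
by rewrite ord1 vE e mulN1r [RHS]mxE.
Qed.

Lemma dist2_eq1 p q : dist2 d p q = 1 -> exists j, q = p + ev j \/ q = p - ev j.
Proof.
move=> h; case: (dist2_le1 p q); [by rewrite h | move=> e | by []].
by move: h; rewrite e dist2_sub subrr big1 // => i _; rewrite mxE expr0n.
Qed.

Lemma ev_inj : injective (@ev d).
Proof.
move=> i j /matrixP/(_ ord0 i); rewrite !mxE !eqxx /=.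
by case: eqP => // ->.
Qed.

Lemma ev_neqN i j : ev i != - ev j :> pt d.
Proof.
apply/eqP => /matrixP/(_ ord0 i); rewrite !mxE !eqxx /=.
by case: eqP => _.
Qed.

Lemma dist2_indic p q :
  (dist2 d p q == 1)%:R = \sum_j ((q == p + ev j)%:R + (q == p - ev j)%:R) :> R.
Proof.
have [/eqP/dist2_eq1[j e]|ne] := boolP (dist2 d p q == 1).
  have injp k : (p + ev j == p + ev k) = (k == j).
    by rewrite (inj_eq (addrI p)) (inj_eq ev_inj) eq_sym.
  have injm k : (p - ev j == p - ev k) = (k == j).
    by rewrite (inj_eq (addrI p)) (inj_eq oppr_inj) (inj_eq ev_inj) eq_sym.
  have pm k : (p + ev j == p - ev k) = false.
    by rewrite (inj_eq (addrI p)) (negPf (ev_neqN _ _)).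
  have mp k : (p - ev j == p + ev k) = false by rewrite (inj_eq (addrI p)) eq_sym (negPf (ev_neqN _ _)).
  rewrite (bigD1 j) //= big1 ?addr0.
    by case: e => ->; rewrite ?injp ?injm ?pm ?mp eqxx ?addr0 ?add0r.
  by move=> k kj; case: e => ->; rewrite ?injp ?injm ?pm ?mp (negPf kj) addr0.
rewrite big1 // => j _; case: eqP => [e|_]; first by rewrite e dist2_ev eqxx in ne.
case: eqP => [e|_]; last by rewrite addr0.
by rewrite e dist2C -{2}[p](subrK (ev j)) dist2_ev eqxx in ne.
Qed.

Lemma in_nbhd X q : (q \in nbhd d X) = `[< exists2 p, p \in X & (dist2 d p q <= 1)%R >].
Proof.
rewrite in_fset_set; first by apply/idP/asboolP; rewrite inE.
pose Y := (X `|` \bigcup_(j <- enum 'I_d) ([fset (x + ev j)%R | x in X] `|` [fset (x - ev j)%R | x in X]))%fset.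
apply: (@sub_finite_set _ _ [set` Y]) => // y /= [p pX /dist2_le1 h].
rewrite in_fsetU; case: h => [->|[j h]]; first by rewrite pX.
apply/orP; right; apply/bigfcupP; exists j; first by rewrite mem_enum.
by rewrite in_fsetU; apply/orP; case: h => ->; [left | right]; apply/imfsetP; exists p.
Qed.

Lemma edom_nbhd X j y : y \in edom X j -> y \in nbhd d X /\ y + ev j \in nbhd d X.
Proof.
have self (p : pt d) : dist2 d p p = 0 by rewrite dist2_sub subrr big1 // => i _; rewrite mxE expr0n.
rewrite in_edom !in_nbhd => /orP[h|h]; split; apply/asboolP.
- by exists y => //; rewrite self.
- by exists y => //; rewrite dist2_ev.
- by exists (y + ev j) => //; rewrite dist2C dist2_ev.
- by exists (y + ev j) => //; rewrite self.
Qed.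

(** Ordered pairs split by direction and orientation. The two orientations give equal sums, which
    cancels the factor [1/2], and edges missing [X] carry no gradient. *)
Lemma Dir_energy X (u : pt d -> R) : (forall p, p \notin X -> u p = 0) -> Dir R d X u = energy X u.
Proof.
move=> u0; set Nb := nbhd d X.
have half j : \sum_(p <- Nb) \sum_(q <- Nb) (q == p + ev j)%:R * (u p - u q) ^+ 2 = \sum_(y <- edom X j) grad j u y ^+ 2.
  transitivity (\sum_(p <- Nb) (p + ev j \in Nb)%:R * grad j u p ^+ 2).
    apply: eq_bigr => p _; have [h|h] := boolP (p + ev j \in Nb).
      rewrite (big_fsetD1 (p + ev j)) //= eqxx big_seq big1 ?addr0.
        by rewrite /grad -sqrrN opprB.
      by move=> q; rewrite !inE => /andP[/negPf -> _]; rewrite mul0r.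
    rewrite big_seq big1 ?mul0r // => q qN; case: eqP => [e|]; last by rewrite mul0r.
    by rewrite -e qN in h.
  transitivity (\sum_(p <- edom X j) (p + ev j \in Nb)%:R * grad j u p ^+ 2).
    apply/esym/big_fset_incl; first by apply/fsubsetP => y /edom_nbhd[].
    move=> y _; rewrite in_edom negb_or => /andP[h1 h2].
    by rewrite /grad !u0 // subrr expr0n mulr0.
  by apply: eq_sum_fset => y /edom_nbhd[_ ->]; rewrite mul1r.
rewrite /Dir -/Nb.
have -> : \sum_(p <- Nb) \sum_(q <- Nb) (if dist2 d p q == 1 then (u p - u q) ^+ 2 else 0) =
  \sum_j (\sum_(p <- Nb) \sum_(q <- Nb) (q == p + ev j)%:R * (u p - u q) ^+ 2 +
     \sum_(p <- Nb) \sum_(q <- Nb) (q == p - ev j)%:R * (u p - u q) ^+ 2).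
  transitivity (\sum_(p <- Nb) \sum_(q <- Nb) \sum_j
     ((q == p + ev j)%:R * (u p - u q) ^+ 2 + (q == p - ev j)%:R * (u p - u q) ^+ 2)).
    apply: eq_bigr => p _; apply: eq_bigr => q _.
    transitivity ((dist2 d p q == 1)%:R * (u p - u q) ^+ 2); first by case: eqP; rewrite ?mul1r ?mul0r.
    by rewrite dist2_indic mulr_suml; apply: eq_bigr => j _; rewrite mulrDl.
  under eq_bigr do rewrite exchange_big /=; rewrite exchange_big /=.
  by apply: eq_bigr => j _; rewrite -big_split /=; apply: eq_bigr => p _; rewrite -big_split.
rewrite /energy mulr_sumr; apply: eq_bigr => j _.
have -> : \sum_(p <- Nb) \sum_(q <- Nb) (q == p - ev j)%:R * (u p - u q) ^+ 2 =
   \sum_(p <- Nb) \sum_(q <- Nb) (q == p + ev j)%:R * (u p - u q) ^+ 2.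
  rewrite exchange_big /=; apply: eq_bigr => q _; apply: eq_bigr => p _.
  by rewrite -[u p - u q]opprB sqrrN -(subr_eq p) eq_sym.
by rewrite half; lra.
Qed.

Lemma finite_neighbours (P : pt d -> Prop) p : finite_set [set q | P q /\ dist2 d p q = 1].
Proof.
pose Y := (\bigcup_(j <- enum 'I_d) ([fset (p + ev j)%R] `|` [fset (p - ev j)%R]))%fset.
apply: (@sub_finite_set _ _ [set` Y]) => // q /= [_ /dist2_eq1[j h]].
apply/bigfcupP; exists j; first by rewrite mem_enum.
by rewrite !inE; case: h => ->; rewrite eqxx ?orbT.
Qed.

(** For fixed [p] the points [p - ev j] outside [X] are distinct, and all are counted in [valp]. *)
Lemma entries_tot_le_Per X : entries_tot X <= (Per d X)%:R :> R.
Proof.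
rewrite /entries_tot /entries exchange_big /= /Per natr_sum; apply: ler_sum_fset => p pX.
rewrite -natr_sum ler_nat /valp.
pose L := [seq p - ev j | j <- enum 'I_d & p - ev j \notin X].
have -> : (\sum_(j < d) ((p - ev j)%R \notin X) = size L)%N.
  rewrite size_map size_filter -sum1_count [RHS]big_mkcond /= big_enum /=.
  by apply: eq_bigr => j _; case: (_ \in X).
apply: uniq_leq_size.
  rewrite map_inj_uniq ?filter_uniq -?enumT ?enum_uniq // => i j /addrI /oppr_inj; exact: ev_inj.
move=> q /mapP[j]; rewrite mem_filter => /andP[hX _] ->.
rewrite in_fset_set; last exact: finite_neighbours.
by rewrite inE /=; split => //; rewrite dist2C -[p in dist2 d _ p](subrK (ev j)) dist2_ev.
Qed.

End Discrete.

(** * Lattice balls *)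

Section RiemannSum.
Context {R : realType}.

Lemma cospow_cell n (a b : R) : 0 <= a -> a <= b -> b <= pi / 2 ->
  (sin b - sin a) * cos b ^+ n <= cospow_int n.+1 b - cospow_int n.+1 a
  <= (sin b - sin a) * cos a ^+ n.
Proof.
move=> a0 ab b1; have pih := @pihalf_ge0 R.
have der (k x : R) : is_derive x (1:R) (fun s => cospow_int n.+1 s + k * sin s) (cos x ^+ n.+1 + k * cos x).
  by apply: is_derive_add (is_derive_cospow_int _ x) _; exact/is_derive_constmul/is_derive_sin.
have eq (k x : R) : cos x ^+ n.+1 + - k * cos x = (cos x ^+ n - k) * cos x by rewrite exprS; ring.
have c0 (x : R) : a <= x <= b -> 0 <= cos x.
  by move=> /andP[x1 x2]; apply: cos_ge0_half; rewrite /inhalf; apply/andP; split; lra.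
have cdec (x y : R) : a <= x -> x <= y -> y <= b -> cos y ^+ n <= cos x ^+ n.
  move=> ax xy yb; have cxy : cos y <= cos x.
    apply: (is_derive_le0_homo cos (fun t => - sin t)) => // t /andP[t1 t2].
    by rewrite oppr_le0; apply: sin_ge0_pi; apply/andP; split; lra.
  by apply: lerXn2r; rewrite ?nnegrE ?c0 //; apply/andP; split; lra.
apply/andP; split.
  have : cospow_int n.+1 a + - cos b ^+ n * sin a <= cospow_int n.+1 b + - cos b ^+ n * sin b; last by lra.
  apply: (is_derive_ge0_homo _ _ _ _ ab (fun (x : R) _ => der (- cos b ^+ n) x)) => x hx.
  by rewrite eq mulr_ge0 ?c0 // subr_ge0 cdec //; case/andP: hx.
have : cospow_int n.+1 b + - cos a ^+ n * sin b <= cospow_int n.+1 a + - cos a ^+ n * sin a; last by lra.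
apply: (is_derive_le0_homo _ _ _ _ ab (fun (x : R) _ => der (- cos a ^+ n) x)) => x hx.
by rewrite eq mulr_le0_ge0 ?c0 // subr_le0 cdec //; case/andP: hx.
Qed.

(** The summand decreases on [t >= 0], so half of the integral lies between the half sum without and
    with its peak term [Num.sqrt h ^+ n]. The substitution [t = rho * sin (al t)] turns the integral
    into [cospow_int]. *)
Lemma sum_sqrt_pow n (h : R) (M : nat) : M%:R <= Num.sqrt h -> Num.sqrt h < M.+1%:R -> 0 <= h ->
  `|Num.sqrt h ^+ n + 2 * (\sum_(t < M) Num.sqrt (h - t.+1%:R ^+ 2) ^+ n)
    - Num.sqrt h ^+ n.+1 * cospow_tot n.+1| <= Num.sqrt h ^+ n.
Proof.
move=> hM1 hM2 h0; set rho := Num.sqrt h in hM1 hM2 *.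
have r0 : 0 <= rho by exact: sqrtr_ge0.
have r2 : rho ^+ 2 = h by rewrite sqr_sqrtr.
have pih := @pihalf_ge0 R.
have quot (t : nat) : (t <= M)%N -> 0 <= t%:R / rho <= 1.
  move=> tM; rewrite divr_ge0 //=; have [->|rn0] := eqVneq rho 0; first by rewrite invr0 mulr0.
  by rewrite ler_pdivrMr ?lt_neqAle ?(eq_sym 0) ?rn0 // mul1r (le_trans _ hM1) // ler_nat.
(* Past [M] the angle is [pi / 2], which closes the incomplete last cell. *)
pose al (t : nat) := if (t <= M)%N then asin (t%:R / rho) else pi / 2.
have sal t : (t <= M)%N -> sin (al t) = t%:R / rho.
  move=> tM; rewrite /al tM asinK // in_itv /=; have /andP[q0 q1] := quot t tM.
  by rewrite q1 andbT (le_trans _ q0) // oppr_le0.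
have rsal t : (t <= M)%N -> rho * sin (al t) = t%:R.
  move=> tM; rewrite sal //; have [e|rn0] := eqVneq rho 0; last by rewrite mulrC divfK.
  have M0 : M = 0%N by apply/eqP; rewrite -leqn0 -(ler_nat R) -[leRHS]e.
  by move: tM; rewrite M0 leqn0 => /eqP ->; rewrite e mul0r.
have alh t : inhalf (al t).
  rewrite /al; case: ifP => [tM|_]; last by rewrite /inhalf lexx andbT; lra.
  have /andP[q0 q1] := quot t tM.
  by rewrite /inhalf asin_geNpi2 ?asin_lepi2 // q1 andbT (le_trans _ q0) // oppr_le0.
have al_le t t' : sin (al t) <= sin (al t') -> al t <= al t'.
  move=> h1; rewrite leNgt; apply/negP => h2; have /andP[? _] := alh t'; have /andP[_ ?] := alh t.
  by have := sin_lt_half _ _ h2; rewrite ltNge h1 => /(_ _ _)/negP; apply.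
have al0 t : 0 <= al t.
  rewrite leNgt; apply/negP => h1; have /andP[h2 _] := alh t.
  have : sin (al t) < sin 0 by apply: sin_lt_half => //; lra.
  rewrite sin0 ltNge; case/negP; rewrite /al; case: ifP => [tM|_]; last by rewrite sin_pihalf.
  by have := sal t tM; rewrite /al tM => ->; case/andP: (quot t tM).
have rcal t : (t <= M)%N -> rho * cos (al t) = Num.sqrt (h - t%:R ^+ 2).
  move=> tM; have /andP[q0 q1] := quot t tM.
  have c0 : 0 <= rho * cos (al t) by rewrite mulr_ge0 // cos_ge0_half.
  rewrite -[LHS](ger0_norm c0) -sqrtr_sqr exprMn cos2sin2 mulrBr mulr1 -exprMn rsal // r2.
  by [].
pose F t := rho ^+ n.+1 * cospow_int n.+1 (al t).
have alM1 t : (M < t)%N -> al t = pi / 2 by rewrite /al ltnNge => /negPf ->.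
have step t : (t < M)%N -> Num.sqrt (h - t.+1%:R ^+ 2) ^+ n <= F t.+1 - F t <= Num.sqrt (h - t%:R ^+ 2) ^+ n.
  move=> tM; have tM' := ltnW tM.
  have le : al t <= al t.+1.
    apply: al_le; rewrite !sal //; have [e|rn0] := eqVneq rho 0; first by rewrite e invr0 !mulr0.
    by rewrite ler_pM2r ?invr_gt0 ?lt_neqAle ?(eq_sym 0) ?rn0 // ler_nat.
  have /andP[_ ub] := alh t.+1.
  have := cospow_cell n _ _ (al0 t) le ub; set S := sin _ - sin _.
  have rS : rho * S = 1 by rewrite /S mulrBr !rsal // -natrB // subSnn.
  have rn : 0 <= rho ^+ n.+1 by rewrite exprn_ge0.
  rewrite -!rcal // /F -mulrBr !exprMn => /andP[h1 h2].
  have e k : rho ^+ n * cos (al k) ^+ n = rho ^+ n.+1 * (S * cos (al k) ^+ n).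
    transitivity (rho ^+ n * cos (al k) ^+ n * (rho * S)); first by rewrite rS mulr1.
    by rewrite exprSr; ring.
  by rewrite !e !ler_wpM2l.
have last : F M.+1 - F M <= Num.sqrt (h - M%:R ^+ 2) ^+ n.
  have le : al M <= al M.+1 by rewrite (alM1 M.+1) //; case/andP: (alh M).
  have /andP[_ ub] := alh M.+1.
  have /andP[_ h2] := cospow_cell n _ _ (al0 M) le ub.
  have rS : rho * (sin (al M.+1) - sin (al M)) <= 1.
    by rewrite mulrBr (rsal M) // (alM1 M.+1) // sin_pihalf mulr1; move: hM2; rewrite -natr1; lra.
  rewrite -rcal // /F -mulrBr exprMn; apply: le_trans (ler_wpM2l (exprn_ge0 n.+1 r0) h2) _.
  have -> : rho ^+ n.+1 * ((sin (al M.+1) - sin (al M)) * cos (al M) ^+ n) =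
    rho * (sin (al M.+1) - sin (al M)) * (rho ^+ n * cos (al M) ^+ n) by rewrite exprSr; ring.
  by rewrite ler_piMl // mulr_ge0 ?exprn_ge0 // cos_ge0_half.
have F0 : F 0%N = 0.
  rewrite /F; have -> : al 0%N = 0.
    apply/eqP; rewrite eq_le al0 andbT leNgt; apply/negP => h1; have /andP[_ h2] := alh 0%N.
    have : sin 0 < sin (al 0%N) by apply: sin_lt_half => //; lra.
    by rewrite sin0 sal // mul0r ltxx.
  by have := cospow_intN n.+1 (0 : R); rewrite oppr0 => e; suff -> : cospow_int n.+1 (0 : R) = 0; [rewrite mulr0 | lra].
have FM1 : F M.+1 = rho ^+ n.+1 * cospow_tot n.+1 / 2.
  by rewrite /F alM1 // /cospow_tot cospow_intN; field.
set S := \sum_(t < M) _.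
have tele : \sum_(t < M) (F t.+1 - F t) = F M.
  by rewrite -(big_mkord predT (fun t => F t.+1 - F t)) telescope_sumr // F0 subr0.
have up : S <= F M by rewrite -tele; apply: ler_sum => t _; case/andP: (step t (ltn_ord t)).
have FMle : F M <= F M.+1.
  rewrite /F ler_wpM2l ?exprn_ge0 //.
  have le : al M <= al M.+1 by rewrite (alM1 M.+1) //; case/andP: (alh M).
  have /andP[_ ub] := alh M.+1.
  have /andP[h1 _] := cospow_cell n _ _ (al0 M) le ub.
  rewrite -subr_ge0; apply: le_trans h1; apply: mulr_ge0; last by rewrite exprn_ge0 // cos_ge0_half.
  have /andP[? _] := alh M; by rewrite subr_ge0 sin_homo_half.
have low : F M.+1 <= rho ^+ n + S.
  have -> : rho ^+ n + S = \sum_(t < M.+1) Num.sqrt (h - t%:R ^+ 2) ^+ n.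
    by rewrite big_ord_recl expr0n /= subr0.
  rewrite big_ord_recr /=; have : F M <= \sum_(t < M) Num.sqrt (h - t%:R ^+ 2) ^+ n.
    by rewrite -tele; apply: ler_sum => t _; case/andP: (step t (ltn_ord t)).
  lra.
rewrite ler_norml; apply/andP; split; lra.
Qed.

End RiemannSum.

Section LatticeCount.
Context {R : realType} {d : nat}.
Implicit Types (s : seq 'I_d) (h : R) (p q : pt d) (i j : 'I_d).

Definition sqnorm p : int := \sum_i p ord0 i ^+ 2.

Lemma sqnorm_ge p i : p ord0 i ^+ 2 <= sqnorm p.
Proof. by rewrite /sqnorm (bigD1 i) //= lerDl; apply: sumr_ge0 => j _; exact: sqr_ge0. Qed.

Lemma sqnorm_ge0 p : 0 <= sqnorm p.
Proof. by apply: sumr_ge0 => j _; exact: sqr_ge0. Qed.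

Lemma coord_le_sqrt p i h (M : nat) : (sqnorm p)%:~R <= h -> Num.sqrt h < M.+1%:R ->
  (absz (p ord0 i) <= M)%N.
Proof.
move=> hp hM; have h0 : 0 <= h by apply: le_trans hp; rewrite ler0z sqnorm_ge0.
have : `|(p ord0 i)%:~R| <= Num.sqrt h :> R.
  rewrite -sqrtr_sqr ler_wsqrtr // -rmorphXn /= (le_trans _ hp) // ler_int.
  exact: sqnorm_ge.
move/le_lt_trans/(_ hM); rewrite -intr_norm -[M.+1%:R]/(M.+1%:Z%:~R) ltr_int.
by lia.
Qed.

(** Indexed by the squared radius, since slicing at height [t] replaces [h] by [h - t^2]. *)
Definition latset s h : set (pt d) :=
  [set p : pt d | (forall j, j \notin s -> p ord0 j = 0) /\ (sqnorm p)%:~R <= h].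

Lemma exists_sqrt_floor h : exists2 M : nat, M%:R <= Num.sqrt h & Num.sqrt h < M.+1%:R.
Proof.
exists (Num.truncn (Num.sqrt h)); first by rewrite truncn_le // sqrtr_ge0.
exact: truncnS_gt.
Qed.

Lemma box_repr (a : int) (M : nat) : (absz a <= M)%N ->
  (absz (a + M%:Z)%R < M.*2.+1)%N /\ (absz (a + M%:Z))%:Z - M%:Z = a.
Proof. by split; lia. Qed.

Lemma finite_latset s h : finite_set (latset s h).
Proof.
have [M hM1 hM2] := exists_sqrt_floor h.
pose g (f : {ffun 'I_d -> 'I_(M.*2.+1)}) : pt d := \row_j ((f j)%:Z - M%:Z).
apply: (@sub_finite_set _ _ (g @` setT)); last exact: finite_image finite_finset.
move=> p [_ hp]; exists [ffun j => inord (absz (p ord0 j + M%:Z))] => //.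
apply/matrixP => a j; rewrite ord1 mxE ffunE.
have := coord_le_sqrt p j h M hp hM2 => hj.
have [h1 h2] := box_repr _ _ hj.
by have -> := inordK h1; rewrite h2 (ord1 a).
Qed.

Definition lat s h : {fset pt d} := fset_set (latset s h).

Lemma in_lat s h p : (p \in lat s h) =
  [forall j, (j \notin s) ==> (p ord0 j == 0)] && ((sqnorm p)%:~R <= h).
Proof.
rewrite in_fset_set; last exact: finite_latset.
apply/idP/andP => [|[/forallP h1 h2]].
  rewrite inE => -[h1 h2]; split => //; apply/forallP => j; apply/implyP => /h1 ->.
  by [].
by rewrite inE; split => // j js; have /implyP/(_ js)/eqP := h1 j.
Qed.

Lemma card_slice_lat i s h (t : int) : i \notin s -> t%:~R ^+ 2 <= h ->
  #|` slice (lat (i :: s) h) i t| = #|` lat s (h - t%:~R ^+ 2)|.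
Proof.
move=> nis th.
pose put (a : int) p : pt d := \row_j (if j == i then a else p ord0 j).
have putE a p j : put a p ord0 j = if j == i then a else p ord0 j by rewrite mxE.
have nput a p : sqnorm (put a p) + p ord0 i ^+ 2 = sqnorm p + a ^+ 2.
  rewrite /sqnorm (bigD1 i) //= [\sum_i p ord0 i ^+ 2](bigD1 i) //= putE eqxx.
  rewrite (eq_bigr (fun j => p ord0 j ^+ 2)); last by move=> j /negPf ji; rewrite putE ji.
  by ring.
have inj a b (p q : pt d) : p ord0 i = b -> q ord0 i = b -> put a p = put a q -> p = q.
  move=> pb qb e; apply/matrixP => r j; rewrite ord1.
  have [->|ji] := eqVneq j i; first by rewrite pb qb.
  by have := congr1 (fun m : pt d => m ord0 j) e; rewrite !putE (negPf ji).
have in0 p : p \in lat s (h - t%:~R ^+ 2) -> p ord0 i = 0.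
  by rewrite in_lat => /andP[/forallP/(_ i)/implyP/(_ nis)/eqP].
apply/eqP; rewrite eqn_leq; apply/andP; split.
  apply: (card_le_inj _ _ _ (put 0)).
    move=> p q; rewrite !in_slice => /andP[_ /eqP ept] /andP[_ /eqP eqt]; exact: inj ept eqt.
  move=> p; rewrite in_slice !in_lat => /andP[/andP[/forallP hp hn] /eqP ept]; apply/andP; split.
    apply/forallP => j; apply/implyP => js; rewrite putE; have [//|ji] := eqVneq j i.
    by have /implyP := hp j; apply; rewrite inE negb_or ji.
  have := nput 0 p; rewrite ept expr0n addr0 => /(congr1 (fun z : int => z%:~R : R)).
  by rewrite rmorphD rmorphXn /= => e; rewrite lerBrDr e.
apply: (card_le_inj _ _ _ (put t)).
  by move=> p q /in0 p0 /in0 q0; exact: inj p0 q0.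
move=> p hp; have p0 := in0 _ hp; move: hp; rewrite in_slice !in_lat putE eqxx /= eqxx andbT.
move=> /andP[/forallP hp hn]; apply/andP; split.
  apply/forallP => j; apply/implyP; rewrite inE negb_or => /andP[/negPf ji js].
  by rewrite putE ji; have /implyP := hp j; apply.
have := nput t p; rewrite p0 expr0n addr0 => ->.
by rewrite rmorphD rmorphXn /= -lerBrDr.
Qed.

Lemma card_split_sym (Y : {fset pt d}) i (M : nat) : (forall p, p \in Y -> (absz (p ord0 i) <= M)%N) ->
  #|` Y|%:R = #|` slice Y i 0|%:R + \sum_(t < M) (#|` slice Y i t.+1%:Z|%:R + #|` slice Y i (- t.+1%:Z)|%:R) :> R.
Proof.
move=> hY.
have cs t : #|` slice Y i t|%:R = \sum_(p <- Y) (p ord0 i == t)%:R :> R by rewrite sum_indic_card.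
rewrite cs; under [X in _ = _ + X]eq_bigr do rewrite !cs -big_split /=.
rewrite exchange_big -big_split /= -[LHS]mulr1 -sumr_fset_const; apply: eq_sum_fset => p /hY hp.
case: (intP (p ord0 i)) hp => [|n|n] hp.
- by rewrite eqxx big1 ?addr0 // => t _; rewrite addr0.
- rewrite add0r (bigD1 (Ordinal (hp : (n < M)%N))) //= eqxx big1 ?addr0 // => t tn.
  have -> : (n.+1%:Z == t.+1%:Z) = false.
    by apply/negbTE; apply: contra tn => /eqP[e]; apply/eqP/val_inj.
  by rewrite add0r.
- have hn : (n < M)%N by lia.
  rewrite add0r (bigD1 (Ordinal hn)) //= eqxx add0r big1 ?addr0 // => t tn.
  have -> : (- n.+1%:Z == - t.+1%:Z) = false.
    by apply/negbTE; apply: contra tn => /eqP/oppr_inj[e]; apply/eqP/val_inj.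
  by rewrite addr0.
Qed.

(** Induction by slicing. The clause [K = 0] for the empty list matters: the exponent [(size s).-1]
    is 0 in dimensions 0 and 1 alike, so a positive constant in dimension 0 would turn into an error
    of order [M] in dimension 1. *)
Lemma card_lat s : uniq s -> exists2 K : R, 0 <= K /\ (s = [::] -> K = 0) &
  forall h, 0 <= h -> `|#|` lat s h|%:R - omega R (size s) * Num.sqrt h ^+ size s|
     <= K * (1 + Num.sqrt h) ^+ (size s).-1.
Proof.
elim: s => [_|i s IH /andP[nis us]].
  exists 0 => // h h0; rewrite mul0r expr0 mulr1.
  have -> : lat [::] h = [fset (0 : pt d)]%fset.
    apply/fsetP => p; rewrite in_lat inE; apply/andP/eqP => [[/forallP hp _]|->].
      by apply/matrixP => a j; rewrite ord1 mxE; exact/eqP/(implyP (hp j)).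
    split; first by apply/forallP => j; rewrite mxE.
    by rewrite /sqnorm big1 ?h0 // => j _; rewrite mxE.
  by rewrite cardfs1 subrr normr0.
have [K [K0 Knil] IHK] := IH us; set n := size s in IHK *; rewrite -[size (i :: s)]/n.+1.
exists (2 * K + omega R n) => [|h h0].
  by split => //; rewrite addr_ge0 ?mulr_ge0 ?(ltW (omega_gt0 _)).
have [M hM1 hM2] := exists_sqrt_floor h; set rho := Num.sqrt h in hM1 hM2 *.
have r0 : 0 <= rho := sqrtr_ge0 h.
have r2 : rho ^+ 2 = h by rewrite sqr_sqrtr.
rewrite (card_split_sym _ i M); last by move=> p; rewrite in_lat => /andP[_ /coord_le_sqrt]; apply.
have sq (t : nat) : (t <= M)%N -> t%:R ^+ 2 <= h.
  by move=> tM; rewrite -r2 lerXn2r ?nnegrE // (le_trans _ hM1) // ler_nat.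
have err (t : nat) : (t <= M)%N ->
  `|#|` lat s (h - t%:R ^+ 2)|%:R - omega R n * Num.sqrt (h - t%:R ^+ 2) ^+ n| <= K * (1 + rho) ^+ n.-1.
  move=> tM; have h1 : 0 <= h - t%:R ^+ 2 by rewrite subr_ge0 sq.
  apply: le_trans (IHK _ h1) _; rewrite ler_wpM2l // lerXn2r ?nnegrE ?addr_ge0 ?sqrtr_ge0 //.
  by rewrite lerD2l ler_wsqrtr // gerBl sqr_ge0.
pose c (t : nat) : R := #|` lat s (h - t%:R ^+ 2)|%:R.
have e0 : #|` slice (lat (i :: s) h) i 0|%:R = c 0%N.
  by rewrite card_slice_lat // expr0n.
have et (t : 'I_M) : #|` slice (lat (i :: s) h) i t.+1%:Z|%:R + #|` slice (lat (i :: s) h) i (- t.+1%:Z)|%:R = 2 * c t.+1.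
  have st : (t.+1%:Z%:~R : R) ^+ 2 <= h by exact: sq.
  rewrite !card_slice_lat //; last by rewrite rmorphN sqrrN.
  by rewrite rmorphN sqrrN -[_%:~R]/(t.+1%:R) /c; ring.
rewrite e0 (eq_bigr _ (fun t _ => et t)) -mulr_sumr.
have := sum_sqrt_pow n h M hM1 hM2 h0; rewrite -/rho.
set S := \sum_(t < M) _; set T := \sum_(t < M) _; move=> hS.
have hT : `|c 0%N - omega R n * rho ^+ n| <= K * (1 + rho) ^+ n.-1.
  by have := err 0%N (leq0n _); rewrite /c expr0n /= subr0.
have hTS : `|T - omega R n * S| <= M%:R * (K * (1 + rho) ^+ n.-1).
  rewrite /T /S mulr_sumr -sumrB; apply: le_trans (ler_norm_sum _ _ _) _.
  rewrite -[M in M%:R]card_ord mulr_natl -sumr_const; apply: ler_sum => t _; exact: err.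
rewrite omegaS.
have hn : (2 * M%:R + 1) * (K * (1 + rho) ^+ n.-1) <= 2 * K * (1 + rho) ^+ n.
  have [s0|sn] := eqVneq s [::]; first by rewrite (Knil s0) !mulr0 !mul0r.
  have n0 : (0 < n)%N by rewrite /n lt0n size_eq0.
  rewrite -{2}(prednK n0) exprS mulrA [leRHS]mulrA ler_wpM2r ?exprn_ge0 ?addr_ge0 //.
  by have := ler_wpM2l K0 hM1; lra.
have hr : rho ^+ n <= (1 + rho) ^+ n by rewrite lerXn2r ?nnegrE ?addr_ge0 // lerDr.
have hw : `|omega R n * (rho ^+ n + 2 * S - rho ^+ n.+1 * cospow_tot n.+1)| <= omega R n * (1 + rho) ^+ n.
  rewrite normrM (gtr0_norm (omega_gt0 _)) ler_pM2l ?omega_gt0 //; exact: le_trans hS hr.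
have -> : c 0%N + 2 * T - omega R n * cospow_tot n.+1 * rho ^+ n.+1 =
  (c 0%N - omega R n * rho ^+ n) + 2 * (T - omega R n * S) +
  omega R n * (rho ^+ n + 2 * S - rho ^+ n.+1 * cospow_tot n.+1) by ring.
apply: le_trans (ler_normD _ _) _.
have := ler_normD (c 0%N - omega R n * rho ^+ n) (2 * (T - omega R n * S)).
rewrite [X in _ <= _ + X]normrM (ger0_norm (ler0n R 2)).
lra.
Qed.

End LatticeCount.

Section LatticeBall.
Context {R : realType} {d : nat}.
Implicit Types (h rho : R) (p q : pt d).

Definition lball h : {fset pt d} := lat (enum 'I_d) h.

Lemma in_lball h p : (p \in lball h) = ((sqnorm p)%:~R <= h).
Proof.
rewrite in_lat; case: forallP => //= nf; exfalso; apply: nf => j.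
by rewrite mem_enum.
Qed.

Lemma lball_card : exists2 C : R, 0 < C & forall rho t, 1 <= rho -> 0 <= t <= 1 ->
  `|#|` lball (rho ^+ 2 * t)|%:R - omega R d * rho ^+ d * Num.sqrt t ^+ d| <= C * (omega R d * rho ^+ d / rho).
Proof.
have [K [K0 Kn] hK] := card_lat (R := R) (enum 'I_d) (enum_uniq _).
rewrite size_enum_ord in hK.
have w0 := @omega_gt0 R d.
exists (K * 2 ^+ d / omega R d + 1); first by rewrite ltr_wpDl // divr_ge0 ?mulr_ge0 ?exprn_ge0 // ltW.
move=> rho t rho1 /andP[t0 t1]; have rho0 : 0 < rho by lra.
have st1 : Num.sqrt t <= 1 by rewrite -[1]sqrtr1 ler_wsqrtr.
have st0 := sqrtr_ge0 t.
have -> : omega R d * rho ^+ d * Num.sqrt t ^+ d = omega R d * Num.sqrt (rho ^+ 2 * t) ^+ d.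
  by rewrite sqrtrM ?sqr_ge0 // sqrtr_sqr (gtr0_norm rho0) exprMn mulrA.
apply: le_trans (hK _ _) _; first by rewrite mulr_ge0 // sqr_ge0.
have srt : Num.sqrt (rho ^+ 2 * t) <= rho.
  by rewrite sqrtrM ?sqr_ge0 // sqrtr_sqr (gtr0_norm rho0) ler_piMr // ltW.
have [d0|dp] := posnP d.
  have Kz : K = 0 by apply: Kn; apply/eqP; rewrite -size_eq0 size_enum_ord d0.
  by rewrite Kz !mul0r add0r mul1r divr_ge0 ?mulr_ge0 ?exprn_ge0 // ltW.
have -> : omega R d * rho ^+ d / rho = omega R d * rho ^+ d.-1.
  have -> : rho ^+ d = rho * rho ^+ d.-1 by rewrite -exprS prednK.
  by have := lt0r_neq0 rho0 => h; field.
rewrite mulrDl mul1r -[leLHS]addr0; apply: lerD; last by rewrite mulr_ge0 ?exprn_ge0 // ltW.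
have -> : K * 2 ^+ d / omega R d * (omega R d * rho ^+ d.-1) = K * (2 ^+ d * rho ^+ d.-1).
  by have := lt0r_neq0 w0 => h; field.
rewrite ler_wpM2l //; apply: (@le_trans _ _ ((2 * rho) ^+ d.-1)).
  by rewrite lerXn2r ?nnegrE ?addr_ge0 ?sqrtr_ge0 ?mulr_ge0 ?(ltW rho0) //; lra.
rewrite exprMn ler_wpM2r ?exprn_ge0 ?(ltW rho0) //.
have -> : (2 : R) ^+ d = 2 * 2 ^+ d.-1 by rewrite -exprS prednK.
by rewrite ler_peMl ?exprn_ge0 //; lra.
Qed.

Definition lshell rho t : {fset pt d} := [fset p in lball (rho ^+ 2) | rho ^+ 2 * (1 - t) < (sqnorm p)%:~R]%fset.

(** A difference of two ball counts; the volumes are compared by Bernoulli, after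
    [1 - t <= sqrt (1 - t)]. *)
Lemma lball_shell : exists2 C : R, 0 < C & forall rho t, 1 <= rho -> 0 <= t <= 1 ->
  #|` lshell rho t|%:R <= C * (omega R d * rho ^+ d) * (t + rho^-1).
Proof.
have [C C0 hC] := lball_card; exists (2 * C + d%:R + 1); first by rewrite ltr_wpDl // addr_ge0 // ?mulr_ge0 // ltW.
move=> rho t rho1 /andP[t0 t1]; have rho0 : 0 < rho by lra.
set N := omega R d * rho ^+ d; have N0 : 0 < N by rewrite mulr_gt0 ?omega_gt0 // exprn_gt0.
have split : #|` lball (rho ^+ 2)|%:R = #|` lball (rho ^+ 2 * (1 - t))|%:R + #|` lshell rho t|%:R :> R.
  rewrite -natrD; congr (_%:R); rewrite -(cardfsID (lball (rho ^+ 2 * (1 - t))) (lball (rho ^+ 2))); congr (_ + _)%N.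
    congr (size (enum_fset _)); apply/fsetP => p; rewrite inE !in_lball andbC; apply: andb_idr => h.
    by apply: le_trans h _; rewrite ler_piMr ?sqr_ge0 //; lra.
  by congr (size (enum_fset _)); apply/fsetP => p; rewrite !inE !in_lball andbC -ltNge.
have h1 := hC rho 1 rho1; have h2 := hC rho (1 - t) rho1.
rewrite sqrtr1 expr1n !mulr1 -/N in h1; rewrite -/N in h2.
have {h1} : `|#|` lball (rho ^+ 2)|%:R - N| <= C * (N / rho) by apply: h1; apply/andP; split; lra.
have {h2} : `|#|` lball (rho ^+ 2 * (1 - t))|%:R - N * Num.sqrt (1 - t) ^+ d| <= C * (N / rho).
  by apply: h2; apply/andP; split; lra.
rewrite !ler_norml => /andP[h3 _] /andP[_ h4].
have sq : 1 - d%:R * t <= Num.sqrt (1 - t) ^+ d.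
  have bern (x : R) n : 0 <= x <= 1 -> 1 - n%:R * x <= (1 - x) ^+ n.
    move=> /andP[x0 x1]; elim: n => [|n IH]; first by rewrite mul0r subr0 expr0.
    have y0 : 0 <= 1 - x by lra.
    rewrite exprS; have := ler_wpM2l y0 IH; rewrite -natr1.
    have : 0 <= n%:R * x ^+ 2 by rewrite mulr_ge0 ?sqr_ge0.
    lra.
  apply: le_trans (bern t d _) _; first by apply/andP.
  rewrite lerXn2r ?nnegrE ?sqrtr_ge0 //; first lra.
  have y0 : 0 <= 1 - t by lra.
  rewrite -{1}(sqr_sqrtr y0) expr2 ler_piMl ?sqrtr_ge0 // -[leRHS]sqrtr1 ler_wsqrtr //; lra.
have h5 := ler_wpM2l (ltW N0) sq.
have : 0 <= N / rho by rewrite divr_ge0 // ltW.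
have : 0 <= N * t by rewrite mulr_ge0 // ltW.
have : 0 <= d%:R * (N / rho) by rewrite mulr_ge0 ?divr_ge0 // ltW.
have : 0 <= C * (N * t) by apply: mulr_ge0 (ltW C0) (mulr_ge0 (ltW N0) t0).
rewrite !mulrDl !mulrDr; lra.
Qed.

Lemma sqnorm_addev p (j : 'I_d) : sqnorm (p + ev j) = sqnorm p + 2 * p ord0 j + 1.
Proof.
rewrite /sqnorm (bigD1 j) //= [\sum_i p ord0 i ^+ 2](bigD1 j) //= addev_coord.
have -> : (j == j)%:R = 1 :> int by rewrite eqxx.
rewrite (eq_bigr (fun i => p ord0 i ^+ 2)); last by move=> i /negPf ij; rewrite addev_coord ij addr0.
set S := \sum_(i | _) _; set a := p ord0 j; rewrite sqrrD expr1n mulr1.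
by rewrite -!addrA; congr (_ + _); rewrite mulrC mulr_natr [RHS]addrC -!addrA; congr (_ + _); rewrite addrC.
Qed.

Lemma sqnorm_subev p (j : 'I_d) : sqnorm (p - ev j) = sqnorm p - 2 * p ord0 j + 1.
Proof. by have := sqnorm_addev (p - ev j) j; rewrite subrK subev_same => ->; ring. Qed.

Lemma energy_laplace (X : {fset pt d}) (w : pt d -> R) : (forall x, x \notin X -> w x = 0) ->
  energy X w = \sum_(x <- X) w x * \sum_j (2 * w x - w (x + ev j) - w (x - ev j)).
Proof.
move=> w0; under [RHS]eq_bigr do rewrite mulr_sumr.
rewrite exchange_big /=; apply: eq_bigr => j _.
have := sum_by_parts X j w (grad j w) w0.
move/eqP; rewrite -eqr_oppLR -sumrN => /eqP h.
transitivity (\sum_(y <- edom X j) grad j w y * grad j w y); first by apply: eq_bigr => y _; rewrite expr2.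
by rewrite -h; apply: eq_bigr => x _; rewrite /grad subrK; ring.
Qed.

Lemma coord_bound p (j : 'I_d) rho : 0 <= rho -> (sqnorm p)%:~R <= rho ^+ 2 -> `|(p ord0 j)%:~R| <= rho.
Proof.
move=> r0 h; rewrite -(ger0_norm r0) -!sqrtr_sqr ler_wsqrtr // (le_trans _ h) //.
by rewrite -rmorphXn /= ler_int sqnorm_ge.
Qed.

Lemma entries_lball : exists2 C : R, 0 < C & forall rho, 1 <= rho ->
  entries_tot (lball (rho ^+ 2)) <= C * (omega R d * rho ^+ d / rho).
Proof.
have [C C0 hC] := lball_shell; have [C' C'0 hC'] := lball_card.
exists (d%:R * (4 * C + 3 * (1 + C')) + 1).
  by rewrite ltr_wpDl // mulr_ge0 // addr_ge0 ?mulr_ge0 ?addr_ge0 // ltW.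
move=> rho rho1; have rho0 : 0 < rho by lra.
set N := omega R d * rho ^+ d; have N0 : 0 < N by rewrite mulr_gt0 ?omega_gt0 // exprn_gt0.
have Nr : 0 <= N / rho by rewrite divr_ge0 // ltW.
have en j : entries (lball (rho ^+ 2)) j <= (4 * C + 3 * (1 + C')) * (N / rho).
  (* Entry points lie in the shell of relative thickness [3 / rho], which must not exceed 1. For
     smaller [rho] all points are counted, as [N <= 3 * (N / rho)]. *)
  have [r3|r3] := leP 3 rho.
    apply: (@le_trans _ _ (#|` lshell rho (3 / rho)|%:R)).
      rewrite /entries sum_indic_card ler_nat; apply/fsubset_leq_card/fsubsetP => p.
      rewrite !inE /= !in_lball => /andP[hp]; rewrite -ltNge sqnorm_subev hp /= => hq.
      have := coord_bound p j rho (ltW rho0) hp; rewrite ler_norml => /andP[pj _].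
      have -> : rho ^+ 2 * (1 - 3 / rho) = rho ^+ 2 - 3 * rho by have := lt0r_neq0 rho0 => h; field.
      rewrite rmorphD rmorphB rmorphM /= in hq.
      by lra.
    have h := hC rho (3 / rho) rho1.
    apply: le_trans (h _) _; first by rewrite divr_ge0 ?(ltW rho0) //= ler_pdivrMr // mul1r.
    rewrite -/N.
    have : 0 <= 3 * (1 + C') * (N / rho) by rewrite mulr_ge0 // mulr_ge0 // addr_ge0 // ltW.
    have -> : C * N * (3 / rho + rho^-1) = 4 * C * (N / rho) by ring.
    lra.
  apply: (@le_trans _ _ (#|` lball (rho ^+ 2)|%:R)).
    rewrite -[leRHS]mulr1 -sumr_fset_const; apply: ler_sum => p _.
    by case: (_ \notin _); rewrite ?lexx ?ler01.
  have := hC' rho 1 rho1; rewrite sqrtr1 expr1n !mulr1 -/N => /(_ _).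
  rewrite ler01 lexx => /(_ isT); rewrite ler_norml => /andP[_ h].
  have : N <= 3 * (N / rho).
    by rewrite mulrA ler_pdivlMr // mulrC ler_pM2r //; apply: ltW.
  have : 0 <= C * (N / rho) by rewrite mulr_ge0 // ltW.
  have : 0 <= C' * (N / rho) by rewrite mulr_ge0 // ltW.
  lra.
apply: (@le_trans _ _ (\sum_(j < d) (4 * C + 3 * (1 + C')) * (N / rho))); first by apply: ler_sum.
by rewrite sumr_const card_ord -mulr_natl; lra.
Qed.

End LatticeBall.

Section Radius.
Context {R : realType}.

Lemma volume_radius d (V : R) : (0 < d)%N -> 0 < V -> exists2 r : R, 0 < r & omega R d * r ^+ d = V.
Proof.
move=> d0 V0; have w0 := @omega_gt0 R d; exists (powR (V / omega R d) d%:R^-1).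
  by rewrite powR_gt0 // divr_gt0.
rewrite -powR_mulrn ?powR_ge0 // -powRrM mulVf ?pnatr_eq0 -?lt0n // powRr1 ?divr_ge0 ?ltW //.
by rewrite mulrC divfK // lt0r_neq0.
Qed.

Lemma radius_le d (r rho c : R) : (0 < d)%N -> 0 <= r -> 0 <= rho -> 0 <= c ->
  omega R d * r ^+ d <= omega R d * rho ^+ d * (1 + c) -> r <= rho * (1 + c).
Proof.
move=> d0 r0 rho0 c0; rewrite -mulrA ler_pM2l ?omega_gt0 // => h.
rewrite -(@ler_pXn2r _ d) // ?nnegrE ?mulr_ge0 ?addr_ge0 //.
apply: le_trans h _; rewrite exprMn ler_wpM2l ?exprn_ge0 //.
by case: d d0 => // n _; rewrite exprS ler_peMr ?addr_ge0 // exprn_ege1 // lerDl.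
Qed.

End Radius.

(** * From the second moment to the symmetric difference *)

Section Bathtub.
Context {R : realType} {d : nat}.
Implicit Types (rho : R) (p q z : pt d).

(** Half of the summand is the torsion function of the ball: minus its lattice Laplacian is exactly
    [d], and extension by zero can only decrease it at points of the ball. So [torsion_bound] gives
    the moment, with no further counting. *)
Lemma lball_moment : (2 <= d)%N -> exists2 C : R, 0 < C & forall rho, 1 <= rho ->
  \sum_(p <- @lball R d (rho ^+ 2)) (rho ^+ 2 - (sqnorm p)%:~R) <=
  omega R d * rho ^+ d * rho ^+ 2 * (2 / d.+2%:R) + C * (omega R d * rho ^+ d * rho).
Proof.
move=> hd; have d0 : (0 < d)%N by exact: leq_trans hd.
have [C1 C10 hC1] := @lball_card R d; have [C2 C20 hC2] := @entries_lball R d.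
exists ((1 + C1) ^+ 3 + 9 * (1 + C1) ^+ 2 * C2).
  by rewrite addr_gt0 ?mulr_gt0 ?exprn_gt0 ?addr_gt0.
move=> rho rho1; have rho0 : 0 < rho by lra.
set N := omega R d * rho ^+ d; have N0 : 0 < N by rewrite mulr_gt0 ?omega_gt0 // exprn_gt0.
pose Y : {fset pt d} := lball (rho ^+ 2).
pose w (p : pt d) : R := if p \in Y then (rho ^+ 2 - (sqnorm p)%:~R) / 2 else 0.
have inY p : (p \in Y) = ((sqnorm p)%:~R <= rho ^+ 2) by exact: in_lball.
have wge p : 0 <= w p by rewrite /w inY; case: ifP => // h; rewrite divr_ge0 // subr_ge0.
have wlow p : (rho ^+ 2 - (sqnorm p)%:~R) / 2 <= w p.
  rewrite /w; case: ifPn => //; rewrite inY -ltNge => h; lra.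
have w0 p : p \notin Y -> w p = 0 by rewrite /w => /negPf ->.
have en : energy Y w <= d%:R * \sum_(p <- Y) w p.
  rewrite energy_laplace // mulr_sumr; apply: ler_sum_fset => p pY; rewrite mulrC ler_wpM2r //.
  apply: (@le_trans _ _ (\sum_(j < d) 1)); last by rewrite sumr_const card_ord.
  apply: ler_sum => j _.
  have e1 : w p = (rho ^+ 2 - (sqnorm p)%:~R) / 2 by rewrite /w pY.
  have := wlow (p + ev j); have := wlow (p - ev j).
  rewrite sqnorm_addev sqnorm_subev e1 !rmorphD rmorphN !rmorphM /=; lra.
have Y0 : Y != fset0.
  apply/fset0Pn; exists 0; rewrite inY /sqnorm big1 ?sqr_ge0 // => j _.
  by rewrite mxE expr0n.
have NB0 : 0 < #|` Y|%:R :> R by rewrite ltr0n cardfs_gt0.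
have [r r0 vol] := volume_radius d _ d0 NB0.
have tb := torsion_bound Y w r hd r0 Y0 vol w0 wge.
have eS : \sum_(p <- Y) (rho ^+ 2 - (sqnorm p)%:~R) = 2 * \sum_(p <- Y) w p.
  by rewrite mulr_sumr; apply: eq_sum_fset => p pY; rewrite /w pY; field.
rewrite -/Y eS; set S := \sum_(p <- Y) w p in en tb *.
have b0 := @entries_tot_ge0 R d Y; have hb := hC2 rho rho1; rewrite -/N -/Y in hb.
set b : R := entries_tot Y in tb b0 hb.
have hS : d%:R * S <= r ^+ 2 * (#|` Y|%:R * cdim d + 9 * b) by lra.
have iv0 : 0 <= rho^-1 by rewrite invr_ge0 ltW.
have iv1 : rho^-1 <= 1 by rewrite invf_le1.
set c := C1 / rho; have c0 : 0 <= c by rewrite divr_ge0 // ltW.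
have hN : #|` Y|%:R <= N * (1 + c).
  have := hC1 rho 1 rho1; rewrite sqrtr1 expr1n !mulr1 -/N -/Y ler01 lexx => /(_ isT).
  by rewrite ler_norml => /andP[_]; rewrite /c; lra.
have hr : r <= rho * (1 + c) by apply: (radius_le d) => //; rewrite ?vol // ltW.
have cC : c <= C1 by rewrite /c ler_piMr // ltW.
have hr2 : r ^+ 2 <= rho ^+ 2 * (1 + c) ^+ 2.
  by rewrite -exprMn lerXn2r ?nnegrE ?mulr_ge0 ?addr_ge0 ?(ltW r0) ?(ltW rho0).
have i1 : r ^+ 2 * #|` Y|%:R <= N * rho ^+ 2 + (1 + C1) ^+ 3 * (N * rho).
  apply: (@le_trans _ _ (rho ^+ 2 * (1 + c) ^+ 2 * (N * (1 + c)))).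
    by apply: ler_pM => //; exact: sqr_ge0.
  have -> : rho ^+ 2 * (1 + c) ^+ 2 * (N * (1 + c)) = N * rho ^+ 2 + N * rho * (rho * c) * (3 + 3 * c + c ^+ 2) by ring.
  have -> : rho * c = C1 by rewrite /c mulrC divfK // lt0r_neq0.
  rewrite lerD2l -mulrA [leRHS]mulrC; apply: ler_wpM2l; first by rewrite mulr_ge0 // ltW.
  have : C1 * (c ^+ 2) <= C1 * (C1 ^+ 2) by rewrite ler_pM2l // lerXn2r ?nnegrE // ltW.
  have : C1 * c <= C1 * C1 by rewrite ler_pM2l.
  lra.
have i2 : r ^+ 2 * b <= (1 + C1) ^+ 2 * C2 * (N * rho).
  apply: (@le_trans _ _ (rho ^+ 2 * (1 + C1) ^+ 2 * (C2 * (N / rho)))).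
    apply: ler_pM => //; first exact: sqr_ge0.
    apply: le_trans hr2 _; rewrite ler_wpM2l ?sqr_ge0 // lerXn2r ?nnegrE ?addr_ge0 ?(ltW C10) //.
    by rewrite lerD2l.
  rewrite le_eqVlt; apply/orP; left; apply/eqP; have := lt0r_neq0 rho0 => h; field.
  exact: h.
have dp : 0 < d%:R :> R by rewrite ltr0n.
have dn := lt0r_neq0 dp; have d2n : (d.+2%:R : R) != 0 by [].
have e2 : 2 * S = (2 / d%:R) * (d%:R * S) by field.
rewrite e2; apply: le_trans (ler_wpM2l (divr_ge0 (ler0n R 2) (ltW dp)) hS) _.
have -> : 2 / d%:R * (r ^+ 2 * (#|` Y|%:R * cdim d + 9 * b)) =
  (2 / d.+2%:R) * (r ^+ 2 * #|` Y|%:R) + (2 / d%:R) * (9 * (r ^+ 2 * b)).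
  by rewrite /cdim; move: (d.+2%:R : R) d2n => D D0; field; rewrite D0 dn.
have k1 : 2 / d.+2%:R <= 1 :> R by rewrite ler_pdivrMr // mul1r ler_nat.
have k2 : 2 / d%:R <= 1 :> R by rewrite ler_pdivrMr // mul1r ler_nat.
have k3 : 0 <= 2 / d.+2%:R :> R by rewrite divr_ge0.
have i3 := ler_wpM2l k3 i1.
have i4 : 2 / d.+2%:R * ((1 + C1) ^+ 3 * (N * rho)) <= (1 + C1) ^+ 3 * (N * rho).
  by rewrite ler_piMl // mulr_ge0 ?exprn_ge0 ?addr_ge0 ?(ltW C10) // mulr_ge0 // ltW.
have i5 : 2 / d%:R * (9 * (r ^+ 2 * b)) <= 9 * (r ^+ 2 * b).
  by rewrite ler_piMl // mulr_ge0 // mulr_ge0 // sqr_ge0.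
rewrite mulrDr in i3; move: i2 i3 i4 i5.
move: (2 / d.+2%:R : R) (2 / d%:R * (9 * (r ^+ 2 * b))) ((1 + C1) ^+ 3) ((1 + C1) ^+ 2) => k l A B.
lra.
Qed.

Lemma dist2_sqnorm p z : dist2 d p z = sqnorm (p - z).
Proof. by rewrite dist2C dist2_sub. Qed.

(** A coordinate beyond [rho] already contributes [rho^2] after clipping, so the clipped moment
    dominates the moment truncated at the sphere. *)
Lemma clip_sqnorm rho p z : 0 <= rho ->
  (if (sqnorm (p - z))%:~R <= rho ^+ 2 then (sqnorm (p - z))%:~R else rho ^+ 2)
  <= \sum_i clip rho (p ord0 i - z ord0 i)%:~R ^+ 2.
Proof.
move=> r0; pose q := p - z; rewrite -/q.
have -> : \sum_i clip rho (p ord0 i - z ord0 i)%:~R ^+ 2 = \sum_i clip rho (q ord0 i)%:~R ^+ 2.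
  by apply: eq_bigr => i _; rewrite /q !mxE.
have [/existsP[i hi]|/existsPn nout] := boolP [exists i, rho < `|(q ord0 i)%:~R|].
  have : rho ^+ 2 <= \sum_i clip rho (q ord0 i)%:~R ^+ 2.
    rewrite (bigD1 i) //= clip_out // lerDl; apply: sumr_ge0 => j _; exact: sqr_ge0.
  by apply: le_trans; case: ifP.
have -> : \sum_i clip rho (q ord0 i)%:~R ^+ 2 = (sqnorm q)%:~R.
  rewrite /sqnorm rmorph_sum /=; apply: eq_bigr => i _; rewrite clip_id ?rmorphXn //.
  by rewrite leNgt; exact: nout.
by case: ifPn => // h; rewrite ltW // ltNge.
Qed.

(** The weight [rho^2 - |p - z|^2] is nonnegative exactly on the ball. The moment hypothesis says
    that [X] misses at most a multiple of [N * rho^2 * eps] of its total, and what is missed sits on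
    the points of the ball outside [X]. *)
Lemma bathtub (K : R) : (2 <= d)%N -> 0 <= K -> exists2 C : R, 0 < C &
  forall (X : {fset pt d}) rho eps z, 1 <= rho -> omega R d * rho ^+ d = #|` X|%:R ->
  0 < eps <= 1 -> 1 <= rho * eps ->
  \sum_(x <- X) \sum_i clip rho (x ord0 i - z ord0 i)%:~R ^+ 2
    <= #|` X|%:R * rho ^+ 2 * cdim d + K * (#|` X|%:R * rho ^+ 2 * eps) ->
  (card_symdiff d X [set p | (dist2 d p z)%:~R <= rho ^+ 2])%:R <= C * (#|` X|%:R * Num.sqrt eps).
Proof.
move=> hd K0; have [Cm Cm0 hm] := lball_moment hd.
have [Cs Cs0 hs] := @lball_shell R d; have [Cc Cc0 hc] := @lball_card R d.
exists (2 * (2 * Cs + (K + Cm)) + Cc); first by rewrite addr_gt0 // mulr_gt0 // addr_gt0 ?mulr_gt0 // ltr_wpDl.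
move=> X rho eps z rho1 vol /andP[e0 e1] re hX.
have rho0 : 0 < rho by lra.
set N : R := #|` X|%:R in vol hX *.
have N0 : 0 < N by rewrite -vol mulr_gt0 ?omega_gt0 // exprn_gt0.
pose f p : R := rho ^+ 2 - (sqnorm (p - z))%:~R.
pose inB p := ((sqnorm (p - z))%:~R <= rho ^+ 2 :> R).
pose B := [fset (p + z)%R | p in lball (rho ^+ 2)]%fset.
have inBE p : (p \in B) = inB p.
  apply/imfsetP/idP => [[q /= hq ->]|h]; first by rewrite /inB addrK -in_lball.
  by exists (p - z); rewrite ?subrK //= in_lball.
have sumB (F : pt d -> R) : \sum_(p <- B) F p = \sum_(q <- lball (rho ^+ 2)) F (q + z).
  by rewrite big_imfset //= => p q _ _ /addIr.
pose D1 := [fset p in X | ~~ inB p]%fset; pose D2 := [fset p in B | p \notin X]%fset.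
pose XB := [fset p in X | inB p]%fset.
have fXB : rho ^+ 2 * N * (1 - cdim d) - K * (N * rho ^+ 2 * eps) <= \sum_(p <- XB) f p.
  have : \sum_(p <- X) (rho ^+ 2 - \sum_i clip rho (p ord0 i - z ord0 i)%:~R ^+ 2) <= \sum_(p <- XB) f p.
    rewrite -big_fset_condE /= [leRHS]big_mkcond /=; apply: ler_sum_fset => p _.
    by have := clip_sqnorm rho p z (ltW rho0); rewrite /inB /f; case: ifP => _; lra.
  by rewrite sumrB sumr_fset_const -/N; lra.
have BX : \sum_(p <- B) f p = \sum_(p <- XB) f p + \sum_(p <- D2) f p.
  rewrite (big_fsetID _ (mem X)) /=; congr (_ + _).
  by congr (\sum_(p <- enum_fset _) _); apply/fsetP => p; rewrite !inE /= inBE andbC.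
have cdimE : 1 - cdim d = 2 / d.+2%:R :> R.
  rewrite /cdim; have h : (d.+2%:R : R) != 0 by [].
  by apply: (mulIf h); rewrite mulrBl !divfK // -[d.+2]addn2 natrD; ring.
have fD2 : \sum_(p <- D2) f p <= (K + Cm) * (N * rho ^+ 2 * eps).
  have : \sum_(p <- B) f p <= N * rho ^+ 2 * (2 / d.+2%:R) + Cm * (N * rho).
    rewrite sumB /f; under eq_bigr do rewrite addrK.
    by have := hm rho rho1; rewrite vol.
  have : Cm * (N * rho) <= Cm * (N * rho ^+ 2 * eps).
    rewrite ler_pM2l // -mulrA ler_pM2l // expr2 -mulrA ler_peMr //; exact: ltW.
  rewrite cdimE in fXB; rewrite BX; move: fXB.
  by move: (2 / d.+2%:R : R) (\sum_(p <- XB) f p) (\sum_(p <- D2) f p) => k u v; lra.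
(* This shell thickness balances the shell count [N * t] against the Markov bound [N * eps / t] for
   the points inside it. *)
set t := Num.sqrt eps.
have t0 : 0 < t by rewrite sqrtr_gt0.
have t2 : t ^+ 2 = eps by rewrite sqr_sqrtr // ltW.
have t1 : t <= 1 by rewrite -[1]sqrtr1 ler_wsqrtr.
have et : eps <= t by rewrite -t2 expr2 ler_piMr // ltW.
have ie : rho^-1 <= eps by rewrite -[rho^-1]mul1r ler_pdivrMr // mulrC.
have D2card : #|` D2|%:R <= (2 * Cs + (K + Cm)) * (N * t).
  have p1 p : p \in D2 -> 1 <= (p - z \in lshell rho t)%:R + f p / (t * rho ^+ 2).
    rewrite !inE inBE => /andP[pB _].
    have tr : 0 < t * rho ^+ 2 by rewrite mulr_gt0 // exprn_gt0.
    have f0 : 0 <= f p by rewrite subr_ge0.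
    rewrite in_lball; move: (pB); rewrite {1}/inB => -> /=; case: ltP => h.
      by rewrite lerDl divr_ge0 // ltW.
    by rewrite add0r ler_pdivlMr // mul1r /f; lra.
  rewrite -[leLHS]mulr1 -sumr_fset_const; apply: le_trans (ler_sum_fset _ _ _ p1) _.
  rewrite big_split /= -mulr_suml mulrDl; apply: lerD.
    apply: (@le_trans _ _ (#|` lshell rho t|%:R)).
      rewrite sum_indic_card ler_nat; apply: (card_le_inj _ _ _ (fun p => p - z)).
        by move=> p q _ _ /addIr.
      by move=> p; rewrite inE /= => /andP[].
    have h := hs rho t rho1; apply: le_trans (h _) _; first by rewrite (ltW t0).
    rewrite vol -!mulrA [2 * _]mulrCA ler_pM2l // mulrCA ler_pM2l //; lra.
  rewrite ler_pdivrMr ?mulr_gt0 ?exprn_gt0 //; apply: le_trans fD2 _.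
  by rewrite -t2 le_eqVlt; apply/orP; left; apply/eqP; ring.
(* [X] and the ball have the same number of points up to the counting error [N / rho]. *)
have D1card : #|` D1|%:R <= Cc * (N * t) + #|` D2|%:R.
  have cX : N = #|` XB|%:R + #|` D1|%:R.
    rewrite -!sum_indic_card -big_split /= -[N]mulr1 -sumr_fset_const; apply: eq_bigr => p _.
    by case: (inB p); rewrite ?addr0 ?add0r.
  have cB : #|` B|%:R = #|` XB|%:R + #|` D2|%:R :> R.
    rewrite -natrD; congr (_%:R); rewrite -(cardfsID X B); congr (_ + _)%N.
      by congr (size (enum_fset _)); apply/fsetP => p; rewrite !inE /= inBE andbC.
    by congr (size (enum_fset _)); apply/fsetP => p; rewrite !inE /= andbC.
  have lB : #|` B|%:R = #|` @lball R d (rho ^+ 2)|%:R :> R.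
    by have := sumB (fun=> 1); rewrite /= !sumr_fset_const !mulr1.
  have := hc rho 1 rho1; rewrite sqrtr1 expr1n !mulr1 ler01 lexx vol => /(_ isT).
  rewrite ler_norml => /andP[h _].
  have : Cc * (N / rho) <= Cc * (N * t) by rewrite ler_pM2l // ler_pM2l // (le_trans ie).
  rewrite -lB in h; lra.
have fin : finite_set [set p | (p \in X) != `[< (dist2 d p z)%:~R <= rho ^+ 2 >]].
  apply: (@sub_finite_set _ _ [set` (D1 `|` D2)%fset]) => // p /=.
  have -> : `[< (dist2 d p z)%:~R <= rho ^+ 2 >] = inB p by rewrite dist2_sqnorm; exact/asboolP/idP.
  by rewrite !inE /= inBE; case: (p \in X); case: (inB p).
have sub : (card_symdiff d X [set p | ((dist2 d p z)%:~R <= rho ^+ 2)%R] <= #|` (D1 `|` D2)%fset|)%N.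
  apply/fsubset_leq_card/fsubsetP => p; rewrite in_fset_set // inE /=.
  have -> : `[< (dist2 d p z)%:~R <= rho ^+ 2 >] = inB p by rewrite dist2_sqnorm; exact/asboolP/idP.
  by rewrite !inE /= inBE; case: (p \in X); case: (inB p).
have : (card_symdiff d X [set p | (dist2 d p z)%:~R <= rho ^+ 2])%:R <= #|` D1|%:R + #|` D2|%:R :> R.
  by rewrite -natrD ler_nat (leq_trans sub) // cardfsU leq_subr.
lra.
Qed.

End Bathtub.

(** * The radial eigenfunction *)

Section Bessel.
Context {R : realType}.
Implicit Types (n k : nat) (x : R).

(** The Laplacian of [r^(2k+2)] on [R^n] is [2 (k+1) (n+2k) r^(2k)]. With these denominators
    [bessel n (r^2)] is the radial solution of [- Laplacian phi = phi] with [phi(0) = 1], a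
    normalised Bessel function of order [n/2 - 1]. *)
Definition bden n k : R := \prod_(j < k) (2 * j.+1%:R * (n + 2 * j)%:R).

Definition bcoef n k : R := (-1) ^+ k / bden n k.

Lemma bden_fact n k : (0 < n)%N -> k`!%:R <= bden n k.
Proof.
move=> n0; elim: k => [|k IH]; first by rewrite /bden big_ord0 fact0.
rewrite /bden big_ord_recr /= -/(bden n k) factS mulnC natrM; apply: ler_pM => //.
by rewrite -mulrA mulrC -mulrA ler_peMr // -natrM ler1n muln_gt0 addn_gt0 n0.
Qed.

Lemma bden_gt0 n k : (0 < n)%N -> 0 < bden n k.
Proof. by move=> n0; apply: lt_le_trans (bden_fact n k n0); rewrite ltr0n fact_gt0. Qed.

Lemma bdenS n k : bden n k.+1 = 2 * n%:R * k.+1%:R * bden n.+2 k.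
Proof.
elim: k => [|k IH]; first by rewrite /bden big_ord_recr !big_ord0 /= muln0 addn0; ring.
rewrite /bden big_ord_recr /= -/(bden n k.+1) IH [in RHS]big_ord_recr /= -/(bden n.+2 k).
have -> : (n + 2 * k.+1 = n.+2 + 2 * k)%N by lia.
ring.
Qed.

Lemma bden_shift n k : n%:R * bden n.+2 k = (n + 2 * k)%:R * bden n k.
Proof.
elim: k => [|k IH]; first by rewrite /bden !big_ord0 muln0 addn0.
rewrite /bden !big_ord_recr /= -/(bden n.+2 k) -/(bden n k) mulrA IH.
have -> : (n + 2 * k.+1 = n.+2 + 2 * k)%N by lia.
ring.
Qed.

Lemma bcoef_diffs n : (0 < n)%N -> pseries_diffs (bcoef n) = (fun k => - (2 * n%:R)^-1 * bcoef n.+2 k).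
Proof.
move=> n0; apply/funext => k; rewrite /pseries_diffs /bcoef bdenS exprS.
have b0 := lt0r_neq0 (bden_gt0 n.+2 k isT).
have k0 : (k.+1%:R : R) != 0 by []. have nn : (n%:R : R) != 0 by rewrite pnatr_eq0 -lt0n.
move: (k.+1%:R : R) (n%:R : R) (bden n.+2 k) b0 k0 nn => a b c c0 a0 bn.
by field; rewrite c0 a0 bn.
Qed.

Lemma bcoef_rec n k : (0 < n)%N ->
  bcoef n k.+1 = bcoef n.+2 k.+1 - bcoef n.+4 k / (n%:R * n.+2%:R).
Proof.
move=> n0; rewrite /bcoef !bdenS exprS.
have b0 := lt0r_neq0 (bden_gt0 n.+4 k isT). have b2 := lt0r_neq0 (bden_gt0 n.+2 k isT).
have k0 : (k.+1%:R : R) != 0 by []. have nn : (n%:R : R) != 0 by rewrite pnatr_eq0 -lt0n.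
have n2 : (n.+2%:R : R) != 0 by [].
have e : bden n.+2 k = n.+2%:R * bden n.+4 k / (n.+2 + 2 * k)%:R.
  by rewrite bden_shift mulrC mulrA mulVf ?mul1r // pnatr_eq0 addn_eq0.
have c0 : ((n.+2 + 2 * k)%:R : R) != 0 by rewrite pnatr_eq0 addn_eq0.
have e2 : ((n.+2 + 2 * k)%:R : R) = n%:R + 2 * k.+1%:R by rewrite -natrM -natrD; congr (_%:R); lia.
rewrite e; rewrite e2 in c0 *; move: (bden n.+4 k) (k.+1%:R : R) (n%:R : R) (n.+2%:R : R) b0 k0 nn n2 c0 => b c a a2 *.
by field; apply/and5P; split.
Qed.

Lemma is_cvg_bessel n x : (0 < n)%N -> cvgn (pseries (bcoef n) x).
Proof.
move=> n0; apply: normed_cvg.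
apply: (series_le_cvg _ _ _ (is_cvg_series_exp_coeff `|x|)) => k /=.
- exact: normr_ge0.
- by rewrite /exp_coeff /= divr_ge0 ?exprn_ge0.
rewrite /exp_coeff /= normrM normrX mulrC ler_wpM2l ?exprn_ge0 // normrM normrX normrN1 expr1n mul1r normfV.
by rewrite (gtr0_norm (bden_gt0 _ _ n0)) lef_pV2 ?posrE ?bden_gt0 ?ltr0n ?fact_gt0 // bden_fact.
Qed.

Definition bessel n x : R := limn (pseries (bcoef n) x).

Lemma is_cvg_pseriesZ (c : R) n x : (0 < n)%N -> cvgn (pseries (fun k => c * bcoef n k) x) /\
  limn (pseries (fun k => c * bcoef n k) x) = c * bessel n x.
Proof.
move=> n0; have e : pseries (fun k => c * bcoef n k) x = (fun m => c * pseries (bcoef n) x m).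
  by apply/funext => m; rewrite /pseries /series /= mulr_sumr; apply: eq_bigr => k _; rewrite mulrA.
rewrite e; have h := is_cvg_bessel n x n0.
have : (fun m => c * pseries (bcoef n) x m) @ \oo --> c * bessel n x by apply: cvgMr.
by move=> h2; split; [apply/cvg_ex; eexists; exact: h2 | exact: cvg_lim h2].
Qed.

Lemma is_derive_bessel n x : (0 < n)%N -> is_derive x (1:R) (bessel n) (- (2 * n%:R)^-1 * bessel n.+2 x).
Proof.
move=> n0; have c1 y := is_cvg_pseriesZ (- (2 * n%:R)^-1) n.+2 y isT.
have -> : bessel n = (fun y => limn (pseries (bcoef n) y)) by [].
apply: is_derive_congr.
  apply: (@pseries_snd_diffs R (bcoef n) (`|x| + 1) x).
  - exact: is_cvg_bessel.
  - by rewrite bcoef_diffs //; case: (c1 (`|x| + 1)).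
  - rewrite bcoef_diffs //; set c := - _.
    have -> : pseries_diffs (fun k => c * bcoef n.+2 k) = fun k => (c * - (2 * n.+2%:R)^-1) * bcoef n.+4 k.
      apply/funext => k; rewrite -mulrA -[RHS]/(c * (fun k => - (2 * n.+2%:R)^-1 * bcoef n.+4 k) k).
      by rewrite -bcoef_diffs // /pseries_diffs mulrCA.
    by have [] := is_cvg_pseriesZ (c * - (2 * n.+2%:R)^-1) n.+4 (`|x| + 1) isT.
  - by rewrite [ltRHS]ger0_norm ?addr_ge0 // ltrDl.
by rewrite bcoef_diffs //; case: (c1 x).
Qed.

Lemma bessel0 n : (0 < n)%N -> bessel n 0 = 1.
Proof.
move=> n0; apply: cvg_lim => //; apply: cvg_near_cst; exists 1%N => // -[//|m] _ /=.
rewrite /pseries /series /= big_mkord big_ord_recl /= expr0 mulr1 /bcoef /bden big_ord0 expr0 divr1.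
by rewrite big1 ?addr0 // => k _; rewrite expr0n mulr0.
Qed.

(** The radial equation in the squared radius, [4 x f'' + 2 n f' + f = 0], once both derivatives are
    written by raising the dimension. *)
Lemma bessel_rec n x : (0 < n)%N ->
  bessel n x = bessel n.+2 x - x * bessel n.+4 x / (n%:R * n.+2%:R).
Proof.
move=> n0; apply: cvg_lim => //.
rewrite -cvg_shiftS /=.
have -> : (fun m => pseries (bcoef n) x m.+1) = (fun m => pseries (bcoef n.+2) x m.+1 -
   x * pseries (bcoef n.+4) x m / (n%:R * n.+2%:R)).
  apply/funext => m; rewrite /pseries /series /= !big_mkord.
  pose S l k := \sum_(i < k) bcoef l i * x ^+ i.
  have Ss l k : S l k.+1 = S l k + bcoef l k * x ^+ k by rewrite /S big_ord_recr.
  rewrite -/(S n m.+1) -/(S n.+2 m.+1) -/(S n.+4 m).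
  elim: m => [|m IH]; first by rewrite !Ss /S !big_ord0 /bcoef /bden !big_ord0; ring.
  rewrite (Ss n m.+1) IH (Ss n.+2 m.+1) (Ss n.+4 m) bcoef_rec // [x ^+ m.+1]exprS; ring.
apply: cvgB; first by rewrite (cvg_shiftS (pseries (bcoef n.+2) x)); exact: is_cvg_bessel.
apply: cvgMl; apply: cvgMr; exact: is_cvg_bessel.
Qed.

(** The derivative of [s^n * bessel n.+2 (s^2)] is [n * s^(n-1) * bessel n (s^2)]: flux through a
    sphere equals mass inside. Positivity therefore passes on, and now includes the endpoint. *)
Lemma bessel_pos_shift n (X : R) : (0 < n)%N -> (forall x, 0 <= x < X -> 0 < bessel n x) ->
  forall x, 0 <= x <= X -> 0 < bessel n.+2 x.
Proof.
move=> n0 pos x /andP[x0 xX].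
have [->|xn0] := eqVneq x 0; first by rewrite bessel0.
have xp : 0 < x by rewrite lt_neqAle eq_sym xn0.
pose r := Num.sqrt x; have r0 : 0 < r by rewrite sqrtr_gt0.
have r2 : r ^+ 2 = x by rewrite sqr_sqrtr.
have nn : (n%:R : R) != 0 by rewrite pnatr_eq0 -lt0n.
have n2n : (n.+2%:R : R) != 0 by [].
have der s : is_derive s (1:R) (fun s => s ^+ n * bessel n.+2 (s ^+ 2)) (n%:R * s ^+ n.-1 * bessel n (s ^+ 2)).
  have dn : is_derive s (1:R) (fun s => s ^+ n) (n%:R * s ^+ n.-1 * 1).
    by rewrite -(prednK n0); exact: (is_derive_exp id _ _ _ (is_derive_id s 1)).
  have d2 : is_derive s (1:R) (fun s => s ^+ 2) (2%:R * s ^+ 1 * 1).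
    exact: (is_derive_exp id _ _ _ (is_derive_id s 1)).
  apply: is_derive_congr.
    exact: (is_derive_mul _ _ _ _ _ dn (is_derive_chain _ _ _ _ _ d2 (is_derive_bessel n.+2 _ isT))).
  have es : s ^+ n = s * s ^+ n.-1 by rewrite -exprS prednK.
  rewrite (bessel_rec n) // es expr1.
  move: (n.+2%:R : R) n2n => a a0; by field; rewrite a0 nn.
have [c /andP[c0 cr] e] := mean_value _ _ _ _ r0 (fun s _ => der s).
have : 0 < r ^+ n * bessel n.+2 (r ^+ 2).
  rewrite expr0n (gtn_eqF n0) mul0r subr0 in e; rewrite e subr0.
  rewrite mulr_gt0 // mulr_gt0 //; first by rewrite mulr_gt0 ?ltr0n // exprn_gt0.
  apply: pos; rewrite sqr_ge0 /=; apply: lt_le_trans xX; rewrite -r2.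
  by rewrite ltr_pXn2r // nnegrE ltW // (lt_trans c0).
by rewrite r2 pmulr_rgt0 // exprn_gt0.
Qed.

(** If [bessel n] stayed positive, the quotient [q] by [bessel n.+2] would stay in [(0, 1]]; but its
    Riccati equation makes it decrease at a fixed rate for large [x]. *)
Lemma bessel_neg_exists n : (0 < n)%N -> exists2 x : R, 0 <= x & bessel n x <= 0.
Proof.
move=> n0; apply: contrapT => nex.
have pos x : 0 <= x -> 0 < bessel n x.
  by move=> x0; rewrite ltNge; apply/negP => h; apply: nex; exists x.
have pos2 x : 0 <= x -> 0 < bessel n.+2 x.
  by move=> x0; apply: (bessel_pos_shift n x n0) => [y /andP[y0 _]|]; [exact: pos | rewrite x0 lexx].
have pos4 x : 0 <= x -> 0 < bessel n.+4 x.
  by move=> x0; apply: (bessel_pos_shift n.+2 x) => // [y /andP[y0 _]|]; [exact: pos2 | rewrite x0 lexx].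
have nn : (n%:R : R) != 0 by rewrite pnatr_eq0 -lt0n.
have np : 0 < n%:R :> R by rewrite ltr0n.
have n2n : (n.+2%:R : R) != 0 by [].
pose q x := bessel n x / bessel n.+2 x.
have q0 x : 0 <= x -> 0 < q x by move=> x0; rewrite divr_gt0 ?pos ?pos2.
have q1 x : 0 <= x -> q x <= 1.
  move=> x0; rewrite ler_pdivrMr ?pos2 // mul1r (bessel_rec n) // gerBl.
  by rewrite divr_ge0 ?mulr_ge0 // ltW // pos4.
(* Beyond [x0] the coefficient [n / (2 x)] is at most [1 / n]; with [q (1 - q) <= 1/4] the slope is
   at most [- 1 / (4 n)], so [q] loses 1 over a length [4 n]. *)
pose x0 : R := n%:R ^+ 2 / 2 + 1.
have x00 : 0 < x0 by rewrite ltr_wpDl // divr_ge0 // sqr_ge0.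
have der x : x0 <= x <= x0 + 4 * n%:R ->
  is_derive x (1:R) q (- (2 * n%:R)^-1 + n%:R / (2 * x) * (q x * (1 - q x))).
  move=> /andP[hx _]; have xp : 0 < x by apply: lt_le_trans hx.
  have b2 := lt0r_neq0 (pos2 x (ltW xp)).
  apply: is_derive_congr.
    apply: is_derive_mul; first exact: is_derive_bessel.
    by apply: is_derive_inv => //; exact: is_derive_bessel.
  have rec : bessel n.+4 x = (bessel n.+2 x - bessel n x) * (n%:R * n.+2%:R) / x.
    rewrite (bessel_rec n) //; have := lt0r_neq0 xp; move: (n.+2%:R : R) n2n => a a0 xn0.
    by field; rewrite xn0 a0 nn.
  rewrite /q rec; have := lt0r_neq0 xp.
  move: (n.+2%:R : R) (n%:R : R) n2n nn (bessel n.+2 x) (bessel n x) b2 => a b a0 b0 u v u0 xn0.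
  by field; rewrite xn0 u0 a0 b0.
have lt : x0 < x0 + 4 * n%:R by rewrite ltrDl mulr_gt0.
have [c /andP[c1 c2] e] := mean_value _ _ _ _ lt der.
have cp : 0 < c by exact: lt_trans c1.
have dle : - (2 * n%:R)^-1 + n%:R / (2 * c) * (q c * (1 - q c)) <= - (4 * n%:R)^-1.
  have h1 : q c * (1 - q c) <= 4^-1 by have := sqr_ge0 (q c - 2^-1); lra.
  have h2 : n%:R / (2 * c) <= n%:R^-1.
    rewrite ler_pdivrMr ?mulr_gt0 // mulrC ler_pdivlMr //.
    have : x0 <= c by exact: ltW.
    by rewrite /x0 -expr2; lra.
  have h3 : n%:R / (2 * c) * (q c * (1 - q c)) <= n%:R^-1 * 4^-1.
    apply: ler_pM => //; first by rewrite divr_ge0 // mulr_ge0 // ltW.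
    by rewrite mulr_ge0 ?(ltW (q0 _ (ltW cp))) // subr_ge0 q1 // ltW.
  by rewrite !invfM; lra.
have : q (x0 + 4 * n%:R) - q x0 <= -1.
  rewrite e; have -> : x0 + 4 * n%:R - x0 = 4 * n%:R by ring.
  apply: le_trans (ler_wpM2r _ dle) _; first by rewrite mulr_ge0.
  by rewrite mulNr mulVf // mulf_neq0.
have := q1 x0 (ltW x00); have := q0 (x0 + 4 * n%:R) (ltW (lt_trans x00 lt)).
lra.
Qed.

Lemma bessel_first_zero n : (0 < n)%N ->
  exists xs : R, [/\ 0 < xs, bessel n xs = 0 & forall x, 0 <= x < xs -> 0 < bessel n x].
Proof.
move=> n0; pose S := [set x : R | 0 <= x /\ bessel n x <= 0].
have lb : has_lbound S by exists 0 => x [].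
have hS : has_inf S by split => //; have [x x0 hx] := bessel_neg_exists n n0; exists x.
pose xs := inf S.
have xs0 : 0 <= xs by apply: lb_le_inf; [case: hS | move=> x []].
have pos x : 0 <= x < xs -> 0 < bessel n x.
  move=> /andP[x0 xxs]; rewrite ltNge; apply/negP => h.
  by have := ge_inf lb (conj x0 h : S x); rewrite leNgt xxs.
have cont x : {for x, continuous (bessel n)} by exact: is_derive_continuous (is_derive_bessel n x n0).
have le0 : bessel n xs <= 0.
  rewrite leNgt; apply/negP => h.
  have : \forall y \near xs, 0 < bessel n y by exact: (cvgr_gt (bessel n xs) (cont xs)).
  move=> /nbhs_ballP[e /= e0 he].
  have [s sS sx] := inf_adherent e0 hS.
  have xss : xs <= s by exact: ge_inf.
  have : 0 < bessel n s.
    by apply: he; rewrite /ball /= ltr_norml; apply/andP; split; lra.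
  by case: sS => _; rewrite leNgt => /negbTE ->.
have xsp : 0 < xs.
  rewrite lt_neqAle xs0 andbT; apply/eqP => e; move: le0.
  by rewrite -e bessel0 // ler10.
exists xs; split => //; apply/eqP; rewrite eq_le le0 /=.
rewrite leNgt; apply/negP => neg.
have [||c /andP[c0 cx] ec] := intermediate_value (fun y => - bessel n y) (fun y => - (- (2 * n%:R)^-1 * bessel n.+2 y)) 0 xs 0 xs0.
- by move=> y _; apply/is_derive_opp/is_derive_bessel.
- by rewrite bessel0 //; apply/andP; split; lra.
have bc : bessel n c = 0 by lra.
have [e|cn] := eqVneq c xs; first by rewrite e in bc; lra.
have := pos c; rewrite c0 lt_neqAle cn cx bc ltxx => /(_ isT).
by [].
Qed.

Lemma bessel_bounded n (X : R) : (0 < n)%N -> 0 <= X ->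
  exists2 M : R, 0 < M & forall x, 0 <= x <= X -> `|bessel n x| <= M.
Proof.
move=> n0 X0.
have cont (g : R -> R) (dg : R -> R) : (forall x, is_derive x (1:R) g (dg x)) -> {within `[0, X], continuous g}.
  by move=> h; apply: (is_derive_within_continuous g dg) => x _.
have [c1 _ h1] := EVT_max X0 (cont _ _ (fun x => is_derive_bessel n x n0)).
have [c2 _ h2] := EVT_max X0 (cont _ _ (fun x => is_derive_opp _ _ _ (is_derive_bessel n x n0))).
exists (`|bessel n c1| + `|bessel n c2| + 1); first by rewrite ltr_wpDl ?addr_ge0.
move=> x hx; have := h1 x; have := h2 x; rewrite in_itv /= hx => /(_ isT) i2 /(_ isT) i1.
rewrite ler_norml; have := ler_norm (bessel n c1); have := ler_norm (- bessel n c2); rewrite normrN.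
have := normr_ge0 (bessel n c1); have := normr_ge0 (bessel n c2) => *.
by apply/andP; split; lra.
Qed.

End Bessel.

(** * The Riccati equation of the radial eigenfunction *)

Section Riccati.
Context {R : realType}.
Variables (d : nat) (xs lam : R).
Hypothesis d0 : (0 < d)%N.
Hypothesis bpos : forall x : R, 0 <= x < xs -> 0 < bessel d x.
Hypothesis lam0 : 0 < lam.
Implicit Types (r p : R).

Let w : R := omega R d.

Let w0 : 0 < w. Proof. exact: omega_gt0. Qed.

(* For the radial eigenfunction [phi] on the unit ball, [rvol], [rtors] and [rnu] are, at radius [r],
   the volume, the normalised torsion, and the excess of the logarithmic derivative of the mass
   [int_(B_r) (phi - phi(r))] with respect to the torsion over [lam / volume]. *)
Definition rvol r : R := w * r ^+ d.
Definition rtors r : R := w * r ^+ d.+2 / (d%:R * d.+2%:R).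
Definition rnu r : R := bessel d (lam * r ^+ 2) / (rtors r * bessel d.+4 (lam * r ^+ 2)).

Let dn : (d%:R : R) != 0. Proof. by rewrite pnatr_eq0 -lt0n. Qed.
Let d2n : (d.+2%:R : R) != 0. Proof. by []. Qed.

Let pos2 x : 0 <= x <= xs -> 0 < bessel d.+2 x.
Proof. exact: bessel_pos_shift. Qed.

Let pos4 x : 0 <= x <= xs -> 0 < bessel d.+4 x.
Proof.
move=> /andP[x0 x1]; apply: (bessel_pos_shift d.+2 xs) => //; last by rewrite x0.
by move=> y /andP[y0 y1]; apply: pos2; rewrite y0 ltW.
Qed.

Let pos6 x : 0 <= x <= xs -> 0 < bessel d.+4.+2 x.
Proof.
move=> /andP[x0 x1]; apply: (bessel_pos_shift d.+4 xs) => //; last by rewrite x0.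
by move=> y /andP[y0 y1]; apply: pos4; rewrite y0 ltW.
Qed.

Let arg_in r : 0 <= r -> lam * r ^+ 2 <= xs -> 0 <= lam * r ^+ 2 <= xs.
Proof. by move=> r0 ->; rewrite mulr_ge0 ?sqr_ge0 // ltW. Qed.

Let tors0 r : 0 < r -> 0 < rtors r.
Proof.
move=> r0; have h : 0 < w * r ^+ d.+2 by rewrite mulr_gt0 ?exprn_gt0.
by apply: divr_gt0 h _; rewrite mulr_gt0 // ltr0n.
Qed.

(* With [A], [A2], [B], [B2] the Bessel functions of parameters [d], [d+2], [d+4], [d+6] at [x],
   both sides are the derivative in [s] of [A / (T * B)]. *)
Lemma riccati_identity (a a2 a4 A A2 B B2 T x s : R) :
    a != 0 -> a2 != 0 -> a4 != 0 -> B != 0 -> T != 0 -> x != 0 -> s != 0 ->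
    A = A2 - x * B / (a * a2) -> A2 = B - x * B2 / (a2 * a4) ->
  - (2 * a)^-1 * A2 * (x / s ^+ 2 * (2 * s ^+ 1 * 1)) * (T * B)^-1 +
    A * (- (a2 * T / s * B + T * (- (2 * a4)^-1 * B2 * (x / s ^+ 2 * (2 * s ^+ 1 * 1)))) / (T * B) ^+ 2)
  = - (a2 * T / s) * (A2 / (T * B)) ^+ 2.
Proof.
move=> a0 a20 a40 B0 T0 x0 s0 -> e2.
have -> : B2 = (B - A2) * (a2 * a4) / x by rewrite e2; field; rewrite x0 a20 a40.
by field; rewrite s0 B0 T0 x0 a0 a20 a40.
Qed.

Lemma rnu_add r : 0 < r -> lam * r ^+ 2 <= xs ->
  rnu r + lam / rvol r = bessel d.+2 (lam * r ^+ 2) / (rtors r * bessel d.+4 (lam * r ^+ 2)).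
Proof.
move=> r0 rx; have hx := arg_in r (ltW r0) rx; have b4 := lt0r_neq0 (pos4 _ hx).
have rn := lt0r_neq0 r0; have wn := lt0r_neq0 w0.
have rdn : r ^+ d != 0 by rewrite expf_neq0.
have alg (v q a a2 A B : R) : v != 0 -> q != 0 -> a != 0 -> a2 != 0 -> B != 0 ->
    (A - lam * r ^+ 2 * B / (a * a2)) / (v * (q * r ^+ 2) / (a * a2) * B) + lam / (v * q) =
    A / (v * (q * r ^+ 2) / (a * a2) * B).
  by move=> *; field; do ?[apply/andP; split].
rewrite /rnu /rvol /rtors (bessel_rec d) // -(addn2 d) exprD addn2.
exact: alg.
Qed.

(** The initial case of [riccati_step], starting from zero torsion and zero mass. It amounts to
    [bessel d.+2 <= bessel d.+4] up to [xs]. *)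
Lemma rnu_first r p : 0 < r -> lam * r ^+ 2 <= xs ->
  rnu r * p ^+ 2 <= p ^+ 2 / rtors r - lam * p ^+ 2 / rvol r.
Proof.
move=> r0 rx; have hx := arg_in r (ltW r0) rx.
suff : rnu r + lam / rvol r <= (rtors r)^-1.
  by move/(ler_wpM2r (sqr_ge0 p)); lra.
rewrite rnu_add // invfM mulrCA ler_piMr ?invr_ge0 ?(ltW (tors0 _ r0)) //.
rewrite ler_pdivrMr ?pos4 // mul1r (bessel_rec d.+2) // gerBl.
have b6 := pos6 _ hx; have x0 : 0 <= lam * r ^+ 2 by case/andP: hx.
by rewrite divr_ge0 // mulr_ge0 // ltW.
Qed.

Lemma is_derive_rtors r : r != 0 -> is_derive r (1:R) rtors (d.+2%:R * rtors r / r).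
Proof.
move=> rn; apply: is_derive_congr.
  apply: is_derive_mulconst; apply: is_derive_constmul.
  exact: (is_derive_exp id _ _ _ (is_derive_id r 1)).
rewrite /rtors [r ^+ d.+2]exprS /=; move: (r ^+ d.+1) (d%:R : R) (d.+2%:R : R) dn d2n => q a a2 a0 a20.
by field; rewrite rn a0 a20.
Qed.

(** In the variable [T = rtors r], with [V = rvol r], this is the Riccati equation
    [nu' = - (nu + lam / V)^2]. *)
Lemma is_derive_rnu r : 0 < r -> lam * r ^+ 2 <= xs ->
  is_derive r (1:R) rnu (- (d.+2%:R * rtors r / r) * (rnu r + lam / rvol r) ^+ 2).
Proof.
move=> r0 rx; have hx := arg_in r (ltW r0) rx; have b4 := lt0r_neq0 (pos4 _ hx).
have rn := lt0r_neq0 r0; have tn := lt0r_neq0 (tors0 _ r0).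
have dx : is_derive r (1:R) (fun s => lam * s ^+ 2) (lam * (2%:R * r ^+ 1 * 1)).
  exact/is_derive_constmul/(is_derive_exp id _ _ _ (is_derive_id r 1)).
have dA := is_derive_chain _ _ _ _ _ dx (is_derive_bessel d _ d0).
have dB := is_derive_chain _ _ _ _ _ dx (is_derive_bessel d.+4 _ isT).
have dT := is_derive_rtors r rn.
have tb : rtors r * bessel d.+4 (lam * r ^+ 2) != 0 by rewrite mulf_neq0.
have dI := is_derive_inv (fun y => rtors y * bessel d.+4 (lam * y ^+ 2)) _ _ tb (is_derive_mul _ _ _ _ _ dT dB).
apply: is_derive_congr (is_derive_mul _ _ _ _ _ dA dI) _.
rewrite rnu_add //.
have xn : lam * r ^+ 2 != 0 by rewrite mulf_neq0 ?expf_neq0 // lt0r_neq0.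
have e1 := bessel_rec d (lam * r ^+ 2) d0; have e2 := bessel_rec d.+2 (lam * r ^+ 2) isT.
have d4n : (d.+4%:R : R) != 0 by [].
have lr : lam = (lam * r ^+ 2) / r ^+ 2 by rewrite mulfK ?expf_neq0.
move: (riccati_identity _ _ _ _ _ _ _ _ _ _ dn d2n d4n b4 tn xn rn e1 e2); rewrite -lr => <-.
by [].
Qed.

Lemma rtors_lt r1 r2 : 0 <= r1 -> r1 < r2 -> rtors r1 < rtors r2.
Proof.
move=> r10 r12; rewrite /rtors ltr_pM2r ?invr_gt0 ?mulr_gt0 ?ltr0n // ltr_pM2l //.
by rewrite ltr_pXn2r // nnegrE // ltW // (le_lt_trans r10).
Qed.

(* Along the segment [P = p1 + s (T - T1)], [T = rtors r], the quantity
   [s^2 T - lam P^2 / V - rnu P^2] increases with [r] by the Riccati equation. *)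
Lemma riccati_step r1 r2 p1 p2 : 0 < r1 -> r1 < r2 -> lam * r2 ^+ 2 <= xs -> 0 <= p1 -> p1 <= p2 ->
  rnu r2 * p2 ^+ 2 - rnu r1 * p1 ^+ 2 <=
  (p2 - p1) ^+ 2 / (rtors r2 - rtors r1) - lam * (p2 ^+ 2 - p1 ^+ 2) / rvol r2.
Proof.
move=> r10 r12 rx p10 p12; have r20 := lt_trans r10 r12.
have Td : 0 < rtors r2 - rtors r1 by rewrite subr_gt0 rtors_lt // ltW.
pose s := (p2 - p1) / (rtors r2 - rtors r1).
have s0 : 0 <= s by rewrite divr_ge0 ?subr_ge0 // ltW // -subr_gt0.
pose P r := s * (rtors r - rtors r1) + p1.
pose c := lam / rvol r2.
pose F r := s ^+ 2 * rtors r - c * P r ^+ 2 - rnu r * P r ^+ 2.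
pose T' r := d.+2%:R * rtors r / r.
pose F' r := T' r * (s ^+ 2 - 2 * (c + rnu r) * P r * s + ((rnu r + lam / rvol r) * P r) ^+ 2).
have hr r : r1 <= r <= r2 -> 0 < r /\ lam * r ^+ 2 <= xs.
  move=> /andP[h1 h2]; have r0 := lt_le_trans r10 h1; split => //.
  by apply: le_trans rx; rewrite ler_wpM2l ?(ltW lam0) // lerXn2r // nnegrE ltW.
have FF : F r1 <= F r2.
  apply: (is_derive_ge0_homo F F' _ _ (ltW r12)) => r h; have [r0 hx] := hr r h.
    have dT := is_derive_rtors r (lt0r_neq0 r0).
    have dP : is_derive r (1:R) P (s * T' r).
      apply: is_derive_addconst; apply: is_derive_constmul.
      exact: (is_derive_addconst _ (- rtors r1) _ _ dT).
    have dP2 := is_derive_exp _ 1 _ _ dP.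
    have d1 := is_derive_constmul rtors (s ^+ 2) _ _ dT.
    have d2 := is_derive_opp _ _ _ (is_derive_constmul (fun y => P y ^+ 2) c _ _ dP2).
    have d3 := is_derive_opp _ _ _ (is_derive_mul rnu (fun y => P y ^+ 2) _ _ _ (is_derive_rnu r r0 hx) dP2).
    have := is_derive_add (fun y => s ^+ 2 * rtors y - c * P y ^+ 2) (fun y => - (rnu y * P y ^+ 2)) _ _ _
      (is_derive_add (fun y => s ^+ 2 * rtors y) (fun y => - (c * P y ^+ 2)) _ _ _ d1 d2) d3.
    move=> h2; apply: (is_derive_congr _ _ _ _ h2); rewrite expr1 -/(T' r) /F'.
    move: (T' r) (P r) (rnu r) (lam / rvol r) => t q n m; clear; ring.
  have t0 := ltW (tors0 _ r0); have Tp : 0 <= T' r by apply: divr_ge0 (ltW r0); apply: mulr_ge0.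
  rewrite mulr_ge0 //.
  have P0 : 0 <= P r.
    rewrite addr_ge0 // mulr_ge0 // subr_ge0; case/andP: h => h1 _.
    by move: h1; rewrite le_eqVlt => /predU1P[->//|h1]; rewrite ltW // rtors_lt // ltW.
  (* [F] has the volume frozen at its largest value [rvol r2]. As [P] and [s] are nonnegative, this
     only increases the bracket in [F'], which then dominates a square. *)
  have cm : c <= lam / rvol r.
    rewrite ler_wpM2l ?(ltW lam0) // lef_pV2 ?posrE /rvol ?mulr_gt0 ?exprn_gt0 //.
    by rewrite ler_wpM2l ?(ltW w0) // lerXn2r // ?nnegrE ?(ltW r0) ?(ltW r20) //; case/andP: h.
  have : (c + rnu r) * P r * s <= (rnu r + lam / rvol r) * P r * s.
    rewrite -(mulrA (c + _)) -(mulrA (rnu r + _)); apply: ler_wpM2r; first exact: mulr_ge0.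
    by rewrite [c + _]addrC lerD2l.
  have := sqr_ge0 (s - (rnu r + lam / rvol r) * P r); rewrite sqrrB.
  lra.
have P1e : P r1 = p1 by rewrite /P subrr mulr0 add0r.
have P2e : P r2 = p2 by rewrite /P divfK ?lt0r_neq0 // subrK.
move: FF; rewrite /F P1e P2e.
have -> : (p2 - p1) ^+ 2 / (rtors r2 - rtors r1) = s ^+ 2 * (rtors r2 - rtors r1).
  by rewrite /s; have h := lt0r_neq0 Td; field.
have -> : lam * (p2 ^+ 2 - p1 ^+ 2) / rvol r2 = c * (p2 ^+ 2 - p1 ^+ 2) by rewrite /c; ring.
lra.
Qed.

End Riccati.

(** * The Kohler-Jobin inequality *)

Section Sequences.
Context {R : realType}.
Implicit Types (U : nat -> R) (m n k N : nat).

Lemma telescope_from U m N : (m <= N)%N ->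
  \sum_(k < N) ((m <= k)%N)%:R * (U k - U k.+1) = U m - U N.
Proof.
elim: N => [|N IH]; first by rewrite leqn0 => /eqP ->; rewrite big_ord0 subrr.
rewrite big_ord_recr /= leq_eqVlt => /predU1P[->|mN].
  by rewrite ltnn mul0r addr0 subrr big1 // => i _; rewrite leqNgt (leq_trans (ltn_ord i)) ?mul0r.
by rewrite -ltnS mN mul1r IH //; ring.
Qed.

Lemma sum_indic_le k N : (k < N)%N -> \sum_(m < N) ((m <= k)%N)%:R = k.+1%:R :> R.
Proof.
elim: N => [//|N IH]; rewrite big_ord_recr /= ltnS leq_eqVlt => /predU1P[->|kN].
  rewrite leqnn -natr1; congr (_ + _).
  under eq_bigr => i _ do rewrite (ltnW (ltn_ord i)).
  by rewrite sumr_const card_ord.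
by rewrite IH // leqNgt kN addr0.
Qed.

Definition mean_upto U k : R := (\sum_(j < k.+1) U j) / k.+1%:R.

(** Hardy's inequality by telescoping: with [A] the mean, each step changes the left side of [h] by
    minus a nonnegative multiple of a square; [2 A U <= A^2 / 2 + 2 U^2] then gives the constant
    4. *)
Lemma hardy_means U N : \sum_(k < N) mean_upto U k ^+ 2 <= 4 * \sum_(k < N) U k ^+ 2.
Proof.
suff h : \sum_(k < N) (mean_upto U k ^+ 2 - 2 * mean_upto U k * U k)
    + (\sum_(j < N) U j) ^+ 2 / N%:R <= 0.
  have h0 : 0 <= (\sum_(j < N) U j) ^+ 2 / N%:R by rewrite divr_ge0 ?sqr_ge0.
  have h2 : \sum_(k < N) (2 * mean_upto U k * U k) <= 2^-1 * (\sum_(k < N) mean_upto U k ^+ 2) + 2 * \sum_(k < N) U k ^+ 2.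
    rewrite !mulr_sumr -big_split /=; apply: ler_sum => k _.
    by have := sqr_ge0 (mean_upto U k - 2 * U k); rewrite sqrrB; lra.
  by move: h; rewrite sumrB; lra.
elim: N => [|N IH]; first by rewrite !big_ord0 expr0n mul0r addr0.
rewrite !big_ord_recr /=.
have -> : mean_upto U N = (\sum_(j < N) U j + U N) / N.+1%:R by rewrite /mean_upto big_ord_recr.
set S := \sum_(j < N) U j in IH *; set Q := \sum_(k < N) _ in IH *.
suff : ((S + U N) / N.+1%:R) ^+ 2 - 2 * ((S + U N) / N.+1%:R) * U N + (S + U N) ^+ 2 / N.+1%:R <= S ^+ 2 / N%:R.
  by move=> h; apply: le_trans IH; rewrite -addrA lerD2l.
case: N @S @Q IH => [|N] S Q IH.
  by rewrite /S big_ord0 add0r expr0n mul0r !divr1; have := sqr_ge0 (U 0%N); lra.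
have e : S ^+ 2 / N.+1%:R - (((S + U N.+1) / N.+2%:R) ^+ 2 - 2 * ((S + U N.+1) / N.+2%:R) * U N.+1 + (S + U N.+1) ^+ 2 / N.+2%:R)
  = N.+1%:R * (S / N.+1%:R - (S + U N.+1) / N.+2%:R) ^+ 2.
  have h1 : (N.+1%:R : R) != 0 by []. have h2 : (N.+2%:R : R) != 0 by [].
  have h12 : (N.+2%:R : R) = N.+1%:R + 1 by rewrite natr1.
  rewrite h12 in h2 *; move: (N.+1%:R : R) h1 h2 => a a0 a1; clear -a0 a1.
  by field; rewrite a0 a1.
by rewrite -subr_ge0 e mulr_ge0 ?sqr_ge0.
Qed.

(** For decreasing [U] the total of [(U j - U n)_+], the analogue of the mass of [phi - phi(r)] over
    [B_r]. *)
Definition layer_mass U n : R := \sum_(j < n) j.+1%:R * (U j - U j.+1).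

Lemma layer_massE U n : layer_mass U n = \sum_(j < n) U j - n%:R * U n.
Proof.
elim: n => [|n IH]; first by rewrite /layer_mass !big_ord0; ring.
by rewrite /layer_mass !big_ord_recr /= -/(layer_mass U n) IH -natr1; ring.
Qed.

(** Layer cake: the integral of [u^2] is twice the integral over [t] of the mass of [(u - t)_+].
    That mass is linear in [t] on each layer, so the trapezoidal rule is exact. *)
Lemma sum_sqr_layers U N : U N = 0 ->
  \sum_(k < N) U k ^+ 2 = \sum_(k < N) (U k - U k.+1) * (layer_mass U k.+1 + layer_mass U k).
Proof.
move=> UN; suff -> : \sum_(k < N) (U k - U k.+1) * (layer_mass U k.+1 + layer_mass U k) =
    \sum_(k < N) U k ^+ 2 - 2 * (\sum_(k < N) U k) * U N + N%:R * U N ^+ 2 by rewrite UN; ring.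
elim: N {UN} => [|N IH]; first by rewrite !big_ord0; ring.
rewrite !big_ord_recr /= IH !layer_massE big_ord_recr /= -natr1; ring.
Qed.

End Sequences.

Section Rank.
Context {R : realType} {d : nat}.
Implicit Types (X : {fset pt d}) (u : pt d -> R).

(** Sorting breaks ties, so the level of rank [k] has exactly [k + 1] points and a tie only produces
    a layer of thickness 0. Points outside [X] have rank [#X], where [U] is 0. *)
Lemma decreasing_rank X u : (forall x, x \notin X -> u x = 0) -> (forall x, 0 <= u x) ->
  exists (rk : pt d -> nat) (U : nat -> R),
  [/\ forall x, U (rk x) = u x,
      forall x, (x \in X) = (rk x < #|` X|)%N /\ (rk x <= #|` X|)%N,
      forall F : nat -> R, \sum_(x <- X) F (rk x) = \sum_(k < #|` X|) F k,
      forall k, U k.+1 <= U k /\ 0 <= U k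
    & U #|` X| = 0].
Proof.
move=> u0 uge; pose le x y := u y <= u x; pose s := sort le X.
have tot : total le by move=> x y; rewrite /le; exact: le_total.
have tr : transitive le by move=> y x z; rewrite /le => h1 h2; exact: le_trans h2 h1.
have sz : size s = #|` X| by rewrite size_sort.
have ms x : (x \in s) = (x \in X) by rewrite mem_sort.
have un : uniq s by rewrite sort_uniq fset_uniq.
have so : sorted le s by exact: sort_sorted.
exists (fun x => index x s), (fun k => nth 0 (map u s) k); split.
- move=> x; have [xs|xs] := boolP (x \in s).
    by rewrite (nth_map x) ?index_mem // nth_index.
  by rewrite nth_default ?size_map ?memNindex // u0 // -ms.
- by move=> x; rewrite -sz index_mem ms index_size.
- move=> F; rewrite (perm_big s) /=; last by rewrite perm_sym; apply/permPl; exact: perm_sort.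
  case: (s) un sz ms => [|a t] un sz _; first by rewrite -sz big_nil big_ord0.
  rewrite (big_nth a) sz big_mkord; apply: eq_bigr => i _; congr F.
  by rewrite index_uniq // sz.
- move=> k; split; last first.
    have [h|h] := ltnP k (size (map u s)); last by rewrite nth_default.
    by have /mapP[x _ ->] := mem_nth 0 h.
  have [h|h] := ltnP k.+1 (size s).
    have x0 : pt d := 0; rewrite !(nth_map x0) ?(ltnW h) //.
    by have := (sortedP x0 so) k h.
  rewrite nth_default ?size_map //.
  have [h'|h'] := ltnP k (size (map u s)); last by rewrite nth_default.
  by have /mapP[x _ ->] := mem_nth 0 h'.
- by rewrite nth_default // size_map sz.
Qed.

End Rank.

Section Levels.
Context {R : realType} {d : nat}.
Variables (X : {fset pt d}) (rk : pt d -> nat).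
Hypothesis rkX : forall x, (x \in X) = (rk x < #|` X|)%N /\ (rk x <= #|` X|)%N.
Hypothesis rk_sum : forall F : nat -> R, \sum_(x <- X) F (rk x) = \sum_(k < #|` X|) F k.
Implicit Types (c : nat -> R) (x p q : pt d).

Definition superlevel k : {fset pt d} := [fset x in X | (rk x <= k)%N]%fset.

Definition sep k p q : R := ((rk p <= k)%N != (rk q <= k)%N)%:R.

Definition lev c x : R := \sum_(k < #|` X|) ((rk x <= k)%N)%:R * c k.

Lemma card_superlevel k : (k < #|` X|)%N -> #|` superlevel k| = k.+1.
Proof.
move=> kN; apply/eqP; rewrite -(eqr_nat R) -sum_indic_card.
by rewrite (rk_sum (fun m => ((m <= k)%N)%:R)) sum_indic_le.
Qed.

Lemma lev_out c x : x \notin X -> lev c x = 0.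
Proof.
move=> xX; apply: big1 => k _; case: (rkX x) xX => -> _; rewrite -leqNgt => h.
by rewrite leqNgt (leq_trans (ltn_ord k) h) mul0r.
Qed.

Lemma lev_ge0 c x : (forall k, 0 <= c k) -> 0 <= lev c x.
Proof. by move=> c0; apply: sumr_ge0 => k _; rewrite mulr_ge0. Qed.

Lemma sum_lev c : \sum_(x <- X) lev c x = \sum_(k < #|` X|) k.+1%:R * c k.
Proof.
rewrite exchange_big /=; apply: eq_bigr => k _; rewrite -mulr_suml.
by rewrite (rk_sum (fun m => ((m <= k)%N)%:R)) sum_indic_le.
Qed.

Lemma lev_sep c p q : (forall k, 0 <= c k) ->
  `|lev c q - lev c p| = \sum_(k < #|` X|) sep k p q * c k.
Proof.
move=> c0; wlog h : p q / (rk p <= rk q)%N => [H|].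
  have [h|h] := leqP (rk p) (rk q); first exact: H.
  rewrite distrC H ?(ltnW h) //; apply: eq_bigr => k _; congr (_ * _).
  by rewrite /sep eq_sym.
rewrite distrC /lev -sumrB ger0_norm.
  apply: eq_bigr => k _; rewrite -mulrBl; congr (_ * _); rewrite /sep.
  have [hq|hq] := leqP (rk q) k; first by rewrite (leq_trans h hq) eqxx subrr.
  by case: leqP => _; rewrite subr0.
apply: sumr_ge0 => k _; rewrite -mulrBl mulr_ge0 // subr_ge0 ler_nat.
by have [hq|//] := leqP (rk q) k; rewrite (leq_trans h hq).
Qed.

Lemma entries_superlevel k : (k < #|` X|)%N ->
  entries_tot (superlevel k) <= \sum_(j < d) \sum_(y <- edom X j) sep k y (y + ev j).
Proof.
move=> kN; apply: ler_sum => j _; rewrite /entries.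
have inj : {in X &, injective (fun x => x - ev j)} by move=> x y _ _ /addIr.
have mem x : x \in X -> x - ev j \in edom X j by move=> xX; rewrite in_edom subrK xX orbT.
have := sum_image_le _ X (edom X j) _ (fun y => sep k y (y + ev j)) inj mem (fun y _ => ler0n R _).
apply: le_trans; apply: le_trans (_ : \sum_(x <- superlevel k) sep k (x - ev j) (x - ev j + ev j) <= _).
  apply: ler_sum_fset => x; rewrite subrK !inE /= => /andP[_ xk]; rewrite /sep xk.
  case: (rkX (x - ev j)) => -> _; rewrite ler_nat.
  case: (leqP (rk (x - ev j)) k) => h; last by rewrite andbF.
  by rewrite (leq_ltn_trans h kN).
by apply: ler_sum_fset_incl => [x|//]; rewrite !inE => /andP[].
Qed.

End Levels.

Section KohlerJobin.
Context {R : realType}.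

Lemma jensen_sqr n (m f : nat -> R) : (forall i, 0 <= m i) ->
  (\sum_(i < n) m i * f i) ^+ 2 <= (\sum_(i < n) m i) * (\sum_(i < n) m i * f i ^+ 2).
Proof.
move=> m0; set M := \sum_(i < n) m i; set S := \sum_(i < n) m i * f i; set Q := \sum_(i < n) _ * _ ^+ 2.
have M0 : 0 <= M by exact: sumr_ge0.
have h : \sum_(i < n) m i * (f i * M - S) ^+ 2 = M * (M * Q - S ^+ 2).
  rewrite (eq_bigr (fun i : 'I_n => M ^+ 2 * (m i * f i ^+ 2) - 2 * M * S * (m i * f i) + S ^+ 2 * m i)).
    by rewrite big_split sumrB /= -!mulr_sumr -/M -/S -/Q; ring.
  by move=> i _; ring.
have : 0 <= M * (M * Q - S ^+ 2) by rewrite -h; apply: sumr_ge0 => i _; rewrite mulr_ge0 // sqr_ge0.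
have [Mp|] := ltP 0 M; first by rewrite pmulr_rge0 // subr_ge0.
move=> Mn _; have M00 : M = 0 by apply: le_anti; rewrite Mn M0.
have mi i : (i < n)%N -> m i = 0.
  move=> hi; apply: le_anti; rewrite m0 andbT -M00.
  by rewrite /M (bigD1 (Ordinal hi)) //= lerDl sumr_ge0.
by rewrite M00 mul0r /S big1 ?expr0n // => i _; rewrite mi ?mul0r.
Qed.

Lemma mean_upto_decr (U : nat -> R) m k : (forall i, U i.+1 <= U i) -> (m <= k)%N ->
  mean_upto U k <= mean_upto U m.
Proof.
move=> Um /subnK <-; elim: (k - m)%N => [//|i IH0]; apply: le_trans IH0; rewrite addSn.
move: (i + m)%N => n; rewrite /mean_upto ler_pdivrMr // big_ord_recr /= mulrC mulrA ler_pdivlMr // -natr1.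
set S := \sum_(j < n.+1) U j.
have hU p j : U (p + j)%N <= U p by elim: j => [|j IH]; [rewrite addn0 | rewrite addnS; apply: le_trans IH].
have : n.+1%:R * U n.+1 <= S.
  rewrite mulr_natl -[X in _ *+ X]card_ord -sumr_const; apply: ler_sum => j _.
  by have := hU j (n.+1 - j)%N; rewrite subnKC ?(ltnW (ltn_ord j)).
by rewrite mulrDl mulrDr; lra.
Qed.

Variable d : nat.
Hypothesis hd : (2 <= d)%N.

Let d0 : (0 < d)%N. Proof. exact: leq_trans hd. Qed.
Let dp : 0 < d%:R :> R. Proof. by rewrite ltr0n. Qed.

Lemma cdim_gt0 : 0 < cdim d :> R.
Proof. by rewrite divr_gt0. Qed.

Lemma rtors_onto (t : R) : 0 < t -> exists2 r, 0 < r & rtors d r = t.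
Proof.
move=> t0; have w0 := (omega_gt0 d : 0 < omega R d); have w2 := (omega_gt0 d.+2 : 0 < omega R d.+2).
have k0 : 0 < d%:R * d.+2%:R :> R by apply: mulr_gt0.
have V0 : 0 < t * (d%:R * d.+2%:R) / omega R d * omega R d.+2.
  by apply: mulr_gt0 w2; apply: divr_gt0 w0; exact: mulr_gt0.
(* [rtors d] is a multiple of [r^(d+2)], hence the volume in dimension [d + 2]. *)
have [r r0 e] := volume_radius d.+2 _ isT V0; exists r => //.
have e2 : r ^+ d.+2 = t * (d%:R * d.+2%:R) / omega R d.
  by apply: (mulfI (lt0r_neq0 w2)); rewrite e mulrC.
rewrite /rtors e2; have h1 := lt0r_neq0 k0; have h2 := lt0r_neq0 w0.
by rewrite [omega R d * _]mulrC divfK // mulfK.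
Qed.

(* Saint-Venant, read as a comparison of the cardinality [n] with the volume of the ball having the
   same torsion. *)
Lemma volume_defect (n : nat) (b r s t : R) : (0 < n)%N -> 0 <= b -> 0 < r -> 0 < s ->
  omega R d * r ^+ d = n%:R -> rtors d s = t -> d%:R ^+ 2 * t <= r ^+ 2 * (n%:R * cdim d + 9 * b) ->
  n%:R^-1 - (rvol d s)^-1 <= 9 / cdim d * b / n%:R ^+ 2.
Proof.
move=> n0 b0 r0 s0 vol et ht; have w0 := (omega_gt0 d : 0 < omega R d); have c0 := cdim_gt0.
have np : 0 < n%:R :> R by rewrite ltr0n.
have V0 : 0 < rvol d s by rewrite mulr_gt0 // exprn_gt0.
have rhs0 : 0 <= 9 / cdim d * b / n%:R ^+ 2 by rewrite !mulr_ge0 ?invr_ge0 ?sqr_ge0 // ltW.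
have [h|h] := leP (rvol d s) n%:R.
  by apply: le_trans rhs0; rewrite subr_le0 lef_pV2.
have rs : r < s.
  move: h; rewrite -vol /rvol ltr_pM2l // => h; rewrite ltNge; apply: contraTN h => h; rewrite -leNgt.
  by rewrite lerXn2r // nnegrE ltW.
have e : d%:R ^+ 2 * t = s ^+ 2 * (rvol d s * cdim d).
  rewrite -et /rtors /rvol /cdim -(addn2 d) exprD; have h1 := lt0r_neq0 dp.
  have h2 : ((d + 2)%:R : R) != 0 by rewrite addn2.
  by move: ((d + 2)%:R : R) (d%:R : R) h1 h2 => a c *; field; apply/andP; split.
have hM : rvol d s * cdim d <= n%:R * cdim d + 9 * b.
  have s2 : 0 < s ^+ 2 by rewrite exprn_gt0.
  rewrite -(ler_pM2l s2) -e; apply: le_trans ht _; apply: ler_wpM2r.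
    by rewrite addr_ge0 ?mulr_ge0 // ltW.
  by rewrite lerXn2r // ?nnegrE ltW.
have -> : n%:R^-1 - (rvol d s)^-1 = (rvol d s - n%:R) / (rvol d s * n%:R).
  by have h1 := lt0r_neq0 np; have h2 := lt0r_neq0 V0; field; rewrite h1 h2.
have VN : 0 < rvol d s * n%:R by exact: mulr_gt0.
rewrite (ler_pdivrMr _ _ VN).
have h1 : rvol d s - n%:R <= 9 / cdim d * b.
  by rewrite mulrAC ler_pdivlMr // mulrBl; lra.
apply: le_trans h1 _; set q := 9 / cdim d * b; have q0 : 0 <= q by rewrite !mulr_ge0 ?invr_ge0 // ltW.
have -> : q / n%:R ^+ 2 * (rvol d s * n%:R) = q * (rvol d s / n%:R).
  by have h2 := lt0r_neq0 np; field.
by rewrite ler_peMr // ler_pdivlMr // mul1r ltW.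
Qed.

End KohlerJobin.

Section Layers.
Context {R : realType} {d : nat}.
Variables (X : {fset pt d}) (u : pt d -> R) (rk : pt d -> nat) (U : nat -> R).
Hypothesis hd : (2 <= d)%N.
Hypothesis Urk : forall x, U (rk x) = u x.
Hypothesis rkX : forall x, (x \in X) = (rk x < #|` X|)%N /\ (rk x <= #|` X|)%N.
Hypothesis rksum : forall F : nat -> R, \sum_(x <- X) F (rk x) = \sum_(k < #|` X|) F k.
Hypothesis Umon : forall k, U k.+1 <= U k /\ 0 <= U k.
Hypothesis UN : U #|` X| = 0.
Implicit Types (k n : nat).

Let N := #|` X|.

Definition layer k : R := U k - U k.+1.

Definition edges (F : 'I_d -> pt d -> R) : R := \sum_(j < d) \sum_(y <- edom X j) F j y.

(** The analogue of the integral of [|grad u|] over a level surface. A crossing edge is weighted by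
    its full gradient, not by the part in the layer, so that the energy is exactly the sum of
    [layer k * flux k]. *)
Definition flux k : R := edges (fun j y => sep rk k y (y + ev j) * `|grad j u y|).

(** Volume over flux is the slope [g'] for which [g(u)] has flux equal to the enclosed volume, as
    the torsion function does. The index [n] keeps the first [n] layers only; by [flux_gt0] a layer
    of zero flux has zero thickness. *)
Definition stretched n k : R := ((k < n)%N)%:R * (k.+1%:R / flux k * layer k).

Definition test_torsion n : pt d -> R := lev X rk (stretched n).

Definition tau n : R := \sum_(k < n) k.+1%:R * (k.+1%:R / flux k * layer k).

Lemma edges_sum (F : nat -> 'I_d -> pt d -> R) (c : nat -> R) :
  edges (fun j y => \sum_(k < N) c k * F k j y) = \sum_(k < N) c k * edges (F k).
Proof.
rewrite /edges; under eq_bigr do rewrite exchange_big /=.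
rewrite exchange_big /=; apply: eq_bigr => k _; rewrite mulr_sumr.
by apply: eq_bigr => j _; rewrite mulr_sumr.
Qed.

Lemma edges_le F G : (forall j y, F j y <= G j y) -> edges F <= edges G.
Proof. by move=> h; apply: ler_sum => j _; apply: ler_sum. Qed.

Lemma edgesZ (c : R) F : edges (fun j y => c * F j y) = c * edges F.
Proof. by rewrite /edges mulr_sumr; apply: eq_bigr => j _; rewrite mulr_sumr. Qed.

Lemma eq_edges F G : (forall j y, F j y = G j y) -> edges F = edges G.
Proof. by move=> h; apply: eq_bigr => j _; apply: eq_bigr. Qed.

Lemma layer_ge0 k : 0 <= layer k.
Proof. by rewrite subr_ge0; case: (Umon k). Qed.

Lemma sep_ge0 k p q : 0 <= sep rk k p q :> R.
Proof. exact: ler0n. Qed.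

Lemma flux_ge0 k : 0 <= flux k.
Proof. by apply: sumr_ge0 => j _; apply: sumr_ge0 => y _; rewrite mulr_ge0 // sep_ge0. Qed.

Lemma norm_grad_layers j y : `|grad j u y| = \sum_(k < N) sep rk k y (y + ev j) * layer k.
Proof.
have lu x : lev X rk layer x = u x.
  by rewrite /lev telescope_from ?UN ?subr0 ?Urk //; case: (rkX x).
by rewrite /grad -!lu lev_sep //; exact: layer_ge0.
Qed.

Lemma energy_layers : energy X u = \sum_(k < N) layer k * flux k.
Proof.
rewrite -(edges_sum (fun k j y => sep rk k y (y + ev j) * `|grad j u y|) layer); apply: eq_edges => j y.
by rewrite -sqr_normr expr2 {1}norm_grad_layers mulr_suml; apply: eq_bigr => k _; ring.
Qed.

Lemma layer_entries k : (k < N)%N -> layer k * entries_tot (superlevel X rk k) <= flux k.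
Proof.
move=> kN; apply: le_trans (ler_wpM2l (layer_ge0 k) (entries_superlevel X rk rkX k kN)) _.
rewrite -/(edges _) -edgesZ; apply: edges_le => j y.
have h : sep rk k y (y + ev j) * layer k <= `|grad j u y|.
  rewrite norm_grad_layers (bigD1 (Ordinal kN)) //= lerDl sumr_ge0 // => i _.
  by rewrite mulr_ge0 ?sep_ge0 ?layer_ge0.
have e : sep rk k y (y + ev j) * sep rk k y (y + ev j) = sep rk k y (y + ev j) :> R.
  by rewrite /sep -natrM mulnb andbb.
by rewrite mulrC -{1}e -mulrA ler_wpM2l // sep_ge0.
Qed.

Lemma superlevel_neq0 k : (k < N)%N -> superlevel X rk k != fset0.
Proof. by move=> kN; rewrite -cardfs_gt0 (card_superlevel X rk rksum). Qed.

Lemma superlevel_radius k : exists2 r : R, 0 < r & omega R d * r ^+ d = k.+1%:R.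
Proof. by apply: volume_radius => //; exact: leq_trans hd. Qed.

Lemma flux_gt0 k : (k < N)%N -> 0 < layer k -> 0 < flux k.
Proof.
move=> kN lk; apply: lt_le_trans (layer_entries k kN); apply: mulr_gt0 => //.
have [r r0 vol] := superlevel_radius k.
have cs := card_superlevel X rk rksum k kN.
have := isoperimetric (superlevel X rk k) r hd r0 (superlevel_neq0 k kN).
rewrite cs => /(_ vol); rewrite -(pmulr_rgt0 _ r0); apply: lt_le_trans.
by rewrite ltr0n.
Qed.

Lemma stretch_ge0 k : 0 <= k.+1%:R / flux k * layer k.
Proof. by rewrite mulr_ge0 ?divr_ge0 ?flux_ge0 ?layer_ge0. Qed.

Lemma stretched_ge0 n k : 0 <= stretched n k.
Proof. by rewrite mulr_ge0 ?ler0n // stretch_ge0. Qed.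

Lemma tauS n : tau n.+1 = tau n + n.+1%:R * (n.+1%:R / flux n * layer n).
Proof. by rewrite /tau big_ord_recr. Qed.

Lemma tau_ge0 n : 0 <= tau n.
Proof. by apply: sumr_ge0 => k _; rewrite mulr_ge0 // stretch_ge0. Qed.

Lemma tau_le m n : (m <= n)%N -> tau m <= tau n.
Proof.
move=> /subnK <-; elim: (n - m)%N => [//|i IH]; rewrite addSn tauS.
by apply: le_trans IH _; rewrite lerDl mulr_ge0 // stretch_ge0.
Qed.

Lemma sum_stretched n (g : nat -> R) : (n <= N)%N ->
  \sum_(k < N) stretched n k * g k = \sum_(k < n) k.+1%:R / flux k * layer k * g k.
Proof.
move=> nN; rewrite (big_ord_widen N (fun k => k.+1%:R / flux k * layer k * g k) nN).
rewrite [RHS]big_mkcond /=; apply: eq_bigr => k _; rewrite /stretched.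
by case: ltnP => _; rewrite ?mul1r ?mul0r.
Qed.

Lemma sum_test_torsion n : (n <= N)%N -> \sum_(x <- X) test_torsion n x = tau n.
Proof.
move=> nN; rewrite (sum_lev X rk rksum); under eq_bigr do rewrite mulrC.
by rewrite (sum_stretched n (fun k => k.+1%:R)) //; apply: eq_bigr => k _; rewrite mulrC.
Qed.

(** One edge may cross several levels, so the chain rule for [g(u)] is replaced by Jensen's
    inequality over the layers that the edge crosses. *)
Lemma energy_test_torsion n : (n <= N)%N -> energy X (test_torsion n) <= tau n.
Proof.
move=> nN; pose g k := ((k < n)%N)%:R * (k.+1%:R / flux k).
have -> : tau n = \sum_(k < N) (layer k * g k ^+ 2) * flux k.
  transitivity (\sum_(k < N) stretched n k * k.+1%:R).
    by rewrite (sum_stretched n (fun k => k.+1%:R)) //; apply: eq_bigr => k _; rewrite mulrC.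
  apply: eq_bigr => k _; rewrite /stretched /g; case: ltnP => _; last by rewrite !mul0r expr0n mulr0 mul0r.
  rewrite !mul1r; have [->|f0] := eqVneq (flux k) 0; first by rewrite invr0; ring.
  by field.
rewrite -(edges_sum (fun k j y => sep rk k y (y + ev j) * `|grad j u y|) (fun k => layer k * g k ^+ 2)).
apply: edges_le => j y; rewrite -sqr_normr /grad /test_torsion lev_sep; last exact: stretched_ge0.
apply: le_trans (_ : (\sum_(k < N) (sep rk k y (y + ev j) * layer k) * g k) ^+ 2 <= _).
  by rewrite le_eqVlt; apply/orP; left; apply/eqP; congr (_ ^+ 2); apply: eq_bigr => k _; rewrite /stretched /g; ring.
apply: le_trans (jensen_sqr N (fun k => sep rk k y (y + ev j) * layer k) g _) _.
  by move=> k; rewrite mulr_ge0 ?sep_ge0 ?layer_ge0.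
rewrite -norm_grad_layers mulr_sumr le_eqVlt; apply/orP; left; apply/eqP.
by apply: eq_bigr => k _; ring.
Qed.

Lemma torsion_superlevel k : (k < N)%N -> exists r : R, [/\ 0 < r, omega R d * r ^+ d = k.+1%:R &
  d%:R ^+ 2 * tau k.+1 <= r ^+ 2 * (k.+1%:R * cdim d + 9 * entries_tot (superlevel X rk k))].
Proof.
move=> kN; have [r r0 vol] := superlevel_radius k; exists r; split => //.
set Y := superlevel X rk k; have cs : #|` Y| = k.+1 by exact: card_superlevel.
(* With the factor [d] the linear term is [d^2 * tau] and the energy is at most that, so half of it
   remains. *)
pose w x := d%:R * test_torsion k.+1 x.
have t0 x : x \notin Y -> test_torsion k.+1 x = 0.
  rewrite /Y !inE negb_and => /orP[xX|xk]; first exact: lev_out.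
  apply: big1 => i _; rewrite /stretched ltnS; have [ik|_] := leqP i k; last by rewrite !mul0r mulr0.
  by rewrite leqNgt (leq_ltn_trans ik) ?mul0r // ltnNge.
have sYX : {subset Y <= X} by move=> x; rewrite !inE => /andP[].
have st : \sum_(x <- Y) test_torsion k.+1 x = tau k.+1.
  rewrite -sum_test_torsion //; apply/big_fset_incl; first exact/fsubsetP.
  by move=> x _; exact: t0.
have ew : energy Y w <= d%:R ^+ 2 * tau k.+1.
  have -> : energy Y w = d%:R ^+ 2 * energy Y (test_torsion k.+1).
    rewrite /energy mulr_sumr; apply: eq_bigr => j _; rewrite mulr_sumr; apply: eq_bigr => y _.
    by rewrite /grad /w; ring.
  rewrite ler_wpM2l ?sqr_ge0 //; apply: le_trans (energy_test_torsion k.+1 kN).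
  apply: ler_sum => j _; apply: ler_sum_fset_incl => [y|y _ _]; last exact: sqr_ge0.
  by rewrite !in_edom => /orP[] /sYX -> //; rewrite orbT.
have := torsion_bound Y w r hd r0 (superlevel_neq0 k kN).
rewrite cs => /(_ vol) h; have {h} := h _ _.
have -> : \sum_(x <- Y) w x = d%:R * tau k.+1 by rewrite -st mulr_sumr.
move=> h; have : d%:R * (d%:R * tau k.+1) <= 2^-1 * energy Y w + 2^-1 * r ^+ 2 * (k.+1%:R * cdim d + 9 * entries_tot Y).
  apply: h => x; first by move=> /t0 e; rewrite /w e mulr0.
  by rewrite mulr_ge0 // lev_ge0 // => i; exact: stretched_ge0.
by rewrite mulrA -expr2 -mulrA; lra.
Qed.

Lemma layer_mass0 n : (n <= N)%N -> tau n = 0 -> layer_mass U n = 0.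
Proof.
elim: n => [|n IH] nN; first by rewrite /layer_mass big_ord0.
rewrite tauS /layer_mass big_ord_recr /= -/(layer_mass U n) => e.
have s0 := stretch_ge0 n; have t0 := tau_ge0 n.
have m0 : 0 <= n.+1%:R * (n.+1%:R / flux n * layer n) by rewrite mulr_ge0.
rewrite IH ?(ltnW nN) //; last by lra.
rewrite add0r -/(layer n); have [lp|ln] := ltP 0 (layer n).
  have fp := flux_gt0 n nN lp.
  have : 0 < n.+1%:R * (n.+1%:R / flux n * layer n) by do !apply: mulr_gt0 => //; rewrite invr_gt0.
  lra.
have -> : layer n = 0 by apply: le_anti; rewrite ln layer_ge0.
exact: mulr0.
Qed.

Lemma layer_massS n : layer_mass U n.+1 = layer_mass U n + n.+1%:R * layer n.
Proof. by rewrite /layer_mass big_ord_recr. Qed.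

Lemma layer_mass_ge0 n : 0 <= layer_mass U n.
Proof. by apply: sumr_ge0 => k _; rewrite mulr_ge0 // layer_ge0. Qed.

(** [riccati_step] is summed over the layers, with [tau] as torsion and [layer_mass] as mass. The
    volumes [V] are specified on layers of positive thickness only; the other summands vanish. *)
Lemma layers_riccati (xs s : R) : 0 < xs -> (forall x : R, 0 <= x < xs -> 0 < bessel d x) ->
    bessel d xs = 0 -> 0 < s -> rtors d s = tau N ->
  exists V : nat -> R,
    (forall k, (k < N)%N -> 0 < layer k -> exists2 r, 0 < r & rtors d r = tau k.+1 /\ V k = rvol d r) /\
    \sum_(k < N) xs / s ^+ 2 * (layer_mass U k.+1 ^+ 2 - layer_mass U k ^+ 2) / V k <= energy X u.
Proof.
move=> xs0 bpos bxs s0 es; have d0 : (0 < d)%N by exact: leq_trans hd.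
have /choice[rad hrad] : forall t : R, exists r : R, 0 < t -> 0 < r /\ rtors d r = t.
  move=> t; have [t0|t0] := ltP 0 t; last by exists 0.
  by have [r r0 e] := rtors_onto d hd t t0; exists r => _.
have s20 : 0 < s ^+ 2 by rewrite exprn_gt0.
pose lam := xs / s ^+ 2; have lam0 : 0 < lam by exact: divr_gt0.
have lams : lam * s ^+ 2 = xs by rewrite divfK // lt0r_neq0.
have radmono t1 t2 : 0 < t1 -> t1 < t2 -> rad t1 < rad t2.
  move=> h1 h12; have [r1 e1] := hrad _ h1; have [r2 e2] := hrad _ (lt_trans h1 h12).
  have [//|h|e] := ltgtP (rad t1) (rad t2).
    by have := rtors_lt d d0 _ _ (ltW r2) h; rewrite e1 e2 ltNge (ltW h12).
  by move: h12; rewrite -e1 -e2 e ltxx.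
have tN : 0 < tau N.
  by rewrite -es; apply: le_lt_trans (rtors_lt d d0 0 s (lexx _) s0); rewrite /rtors exprS mul0r mulr0 mul0r.
have rs : rad (tau N) = s.
  have [r1 e1] := hrad _ tN; have [h|h|//] := ltgtP (rad (tau N)) s.
    by have := rtors_lt d d0 _ _ (ltW r1) h; rewrite e1 es ltxx.
  by have := rtors_lt d d0 _ _ (ltW s0) h; rewrite e1 es ltxx.
have rx n : (n <= N)%N -> 0 < tau n -> lam * rad (tau n) ^+ 2 <= xs.
  move=> nN tn; rewrite -lams ler_wpM2l ?(ltW lam0) // lerXn2r ?nnegrE ?(ltW s0) //.
    by apply: ltW; case: (hrad _ tn).
  rewrite -rs; have := tau_le _ _ nN; rewrite le_eqVlt => /predU1P[->//|h].
  by rewrite ltW // radmono.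
pose P := layer_mass U.
pose V k := rvol d (rad (tau k.+1)).
(* [rnu] is singular at zero torsion, but there the mass vanishes too. At the last level [Q] is 0
   because [lam * s^2] is the zero [xs]. *)
pose Q n := if 0 < tau n then rnu d lam (rad (tau n)) * P n ^+ 2 else 0.
have step n : (n < N)%N -> Q n.+1 - Q n <= layer n * flux n - lam * (P n.+1 ^+ 2 - P n ^+ 2) / V n.
  move=> nN; have [lp|ln] := ltP 0 (layer n); last first.
    have l00 : layer n = 0 by apply: le_anti; rewrite ln layer_ge0.
    by rewrite /Q /P tauS layer_massS l00 !(mulr0, addr0, subrr, mul0r).
  have fp := flux_gt0 n nN lp; have fn := lt0r_neq0 fp; have lnz := lt0r_neq0 lp.
  have n0 : (n.+1%:R : R) != 0 by [].
  have np : 0 < n.+1%:R :> R by [].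
  have Dp : 0 < n.+1%:R * (n.+1%:R / flux n * layer n) by apply: mulr_gt0 => //; apply: mulr_gt0 => //; apply: divr_gt0.
  have tlt : tau n < tau n.+1 by rewrite tauS ltrDl.
  have t0 := tau_ge0 n; have t1 : 0 < tau n.+1 by exact: le_lt_trans tlt.
  have [r1 e1] := hrad _ t1; rewrite /Q t1.
  (* The stretching was chosen for this: squared mass increment over torsion increment is exactly
     the energy of the layer. *)
  have ef D : D = n.+1%:R * (n.+1%:R / flux n * layer n) -> (n.+1%:R * layer n) ^+ 2 / D = layer n * flux n.
    by move=> ->; move: (n.+1%:R : R) n0 => a a0; field; rewrite a0 lnz fn.
  have [tp|tn] := ltP 0 (tau n).
    have [r2 e2] := hrad _ tp.
    have := riccati_step d xs lam d0 bpos lam0 _ _ (P n) (P n.+1) r2 (radmono _ _ tp tlt) (rx _ nN t1) (layer_mass_ge0 n).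
    rewrite e1 e2 -(ef (tau n.+1 - tau n)); last by rewrite tauS addrC addKr.
    have dP : P n.+1 - P n = n.+1%:R * layer n by rewrite /P layer_massS addrC addKr.
    rewrite dP; apply; rewrite -subr_ge0 dP.
    exact: ltW (mulr_gt0 np lp).
  have tz : tau n = 0 by apply: le_anti; rewrite tn t0.
  have Pz : P n = 0 by apply: layer_mass0; [exact: ltnW | ].
  have := rnu_first d xs lam d0 bpos lam0 _ (P n.+1) r1 (rx _ nN t1).
  by rewrite e1 Pz expr0n /= !subr0 {2}/P layer_massS -/(P n) Pz add0r ef // tauS tz add0r.
exists V; split.
  move=> k kN lk; have tp : 0 < tau k.+1.
    have fp := flux_gt0 k kN lk; rewrite tauS; apply: ltr_wpDl (tau_ge0 k) _.
    by apply: mulr_gt0 => //; apply: mulr_gt0 => //; apply: divr_gt0.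
  by have [r0 e] := hrad _ tp; exists (rad (tau k.+1)).
have sumQ n : (n <= N)%N -> Q n <= \sum_(k < n) (layer k * flux k - lam * (P k.+1 ^+ 2 - P k ^+ 2) / V k).
  elim: n => [|n IH] nN; first by rewrite /Q /tau !big_ord0 ltxx.
  by rewrite big_ord_recr /=; have := step n nN; have := IH (ltnW nN); lra.
have := sumQ N (leqnn _); rewrite sumrB -energy_layers.
rewrite {1}/Q tN rs /rnu lams bxs !mul0r subr_ge0.
by [].
Qed.

(** The means decrease with the rank, so on an edge crossing level [k] the mean is at most its value
    at the inner endpoint. Cauchy-Schwarz against the gradient and Hardy's inequality for the means
    conclude, whatever the size of the single level boundaries. *)
Lemma layers_boundary :
  \sum_(k < N) layer k * entries_tot (superlevel X rk k) * mean_upto U k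
    <= 4 * d%:R * Num.sqrt (energy X u * \sum_(x <- X) u x ^+ 2).
Proof.
set L := \sum_(x <- X) _; set A := mean_upto U.
have A0 k : 0 <= A k by rewrite divr_ge0 ?sumr_ge0 // => i _; case: (Umon i).
pose B x := (x \in X)%:R * A (rk x); have B0 x : 0 <= B x by rewrite mulr_ge0.
have Bout x : x \notin X -> B x = 0 by move=> /negPf h; rewrite /B h mul0r.
have Ble x k : (rk x <= k)%N -> (k < N)%N -> A k <= B x.
  move=> h kN; rewrite /B; case: (rkX x) => -> _; rewrite (leq_ltn_trans h kN) mul1r.
  by apply: mean_upto_decr => // i; case: (Umon i).
have B2 : \sum_(x <- X) B x ^+ 2 <= 4 * L.
  have -> : \sum_(x <- X) B x ^+ 2 = \sum_(k < N) A k ^+ 2.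
    rewrite -(rksum (fun k => A k ^+ 2)); apply: eq_sum_fset => x xX.
    by rewrite /B xX mul1r.
  have -> : L = \sum_(k < N) U k ^+ 2.
    by rewrite -(rksum (fun k => U k ^+ 2)); apply: eq_bigr => x _; rewrite Urk.
  exact: hardy_means.
apply: le_trans (_ : edges (fun j y => `|grad j u y| * (B y + B (y + ev j))) <= _).
  apply: le_trans (_ : \sum_(k < N) (layer k * A k) * edges (fun j y => sep rk k y (y + ev j)) <= _).
    apply: ler_sum => k _; rewrite mulrAC; apply: (ler_wpM2l (mulr_ge0 (layer_ge0 k) (A0 k))).
    exact: (entries_superlevel X rk rkX k (ltn_ord k)).
  rewrite -(edges_sum (fun k j y => sep rk k y (y + ev j)) (fun k => layer k * A k)).
  apply: edges_le => j y; rewrite norm_grad_layers mulr_suml; apply: ler_sum => k _.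
  rewrite mulrC -mulrA; rewrite {1 2}/sep; case: eqP => [_|/eqP ne]; first by rewrite !mul0r.
  rewrite !mul1r ler_wpM2l ?layer_ge0 //.
  have h0 := B0 y; have h1 := B0 (y + ev j).
  have [h|h] := leqP (rk y) k; first by have := Ble _ _ h (ltn_ord k); lra.
  have h' : (rk (y + ev j)%R <= k)%N.
    by move: ne; rewrite leqNgt h /=; case: leqP.
  by have := Ble _ _ h' (ltn_ord k); lra.
have E0 : 0 <= energy X u by apply: sumr_ge0 => j _; apply: sumr_ge0 => y _; exact: sqr_ge0.
have L0 : 0 <= L by apply: sumr_ge0 => x _; exact: sqr_ge0.
have per j : \sum_(y <- edom X j) `|grad j u y| * (B y + B (y + ev j)) <= 4 * Num.sqrt (energy X u * L).
  have e4 : 4 * Num.sqrt (energy X u * L) = Num.sqrt (4 ^+ 2 * (energy X u * L)).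
    by rewrite [RHS]sqrtrM ?sqr_ge0 // sqrtr_sqr ger0_norm.
  rewrite e4; apply: le_trans (ler_norm _) _; rewrite -sqrtr_sqr ler_wsqrtr //.
  apply: le_trans (cauchy_schwarz_fset _ _ _) _.
  have -> : 4 ^+ 2 * (energy X u * L) = energy X u * (16 * L) by ring.
  apply: ler_pM.
  - by apply: sumr_ge0 => y _; exact: sqr_ge0.
  - by apply: sumr_ge0 => y _; exact: sqr_ge0.
  - rewrite /energy (bigD1 j) //= (eq_bigr (fun y => grad j u y ^+ 2)); last by move=> y _; exact: sqr_normr.
    rewrite lerDl; apply: sumr_ge0 => i _; apply: sumr_ge0 => y _; exact: sqr_ge0.
  apply: le_trans (_ : \sum_(y <- edom X j) (2 * B y ^+ 2 + 2 * B (y + ev j) ^+ 2) <= _).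
    by apply: ler_sum => y _; have := sqr_ge0 (B y - B (y + ev j)); rewrite sqrrB sqrrD; lra.
  rewrite big_split /= -!mulr_sumr (sum_edom_l X j (fun y => B y ^+ 2)); last first.
    by move=> x /Bout ->; rewrite expr0n.
  rewrite (sum_edom_r X j (fun y => B y ^+ 2)); last by move=> x /Bout ->; rewrite expr0n.
  lra.
apply: le_trans (ler_sum _ (fun j _ => per j)) _.
by rewrite sumr_const card_ord -mulr_natl; lra.
Qed.

End Layers.

Section KohlerJobinMain.
Context {R : realType}.
Variable d : nat.
Hypothesis hd : (2 <= d)%N.

Lemma layer_mass_mean (U : nat -> R) k : (forall i, 0 <= U i) ->
  layer_mass U k.+1 + layer_mass U k <= 2 * k.+1%:R * mean_upto U k.
Proof.
move=> U0; rewrite /mean_upto -mulrA [k.+1%:R * _]mulrC divfK // !layer_massE big_ord_recr /=.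
have := mulr_ge0 (ler0n R k.+1) (U0 k.+1); have := mulr_ge0 (ler0n R k) (U0 k).
by have := U0 k; lra.
Qed.

(** In [layers_riccati] each [V k] is replaced by the true cardinality [k + 1], which turns the left
    side into [lam * \sum u^2]. By [volume_defect] the error is made of the terms in
    [layers_boundary]. *)
Lemma kohler_jobin (X : {fset pt d}) (u : pt d -> R) (xs : R) : 0 < xs ->
    (forall x : R, 0 <= x < xs -> 0 < bessel d x) -> bessel d xs = 0 ->
    (forall x, x \notin X -> u x = 0) -> (forall x, 0 <= u x) -> 0 < \sum_(x <- X) u x ^+ 2 ->
  exists (w : pt d -> R) (s : R),
  [/\ (forall x, x \notin X -> w x = 0) /\ (forall x, 0 <= w x), 0 < s,
      rtors d s = \sum_(x <- X) w x, energy X w <= \sum_(x <- X) w x &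
      xs / s ^+ 2 * (\sum_(x <- X) u x ^+ 2) <= energy X u
        + xs / s ^+ 2 * (72 * d%:R / cdim d * Num.sqrt (energy X u * \sum_(x <- X) u x ^+ 2))].
Proof.
move=> xs0 bpos bxs u0 uge L0.
have [rk [U [Urk rkX rksum Umon UN]]] := decreasing_rank X u u0 uge.
have bdr := layers_boundary X u rk U Urk rkX rksum Umon UN.
have fr := layers_riccati X u rk U hd Urk rkX rksum Umon UN xs.
set L := \sum_(x <- X) u x ^+ 2 in L0 bdr *; set N := #|` X| in rkX rksum UN fr bdr *.
have LE : L = \sum_(k < N) layer U k * (layer_mass U k.+1 + layer_mass U k).
  rewrite -sum_sqr_layers // -(rksum (fun k => U k ^+ 2)).
  by apply: eq_bigr => x _; rewrite Urk.
have l0 := layer_ge0 U Umon.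
have tN : 0 < tau X u rk U N.
  rewrite lt_neqAle tau_ge0 // andbT eq_sym; apply/eqP => t0.
  move: L0; rewrite LE big1 ?ltxx // => k _.
  have tk n : (n <= N)%N -> layer_mass U n = 0.
    move=> nN; apply: (layer_mass0 X u rk U hd) => //; apply: le_anti.
    by rewrite tau_ge0 // -t0 tau_le.
  by rewrite !tk ?addr0 ?mulr0 //; exact: ltnW.
have [s s0 es] := rtors_onto d hd _ tN.
have [V [hV ric]] := fr s xs0 bpos bxs s0 es.
exists (test_torsion X u rk U N), s; split => //.
- split=> [x|x]; first exact: lev_out.
  by apply: lev_ge0 => k; exact: stretched_ge0.
- by rewrite es (sum_test_torsion X u rk U) .
- rewrite (sum_test_torsion X u rk U) //; exact: energy_test_torsion.
set lam := xs / s ^+ 2 in ric *; have lam0 : 0 < lam by rewrite divr_gt0 // exprn_gt0.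
clearbody lam.
pose b k := entries_tot (superlevel X rk k) : R.
have c0 : 0 < cdim d :> R by exact: cdim_gt0.
(* [18] is the 9 of [volume_defect] times the 2 of [layer_mass_mean]; the 4 of [layers_boundary]
   makes it 72. *)
have term (k : 'I_N) : lam * (layer U k * (layer_mass U k.+1 + layer_mass U k)) <=
    lam * (layer_mass U k.+1 ^+ 2 - layer_mass U k ^+ 2) / V k + lam * (18 / cdim d) * (layer U k * b k * mean_upto U k).
  have [lp|ln] := ltP 0 (layer U k); last first.
    have l00 : layer U k = 0 by apply: le_anti; rewrite ln l0.
    by rewrite layer_massS l00 !(mulr0, mul0r, addr0, subrr).
  have [r r0 [er ->]] := hV k (ltn_ord k) lp.
  have [q [q0 vq hq]] := torsion_superlevel X u rk U hd Urk rkX rksum Umon UN k (ltn_ord k).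
  have vd := volume_defect d hd k.+1 (b k) q r _ isT (entries_tot_ge0 _) q0 r0 vq er hq.
  set p := layer_mass U k.+1 + layer_mass U k.
  have p0 : 0 <= p by rewrite addr_ge0 // layer_mass_ge0.
  have pm : p <= 2 * k.+1%:R * mean_upto U k by apply: layer_mass_mean => i; case: (Umon i).
  have -> : layer_mass U k.+1 ^+ 2 - layer_mass U k ^+ 2 = k.+1%:R * layer U k * p.
    by rewrite subr_sqr {1}layer_massS addrC addKr.
  have ap : 0 < k.+1%:R :> R by [].
  have bp : 0 <= b k by exact: entries_tot_ge0.
  move: (k.+1%:R : R) (rvol d r)^-1 (layer U k) (mean_upto U k) (b k) p0 pm lp vd ap bp.
  move=> a v l A e p0 pm lp vd ap bp; have an := lt0r_neq0 ap; have cn := lt0r_neq0 c0.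
  have h1 : lam * l * p * a * (a^-1 - v) <= lam * l * p * a * (9 / cdim d * e / a ^+ 2).
    by apply: ler_wpM2l vd; do !apply: mulr_ge0 => //; exact: ltW.
  have h2 : lam * l * p * a * (9 / cdim d * e / a ^+ 2) = lam * l * (9 / cdim d) * e * (p / a).
    by move: (cdim d) cn => c cn; field; rewrite an cn.
  have h3 : lam * l * (9 / cdim d) * e * (p / a) <= lam * l * (9 / cdim d) * e * (2 * A).
    apply: ler_wpM2l; last by rewrite ler_pdivrMr // mulrAC.
    by do !apply: mulr_ge0 => //; rewrite ?invr_ge0; exact: ltW.
  have -> : lam * (l * p) = lam * l * p * a * (a^-1 - v) + lam * (a * l * p) * v by field.
  have -> : lam * (18 / cdim d) * (l * e * A) = lam * l * (9 / cdim d) * e * (2 * A).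
    by move: (cdim d) cn => c cn; field.
  by rewrite h2 in h1; lra.
rewrite {1}LE mulr_sumr; apply: le_trans (ler_sum _ (fun k _ => term k)) _.
rewrite big_split /= -mulr_sumr; apply: lerD ric _; rewrite -mulrA ler_wpM2l ?(ltW lam0) //.
have c18 : 0 <= 18 / cdim d :> R by rewrite divr_ge0 // ltW.
apply: le_trans (ler_wpM2l c18 bdr) _; rewrite le_eqVlt; apply/orP; left; apply/eqP.
by move: (Num.sqrt _) => q; have := lt0r_neq0 c0; move: (cdim d) => c cn; field.
Qed.
End KohlerJobinMain.

(** * Upper bound for the eigenvalue *)

Section RadialTest.
Context {R : realType}.

Lemma second_difference (g g1 g2 g3 : R -> R) (M : R) :
  (forall t, is_derive t (1:R) g (g1 t)) -> (forall t, is_derive t (1:R) g1 (g2 t)) ->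
  (forall t, is_derive t (1:R) g2 (g3 t)) -> (forall t, -1 <= t <= 1 -> `|g3 t| <= M) ->
  2 * g 0 - g 1 - g (-1) <= - g2 0 + 2 * M.
Proof.
move=> d1 d2 d3 hM.
have neg (f f' : R -> R) : (forall t, is_derive t (1:R) f (f' t)) -> forall t, is_derive t (1:R) (fun s => f (- s)) (- f' (- t)).
  move=> df t; apply: is_derive_congr (is_derive_chain _ _ _ _ _ (is_derive_opp _ _ _ (is_derive_id t 1)) (df (- t))) _.
  by rewrite mulrN1.
have sq t : is_derive t (1:R) (fun s => s ^+ 2 * g2 0) (2 * t * g2 0).
  apply: is_derive_congr (is_derive_mulconst _ _ _ _ (is_derive_exp id 1 _ _ (is_derive_id t 1))) _.
  by rewrite /= expr1 mulr1.
have h1 t : is_derive t (1:R) (fun s => g s + g (- s) - s ^+ 2 * g2 0) (g1 t - g1 (- t) - 2 * t * g2 0).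
  exact: is_derive_add (is_derive_add _ _ _ _ _ (d1 t) (neg _ _ d1 t)) (is_derive_opp _ _ _ (sq t)).
have lin t : is_derive t (1:R) (fun s => 2 * s * g2 0) (2 * g2 0).
  apply: is_derive_congr (is_derive_mulconst _ _ _ _ (is_derive_constmul _ _ _ _ (is_derive_id t 1))) _.
  by rewrite mulr1.
have h2 t : is_derive t (1:R) (fun s => g1 s - g1 (- s) - 2 * s * g2 0) (g2 t + g2 (- t) - 2 * g2 0).
  apply: is_derive_congr (is_derive_add _ _ _ _ _ (is_derive_add _ _ _ _ _ (d2 t) (is_derive_opp _ _ _ (neg _ _ d2 t))) (is_derive_opp _ _ _ (lin t))) _.
  by rewrite opprK.
have [c /andP[c0 c1] e1] := mean_value _ _ _ _ (ltr01 : (0:R) < 1) (fun t _ => h1 t).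
have [b /andP[b0 b1] e2] := mean_value _ _ _ _ c0 (fun t _ => h2 t).
have bb : - b < b by lra.
have [a /andP[a0 a1] e3] := mean_value _ _ _ _ b0 (fun t _ => d3 t).
have nb : - b < 0 by lra.
have [a' /andP[a0' a1'] e4] := mean_value _ _ _ _ nb (fun t _ => d3 t).
have Ma : `|g3 a| <= M by apply: hM; apply/andP; split; lra.
have Ma' : `|g3 a'| <= M by apply: hM; apply/andP; split; lra.
move: Ma Ma'; rewrite !ler_norml => /andP[m1 m2] /andP[m3 m4].
move: e1 e2; rewrite !(oppr0, addr0, subrr, mulr1, mulr0, mul0r, expr0n, expr1n, mul1r) /= => e1 e2.
have e5 : g2 b + g2 (- b) - 2 * g2 0 = b * (g3 a - g3 a') by lra.
have M0 : 0 <= M by lra.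
have h5 : - (2 * M) <= b * c * (g3 a - g3 a').
  have bc0 : 0 <= b * c by rewrite mulr_ge0 // ltW.
  have bc1 : b * c <= 1 by apply: mulr_ile1; rewrite ?(ltW b0) ?(ltW c0) ?(ltW c1) //; exact: ltW (lt_trans b1 c1).
  have : b * c * (- (2 * M)) <= b * c * (g3 a - g3 a') by rewrite ler_wpM2l //; lra.
  apply: le_trans; rewrite mulrN lerN2 ler_piMl //; lra.
rewrite e5 in e2; move: h5; have -> : b * c * (g3 a - g3 a') = b * (g3 a - g3 a') * c by ring.
by rewrite -e2 -e1; lra.
Qed.

Variable d : nat.
Hypothesis d0 : (0 < d)%N.

Let dn : (d%:R : R) != 0. Proof. by rewrite pnatr_eq0 -lt0n. Qed.

(** Along an axis the squared norm is [S + 2 a t + t^2], so the radial function is composed with a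
    quadratic. The constants come from the third derivative and [|a + t| <= 2 * rho]. *)
Lemma radial_second_difference (c a S rho M Y : R) :
  (forall y, 0 <= y <= Y -> `|bessel d.+4 y| <= M /\ `|bessel d.+4.+2 y| <= M) ->
  0 <= c -> 1 <= rho -> a ^+ 2 <= S -> S <= rho ^+ 2 -> 4 * c * rho ^+ 2 <= Y ->
  2 * bessel d (c * S) - bessel d (c * (S + 2 * a + 1)) - bessel d (c * (S - 2 * a + 1)) <=
  c / d%:R * bessel d.+2 (c * S) - c ^+ 2 * a ^+ 2 / (d%:R * d.+2%:R) * bessel d.+4 (c * S)
    + 2 * ((6 * c ^+ 2 * rho + 8 * c ^+ 3 * rho ^+ 3) * M).
Proof.
move=> hM c0 rho1 aS Sr cY.
pose y t := c * (S + 2 * a * t + t ^+ 2).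
have d2n : (d.+2%:R : R) != 0 by []. have d4n : (d.+4%:R : R) != 0 by [].
have dy t : is_derive t (1:R) y (2 * c * (a + t)).
  have dl : is_derive t (1:R) (fun s => S + 2 * a * s) (2 * a).
    apply: is_derive_congr (is_derive_add _ _ _ _ _ (is_derive_cst S t 1) (is_derive_constmul _ (2 * a) _ _ (is_derive_id t 1))) _.
    by rewrite add0r mulr1.
  apply: is_derive_congr (is_derive_constmul _ c _ _ (is_derive_add _ _ _ _ _ dl (is_derive_exp id 1 _ _ (is_derive_id t 1)))) _.
  by rewrite /= expr1; ring.
have db n t : (0 < n)%N -> is_derive t (1:R) (fun s => bessel n (y s)) (- (c * (a + t) / n%:R) * bessel n.+2 (y t)).
  move=> n0; apply: is_derive_congr (is_derive_chain _ _ _ _ _ (dy t) (is_derive_bessel n (y t) n0)) _.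
  have : (n%:R : R) != 0 by rewrite pnatr_eq0 -lt0n.
  by move: (n%:R : R) (bessel n.+2 (y t)) => m B m0; field.
have dat t : is_derive t (1:R) (fun s => a + s) 1.
  apply: is_derive_congr (is_derive_add _ _ _ _ _ (is_derive_cst a t 1) (is_derive_id t 1)) _.
  by rewrite add0r.
pose g1 t := - (c / d%:R) * ((a + t) * bessel d.+2 (y t)).
pose g2 t := - (c / d%:R) * (bessel d.+2 (y t) - (c / d.+2%:R) * ((a + t) ^+ 2 * bessel d.+4 (y t))).
pose g3 t := 3 * c ^+ 2 / (d%:R * d.+2%:R) * ((a + t) * bessel d.+4 (y t))
   - c ^+ 3 / (d%:R * d.+2%:R * d.+4%:R) * ((a + t) ^+ 3 * bessel d.+4.+2 (y t)).
have k1 t : is_derive t (1:R) (fun s => bessel d (y s)) (g1 t).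
  by apply: is_derive_congr (db d t d0) _; rewrite /g1; move: (bessel _ _) (d%:R : R) dn => B b b0; field.
have k2 t : is_derive t (1:R) g1 (g2 t).
  apply: is_derive_congr (is_derive_constmul _ (- (c / d%:R)) _ _ (is_derive_mul _ _ _ _ _ (dat t) (db d.+2 t isT))) _.
  rewrite /g2; move: (bessel d.+2 _) (bessel d.+4 _) (d%:R : R) (d.+2%:R : R) dn d2n => B B' b b' b0 b0'.
  by field; rewrite b0 b0'.
have k3 t : is_derive t (1:R) g2 (g3 t).
  apply: is_derive_congr (is_derive_constmul _ (- (c / d%:R)) _ _ (is_derive_add _ _ _ _ _ (db d.+2 t isT)
     (is_derive_opp _ _ _ (is_derive_constmul _ (c / d.+2%:R) _ _
       (is_derive_mul _ _ _ _ _ (is_derive_exp _ 1 _ _ (dat t)) (db d.+4 t isT)))))) _.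
  rewrite /g3; move: (bessel d.+4.+2 _) (bessel d.+4 _) (d%:R : R) (d.+2%:R : R) (d.+4%:R : R) dn d2n d4n => B B' b b' b'' b0 b0' b0''.
  by field; rewrite b0 b0' b0''.
have bound t : -1 <= t <= 1 -> `|g3 t| <= (6 * c ^+ 2 * rho + 8 * c ^+ 3 * rho ^+ 3) * M.
  move=> ht; have ht2 : t ^+ 2 <= 1 by case/andP: ht => h h'; rewrite -sqr_normr expr_le1 // ler_norml h h'.
  have rho0 : 0 <= rho by lra.
  have a_rho : `|a| <= rho.
    by rewrite -(ler_pXn2r (n := 2)) ?nnegrE // sqr_normr; lra.
  have at2 : `|a + t| <= 2 * rho.
    have tn : `|t| <= 1 by rewrite ler_norml.
    by apply: le_trans (ler_normD _ _) _; lra.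
  have yin : 0 <= y t <= Y.
    apply/andP; split; first by apply: mulr_ge0 => //; have := sqr_ge0 (a + t); rewrite sqrrD; lra.
    apply: le_trans cY; rewrite /y; have -> : 4 * c * rho ^+ 2 = c * (4 * rho ^+ 2) by ring.
    apply: ler_wpM2l => //.
    have h1 : a * t <= rho.
      apply: le_trans (ler_norm _) _; rewrite normrM -[leRHS]mulr1; apply: ler_pM => //.
      by rewrite ler_norml.
    have h2 : rho <= rho ^+ 2 by rewrite expr2 ler_peMr.
    by lra.
  have [b4 b6] := hM _ yin.
  have w1 (k : nat) z : `|bessel k (y t)| <= M -> 0 <= z -> `|z * ((a + t) * bessel k (y t))| <= z * (2 * rho * M).
    by move=> hb z0; rewrite !normrM (ger0_norm z0); apply: ler_wpM2l => //; apply: ler_pM.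
  have w3 z : 0 <= z -> `|z * ((a + t) ^+ 3 * bessel d.+4.+2 (y t))| <= z * ((2 * rho) ^+ 3 * M).
    move=> z0; rewrite normrM (ger0_norm z0) normrM; apply: ler_wpM2l => //; apply: ler_pM => //.
    by rewrite normrX lerXn2r // nnegrE // mulr_ge0.
  have M0 : 0 <= M by apply: le_trans b4.
  have i1 : 0 <= 3 * c ^+ 2 / (d%:R * d.+2%:R) <= 3 * c ^+ 2.
    rewrite divr_ge0 ?mulr_ge0 ?sqr_ge0 //= ler_pdivrMr ?mulr_gt0 ?ltr0n // ler_peMr ?mulr_ge0 ?sqr_ge0 //.
    by rewrite -natrM ler1n muln_gt0 d0.
  have i2 : 0 <= c ^+ 3 / (d%:R * d.+2%:R * d.+4%:R) <= c ^+ 3.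
    rewrite divr_ge0 ?mulr_ge0 ?exprn_ge0 //= ler_pdivrMr ?mulr_gt0 ?ltr0n // ler_peMr ?exprn_ge0 //.
    by rewrite -!natrM ler1n !muln_gt0 d0.
  case/andP: i1 => i1 i1'; case/andP: i2 => i2 i2'.
  apply: le_trans (ler_normB _ _) _; rewrite [leRHS]mulrDl; apply: lerD.
    apply: le_trans (w1 _ _ b4 i1) _.
    have -> : 6 * c ^+ 2 * rho * M = 3 * c ^+ 2 * (2 * rho * M) by ring.
    by rewrite ler_wpM2r // !mulr_ge0.
  apply: le_trans (w3 _ i2) _.
  have -> : 8 * c ^+ 3 * rho ^+ 3 * M = c ^+ 3 * ((2 * rho) ^+ 3 * M) by ring.
  by rewrite ler_wpM2r // mulr_ge0 // exprn_ge0 // mulr_ge0.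
have := second_difference _ _ _ _ _ k1 k2 k3 bound; rewrite /g2.
have -> : y 0 = c * S by rewrite /y; ring.
have -> : y 1 = c * (S + 2 * a + 1) by rewrite /y; ring.
have -> : y (-1) = c * (S - 2 * a + 1) by rewrite /y; ring.
rewrite addr0; move/le_trans; apply; rewrite lerD2r le_eqVlt; apply/orP; left; apply/eqP.
move: (bessel d.+2 _) (bessel d.+4 _) (d%:R : R) (d.+2%:R : R) dn d2n => B B' b b' b0 b0'.
by field; rewrite b0 b0'.
Qed.

End RadialTest.

Section Trial.
Context {R : realType}.
Variables (d : nat) (xs : R).
Hypothesis d0 : (0 < d)%N.
Hypothesis xs0 : 0 < xs.
Hypothesis bpos : forall x : R, 0 <= x < xs -> 0 < bessel d x.
Hypothesis bxs : bessel d xs = 0.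

(** Needed at neighbours just outside the ball: there the trial function is 0 and must not lie below
    the radial function, if second differences are to be compared. *)
Lemma bessel_past_zero : exists2 e : R, 0 < e & forall y, xs <= y <= xs + e -> bessel d y <= 0.
Proof.
have b2 : 0 < bessel d.+2 xs by apply: (bessel_pos_shift d xs d0 bpos); rewrite lexx ltW.
have cont : {for xs, continuous (bessel d.+2 : R -> R)} by exact: is_derive_continuous (is_derive_bessel d.+2 xs isT).
have : \forall y \near xs, 0 < bessel d.+2 y by exact: (cvgr_gt (bessel d.+2 xs) cont).
move=> /nbhs_ballP[e /= e0 he]; exists (e / 2); first by rewrite divr_gt0.
move=> y /andP[y1 y2]; rewrite -bxs.
apply: (is_derive_le0_homo _ _ _ _ y1 (fun z _ => is_derive_bessel d z d0)) => z /andP[z1 z2].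
rewrite mulNr oppr_le0 mulr_ge0 ?invr_ge0 // ltW //; apply: he.
by rewrite /ball /= ltr_norml; apply/andP; split; lra.
Qed.

Lemma bessel_decr x y : 0 <= x -> x <= y -> y <= xs -> bessel d y <= bessel d x.
Proof.
move=> x0 xy yx; apply: (is_derive_le0_homo _ _ _ _ xy (fun z _ => is_derive_bessel d z d0)) => z /andP[z1 z2].
rewrite mulNr oppr_le0 mulr_ge0 ?invr_ge0 // ltW //; apply: (bessel_pos_shift d xs d0 bpos).
by apply/andP; split; [exact: le_trans z1 | exact: le_trans yx].
Qed.

(** In the ball of half radius the argument is at most [xs / 4], so [u >= m] there. This ball holds
    about the fraction [q = 2^-d] of the points, and [R0] makes the counting error at most half of
    that. *)
Lemma trial_mass_le : exists C R0 : R, [/\ 0 < C, 1 <= R0 & forall rho (u : pt d -> R), R0 <= rho ->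
  (forall x, x \in lball (rho ^+ 2) -> u x = bessel d (xs / rho ^+ 2 * (sqnorm x)%:~R)) ->
  0 < \sum_(x <- lball (rho ^+ 2)) u x ^+ 2 /\
  (#|` lball (rho ^+ 2) : {fset pt d} |%:R <= C * \sum_(x <- lball (rho ^+ 2)) u x ^+ 2)].
Proof.
have [C1 C10 hC] := @lball_card R d.
have x4 : 0 <= xs / 4 < xs by rewrite divr_ge0 ?(ltW xs0) //= ltr_pdivrMr // ltr_pMr // ltr1n.
pose m := bessel d (xs / 4); have m0 : 0 < m by exact: bpos.
have w0 := omega_gt0 d : 0 < omega R d.
pose q : R := 2^-1 ^+ d; have q0 : 0 < q by rewrite exprn_gt0.
exists (2 * (1 + C1) / (q * m ^+ 2)), (1 + 2 * C1 / q).
have C2 : 0 < 2 * (1 + C1) / (q * m ^+ 2) by apply: divr_gt0; apply: mulr_gt0; rewrite ?exprn_gt0 //; lra.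
have C3 : 0 <= 2 * C1 / q by apply: divr_ge0; [lra | exact: ltW].
split=> //; first by lra.
move=> rho u hr hu; have rho1 : 1 <= rho by lra.
have rho0 : 0 < rho by lra.
have W0 : 0 < omega R d * rho ^+ d by rewrite mulr_gt0 ?exprn_gt0.
set W := omega R d * rho ^+ d in W0 hC *.
have hq : Num.sqrt (2^-1 ^+ 2) = 2^-1 :> R by rewrite sqrtr_sqr ger0_norm ?invr_ge0.
have h4 : 0 <= (2^-1 : R) ^+ 2 <= 1 by apply/andP; split; [exact: sqr_ge0 | apply: exprn_ile1; lra].
have := hC rho (2^-1 ^+ 2) rho1 h4; rewrite -/W hq -/q => h1.
have h5 : 0 <= (1 : R) <= 1 by rewrite ler01 lexx.
have := hC rho 1 rho1 h5; rewrite -/W sqrtr1 expr1n !mulr1 => h2.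
have cr : C1 * (W / rho) <= W * q / 2.
  rewrite mulrCA -mulrA ler_wpM2l ?(ltW W0) // ler_pdivrMr //.
  have : 2 * C1 / q <= rho by lra.
  by rewrite ler_pdivrMr //; lra.
have cr2 : C1 * (W / rho) <= C1 * W.
  by rewrite ler_wpM2l ?(ltW C10) // ler_pdivrMr // ler_peMr // ltW.
set Y := lball (rho ^+ 2) in hu *; set Z := lball (rho ^+ 2 * 2^-1 ^+ 2) : {fset pt d} in h1.
have lowZ : W * q / 2 <= #|` Z|%:R by move: h1; rewrite ler_norml => /andP[]; lra.
have upY : #|` Y|%:R <= (1 + C1) * W by move: h2; rewrite ler_norml => /andP[]; lra.
have ZY : {subset Z <= Y}.
  move=> x; rewrite !in_lball => /le_trans; apply.
  by rewrite ler_piMr ?sqr_ge0 //; case/andP: h4.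
have uZ x : x \in Z -> m ^+ 2 <= u x ^+ 2.
  move=> xZ; rewrite hu ?ZY //; have yb : xs / rho ^+ 2 * (sqnorm x)%:~R <= xs / 4.
    move: xZ; rewrite in_lball => h; rewrite -mulrA ler_wpM2l ?(ltW xs0) //.
    by rewrite ler_pdivrMl ?exprn_gt0 //; apply: le_trans h _; rewrite ler_wpM2l ?sqr_ge0 //; lra.
  rewrite lerXn2r ?nnegrE ?(ltW m0) //; last first.
    by apply: bessel_decr => //; [rewrite mulr_ge0 ?divr_ge0 ?sqr_ge0 ?(ltW xs0) // ler0z sqnorm_ge0 | lra].
  apply: le_trans (ltW m0) _; apply: bessel_decr => //; last by lra.
  by rewrite mulr_ge0 ?divr_ge0 ?sqr_ge0 ?(ltW xs0) // ler0z sqnorm_ge0.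
have lowS : W * q / 2 * m ^+ 2 <= \sum_(x <- Y) u x ^+ 2.
  apply: le_trans (_ : \sum_(x <- Z) u x ^+ 2 <= _); last first.
    by apply: ler_sum_fset_incl => // x _ _; exact: sqr_ge0.
  apply: le_trans (_ : #|` Z|%:R * m ^+ 2 <= _); first by rewrite ler_wpM2r ?sqr_ge0.
  by rewrite -sumr_fset_const; exact: ler_sum_fset.
split; first by apply: lt_le_trans lowS; rewrite !mulr_gt0 ?exprn_gt0.
apply: le_trans upY _; have := ler_wpM2l (ltW C2) lowS; apply: le_trans.
rewrite le_eqVlt; apply/orP; left; apply/eqP.
have qn := lt0r_neq0 q0; have mn := lt0r_neq0 m0; clear -qn mn; clearbody q m.
by field; rewrite ?qn ?mn.
Qed.

(** Summing the second differences, [bessel_rec] makes the main terms exactly [c * u]. The remainder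
    costs [K / rho^3] per point since [u <= 1], and [trial_mass_le] converts points into mass. *)
Lemma trial_energy : exists C R0 : R, [/\ 0 < C, 1 <= R0 & forall rho, R0 <= rho ->
  exists u : pt d -> R, [/\ forall x, x \notin lball (rho ^+ 2) -> u x = 0,
    0 < \sum_(x <- lball (rho ^+ 2)) u x ^+ 2 &
    energy (lball (rho ^+ 2)) u <= (xs / rho ^+ 2 + C / rho ^+ 3) * \sum_(x <- lball (rho ^+ 2)) u x ^+ 2]].
Proof.
have [Cm [R1 [Cm0 R11 mass]]] := trial_mass_le.
have [e e0 neg] := bessel_past_zero.
have X0 : 0 <= 4 * xs by rewrite mulr_ge0 // ltW.
have [M4 M40 hM4] := bessel_bounded d.+4 (4 * xs) isT X0.
have [M6 M60 hM6] := bessel_bounded d.+4.+2 (4 * xs) isT X0.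
pose M := M4 + M6.
have hM y : 0 <= y <= 4 * xs -> `|bessel d.+4 y| <= M /\ `|bessel d.+4.+2 y| <= M.
  by move=> h; have := hM4 y h; have := hM6 y h; rewrite /M; split; lra.
pose K := d%:R * (2 * ((6 * xs ^+ 2 + 8 * xs ^+ 3) * M)).
have M0 : 0 < M by exact: addr_gt0.
have K0 : 0 < K by rewrite !mulr_gt0 ?ltr0n // addr_gt0 // mulr_gt0 ?exprn_gt0.
have E3 : 0 < 3 * xs / e by rewrite divr_gt0 // mulr_gt0.
exists (K * Cm), (R1 + 3 * xs / e); split; [exact: mulr_gt0 | lra |].
move=> rho hr; have rho1 : 1 <= rho by lra.
have rho0 : 0 < rho by lra. have rhoR : R1 <= rho by lra.
pose c := xs / rho ^+ 2; have c0 : 0 < c by rewrite divr_gt0 // exprn_gt0.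
have cr2 : c * rho ^+ 2 = xs by rewrite /c divfK // expf_neq0 // lt0r_neq0.
set Y := lball (rho ^+ 2) : {fset pt d}.
pose phi (x : pt d) := bessel d (c * (sqnorm x)%:~R).
pose u x := if x \in Y then phi x else 0.
have uY x : x \in Y -> u x = phi x by rewrite /u => ->.
have [S0 cardS] := mass rho u rhoR uY.
have arg x : x \in Y -> 0 <= c * (sqnorm x)%:~R <= xs.
  rewrite in_lball => h; apply/andP; split; first by rewrite mulr_ge0 ?(ltW c0) // ler0z sqnorm_ge0.
  by rewrite -cr2 ler_wpM2l // ltW.
have u01 x : x \in Y -> 0 <= u x <= 1.
  move=> xY; rewrite uY //; have /andP[a0 a1] := arg x xY; apply/andP; split.
    by rewrite -bxs; apply: bessel_decr.
  by rewrite -(bessel0 d d0); apply: bessel_decr.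
have c_rho : c * (2 * rho + 1) <= e.
  have h : 3 * xs / rho <= e by rewrite ler_pdivrMr // [e * _]mulrC -ler_pdivrMr //; lra.
  apply: le_trans h; have -> : 3 * xs / rho = c * (3 * rho).
    by rewrite /c; have rn := lt0r_neq0 rho0; field.
  by rewrite ler_wpM2l ?(ltW c0) //; lra.
have nb (x z : pt d) j : x \in Y -> z = x + ev j \/ z = x - ev j -> phi z <= u z.
  move=> xY hz; rewrite /u; case: ifPn => // zY; apply: neg; apply/andP; split.
    by rewrite -cr2 ler_wpM2l ?(ltW c0) // ltW // ltNge -in_lball.
  have xl : (sqnorm x)%:~R <= rho ^+ 2 :> R by rewrite -in_lball.
  have := coord_bound x j rho (ltW rho0) xl; rewrite ler_norml => /andP[a1 a2].
  have zs : (sqnorm z)%:~R <= rho ^+ 2 + (2 * rho + 1) :> R.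
    by case: hz => ->; rewrite ?sqnorm_addev ?sqnorm_subev ?(rmorphD, rmorphB, rmorphM) /=; lra.
  by apply: le_trans (ler_wpM2l (ltW c0) zs) _; rewrite mulrDr cr2; lra.
have lap x : x \in Y -> \sum_j (2 * u x - u (x + ev j) - u (x - ev j)) <= c * u x + K / rho ^+ 3.
  move=> xY; have xl : (sqnorm x)%:~R <= rho ^+ 2 :> R by rewrite -in_lball.
  set s : R := (sqnorm x)%:~R in xl *.
  pose a j : R := (x ord0 j)%:~R.
  pose tj j := c / d%:R * bessel d.+2 (c * s) - c ^+ 2 * a j ^+ 2 / (d%:R * d.+2%:R) * bessel d.+4 (c * s)
    + 2 * ((6 * c ^+ 2 * rho + 8 * c ^+ 3 * rho ^+ 3) * M).
  apply: le_trans (_ : \sum_j tj j <= _).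
    apply: ler_sum => j _.
    have h1 := nb x (x + ev j) j xY (or_introl erefl); have h2 := nb x (x - ev j) j xY (or_intror erefl).
    have as_ : a j ^+ 2 <= s by rewrite /a /s -rmorphXn /= ler_int sqnorm_ge.
    have h4 : 4 * c * rho ^+ 2 <= 4 * xs by rewrite -mulrA cr2.
    have := radial_second_difference d d0 c (a j) s rho M (4 * xs) hM (ltW c0) rho1 as_ xl h4.
    have -> : s + 2 * a j + 1 = (sqnorm (x + ev j))%:~R by rewrite sqnorm_addev !(rmorphD, rmorphM).
    have -> : s - 2 * a j + 1 = (sqnorm (x - ev j))%:~R by rewrite sqnorm_subev rmorphD rmorphB rmorphM.
    rewrite -/(phi (x + ev j)) -/(phi (x - ev j)) -/(phi x) -/(tj j) uY //; lra.
  have ss : \sum_j a j ^+ 2 = s.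
    by rewrite /s /sqnorm rmorph_sum /=; apply: eq_bigr => j _; rewrite rmorphXn.
  have -> : \sum_j tj j = c * bessel d.+2 (c * s) - c ^+ 2 * s / (d%:R * d.+2%:R) * bessel d.+4 (c * s)
      + d%:R * (2 * ((6 * c ^+ 2 * rho + 8 * c ^+ 3 * rho ^+ 3) * M)).
    rewrite /tj big_split sumrB /=; congr (_ - _ + _).
    - have dn : (d%:R : R) != 0 by rewrite pnatr_eq0 -lt0n.
      by rewrite sumr_const card_ord -[LHS]mulr_natl mulrA [c / _]mulrC mulVKf.
    - by rewrite -mulr_suml -mulr_suml -mulr_sumr ss.
    - by rewrite sumr_const card_ord -[LHS]mulr_natl.
  rewrite uY // /phi -/s (bessel_rec d) // le_eqVlt; apply/orP; left; apply/eqP.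
  have -> : 6 * c ^+ 2 * rho + 8 * c ^+ 3 * rho ^+ 3 = (6 * xs ^+ 2 + 8 * xs ^+ 3) / rho ^+ 3.
    by rewrite /c; have rn := lt0r_neq0 rho0; field.
  rewrite /K; move: (bessel d.+2 _) (bessel d.+4 _) (rho ^+ 3)^-1 (d%:R * d.+2%:R)^-1 => B B' r3 dd.
  by ring.
exists u; split => //; first by move=> x /negPf xY; rewrite /u xY.
rewrite energy_laplace; last by move=> x /negPf xY; rewrite /u xY.
apply: le_trans (_ : \sum_(x <- Y) (c * u x ^+ 2 + K / rho ^+ 3) <= _).
  apply: ler_sum_fset => x xY; have /andP[u0 u1] := u01 x xY.
  apply: le_trans (ler_wpM2l u0 (lap x xY)) _.
  have : u x * (K / rho ^+ 3) <= K / rho ^+ 3.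
    by rewrite ler_piMl // divr_ge0 ?exprn_ge0 // ltW.
  by lra.
rewrite big_split /= -mulr_sumr sumr_fset_const mulrDl lerD2l.
have Kr : 0 <= K / rho ^+ 3 by rewrite divr_ge0 ?exprn_ge0 // ltW.
have := ler_wpM2r Kr cardS; move/le_trans; apply.
by rewrite le_eqVlt; apply/orP; left; apply/eqP; ring.
Qed.

End Trial.

Section Eigenvalue.
Context {R : realType} {d : nat}.
Hypothesis hd : (2 <= d)%N.
Implicit Types (X Y : {fset pt d}) (u : pt d -> R).

Let d0 : (0 < d)%N. Proof. exact: leq_trans hd. Qed.

Lemma extend_fset Y (n : nat) : exists X, {subset Y <= X} /\ #|` X| = (#|` Y| + n)%N.
Proof.
elim: n => [|n [X [sYX cX]]]; first by exists Y; split; [move=> x | rewrite addn0].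
pose f (k : 'I_(#|` X|.+1)) : pt d := \row_(j < d) (k : nat)%:Z.
have finj : injective f.
  move=> k l /(congr1 (fun q : pt d => q ord0 (Ordinal d0))); rewrite /f !mxE => -[e].
  exact: val_inj.
have : ~~ ([fset f k | k in 'I_(#|` X|.+1)] `<=` X)%fset.
  apply/negP => /fsubset_leq_card; rewrite card_imfset //= -cardE card_ord.
  by rewrite ltnn.
move=> /fsubsetPn[x _ xX]; exists (x |` X)%fset; split.
  by move=> y /sYX yX; rewrite !inE yX orbT.
by rewrite cardfsU1 xX add1n cX addnS.
Qed.

Lemma energy_ge0 X u : 0 <= energy X u.
Proof. by apply: sumr_ge0 => j _; apply: sumr_ge0 => y _; exact: sqr_ge0. Qed.

Lemma energyZ X (c : R) u : energy X (fun x => c * u x) = c ^+ 2 * energy X u.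
Proof.
rewrite /energy mulr_sumr; apply: eq_bigr => j _; rewrite mulr_sumr; apply: eq_bigr => y _.
by rewrite /grad; ring.
Qed.

Lemma energy_abs X u : energy X (fun x => `|u x|) <= energy X u.
Proof.
apply: ler_sum => j _; apply: ler_sum => y _; rewrite /grad -sqr_normr -[leRHS]sqr_normr.
by rewrite lerXn2r ?nnegrE // ler_dist_dist.
Qed.

Lemma energy_extend X Y u : {subset Y <= X} -> (forall x, x \notin Y -> u x = 0) ->
  energy X u = energy Y u /\ \sum_(x <- X) u x ^+ 2 = \sum_(x <- Y) u x ^+ 2.
Proof.
move=> sYX u0; have u0X x : x \notin X -> u x = 0.
  by move=> xX; apply: u0; apply: contra xX; exact: sYX.
have ext (F : pt d -> R) : (forall x, x \notin Y -> F x = 0) -> \sum_(x <- X) F x = \sum_(x <- Y) F x.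
  move=> F0; apply/esym/big_fset_incl; first exact/fsubsetP.
  by move=> x _; exact: F0.
rewrite !energy_laplace //; split; apply: ext => x /u0 ->; first by rewrite mul0r.
by rewrite expr0n.
Qed.

Let rayleigh N X := [set E : R | exists u : pt d -> R,
         [/\ (forall p, p \notin X -> u p = 0),
             (N%:R)^-1 * \sum_(p <- X) u p ^+ 2 = 1 &
             E = powR (N%:R) (- ((d%:R - 2) / d%:R)) * Dir R d X u]].

Let rayleigh_lb N X : lbound (rayleigh N X) 0.
Proof. by move=> E [u [u0 _ ->]]; rewrite mulr_ge0 ?powR_ge0 // Dir_energy // energy_ge0. Qed.

Let rayleigh_inf N X : (0 < N)%N -> #|` X| = N -> has_inf (rayleigh N X).
Proof.
move=> N0 cX; split; last by exists 0; exact: rayleigh_lb.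
exists (powR (N%:R) (- ((d%:R - 2) / d%:R)) * Dir R d X (fun x => (x \in X)%:R)).
exists (fun x => (x \in X)%:R); split => //; first by move=> x /negPf ->.
rewrite (eq_sum_fset X _ (fun _ => 1)); last by move=> x ->; rewrite expr1n.
by rewrite sumr_fset_const cX mulr1 mulVf // pnatr_eq0 -lt0n.
Qed.

Lemma lambdaN_ge0 N X : 0 <= lambdaN R d N X.
Proof.
have [e|/set0P h] := eqVneq (rayleigh N X) set0; last exact: lb_le_inf h (rayleigh_lb N X).
by rewrite /lambdaN -/(rayleigh N X) e inf0.
Qed.

Lemma m_lambda_le N X u : (0 < N)%N -> #|` X| = N -> (forall x, x \notin X -> u x = 0) ->
  0 < \sum_(x <- X) u x ^+ 2 ->
  m_lambda R d N <= powR N%:R (- ((d%:R - 2) / d%:R)) * (N%:R * (energy X u / \sum_(x <- X) u x ^+ 2)).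
Proof.
move=> N0 cX u0; set S := \sum_(x <- X) u x ^+ 2 => S0.
have Np : 0 < N%:R :> R by rewrite ltr0n.
apply: le_trans (_ : lambdaN R d N X <= _).
  apply: ge_inf; last by exists X.
  by exists 0 => E [Y [_ ->]]; exact: lambdaN_ge0.
apply: ge_inf; first by exists 0; exact: rayleigh_lb.
pose c := Num.sqrt (N%:R / S); have c2 : c ^+ 2 = N%:R / S by rewrite sqr_sqrtr // divr_ge0 ?(ltW S0).
exists (fun x => c * u x); split.
- by move=> x /u0 ->; rewrite mulr0.
- under eq_bigr do rewrite exprMn.
  by rewrite -mulr_sumr -/S c2 divfK ?mulVf // lt0r_neq0.
rewrite Dir_energy; last by move=> x /u0 ->; rewrite mulr0.
by rewrite energyZ c2; congr (_ * _); rewrite mulrAC mulrA.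
Qed.

(** The second [a] is the slack in the infimum; absolute values do not increase the energy. *)
Lemma near_minimizer N X (a : R) : (0 < N)%N -> #|` X| = N -> 0 < a ->
  lambdaN R d N X <= m_lambda R d N + a ->
  exists u, [/\ forall x, x \notin X -> u x = 0, forall x, 0 <= u x,
    \sum_(x <- X) u x ^+ 2 = N%:R &
    powR N%:R (- ((d%:R - 2) / d%:R)) * energy X u <= m_lambda R d N + 2 * a].
Proof.
move=> N0 cX a0 hX; have [E [u [u0 uN ->]] hE] := inf_adherent a0 (rayleigh_inf N X N0 cX).
have Np : (N%:R : R) != 0 by rewrite pnatr_eq0 -lt0n.
exists (fun x => `|u x|); split.
- by move=> x /u0 ->; rewrite normr0.
- by move=> x; exact: normr_ge0.
- under eq_bigr do rewrite sqr_normr.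
  by apply: (mulfI (invr_neq0 Np)); rewrite uN mulVf.
apply: le_trans (_ : powR N%:R (- ((d%:R - 2) / d%:R)) * energy X u <= _).
  by rewrite ler_wpM2l ?powR_ge0 // energy_abs.
rewrite -Dir_energy //; apply: ltW; apply: lt_le_trans hE _.
by rewrite -/(lambdaN R d N X); lra.
Qed.

End Eigenvalue.

(** * Quantitative stability *)

Section Assembly.
Context {R : realType}.
Variable d : nat.
Hypothesis hd : (2 <= d)%N.

Let d0 : (0 < d)%N. Proof. exact: leq_trans hd. Qed.
Let dp : 0 < d%:R :> R. Proof. by rewrite ltr0n. Qed.

Let w0 : 0 < omega R d. Proof. exact: omega_gt0. Qed.

Lemma rN_gt0 N : (0 < N)%N -> 0 < rN R d N.
Proof. by move=> N0; rewrite powR_gt0 // divr_gt0 // ltr0n. Qed.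

Lemma rN_volume N : (0 < N)%N -> omega R d * rN R d N ^+ d = N%:R.
Proof.
move=> N0; rewrite /rN -powR_mulrn ?powR_ge0 // -powRrM mulVf ?pnatr_eq0 -?lt0n //.
by rewrite powRr1 ?divr_ge0 ?(ltW w0) // mulrC divfK // lt0r_neq0.
Qed.

Lemma powR_inv_rN N : (0 < N)%N -> powR N%:R (- (d%:R)^-1) = powR (omega R d) (- (d%:R)^-1) / rN R d N.
Proof.
move=> N0; have Np : 0 < N%:R :> R by rewrite ltr0n.
rewrite /rN -powRN -{1}[N%:R](@divfK _ (omega R d)) ?lt0r_neq0 // powRM ?divr_ge0 ?(ltW w0) //.
by rewrite mulrC.
Qed.

Lemma rN_sqr N : (0 < N)%N -> rN R d N ^+ 2 =
  powR N%:R (- ((d%:R - 2) / d%:R)) * (N%:R * powR (omega R d) (- (2 / d%:R))).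
Proof.
move=> N0; have Np : 0 < N%:R :> R by rewrite ltr0n.
have dn := lt0r_neq0 dp.
rewrite /rN -powR_mulrn ?powR_ge0 // -powRrM powRM ?invr_ge0 ?(ltW w0) //.
rewrite -[(omega R d)^-1]powR_inv1 ?(ltW w0) // -powRrM.
rewrite [RHS]mulrA; congr (_ * _).
  have <- : powR N%:R (- ((d%:R - 2) / d%:R) + 1) = powR N%:R (- ((d%:R - 2) / d%:R)) * N%:R :> R.
    by rewrite powRD ?powRr1 ?(ltW Np) // (gt_eqF Np) implybT.
  by congr powR; field.
by congr powR; rewrite mulN1r mulrC.
Qed.

Lemma bernoulli (n : nat) (t : R) : 0 <= t <= 1 -> 1 - n%:R * (1 - t) <= t ^+ n.
Proof.
move=> /andP[t0 t1]; elim: n => [|n IH]; first by rewrite mul0r subr0 expr0.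
rewrite exprS; have := ler_wpM2l t0 IH; apply: le_trans.
rewrite -natr1; have : 0 <= n%:R * (1 - t) ^+ 2 by rewrite mulr_ge0 // sqr_ge0.
by rewrite sqrrB; lra.
Qed.

(** The two bounds on the energy give [(s / r)^2 >= 1 - C6 * q]: a small eigenvalue forces a large
    torsion radius. The square root term has relative size [1 / r], hence at most [q]. *)
Lemma torsion_deficit (xs C3 C Q : R) : 0 < xs -> 0 <= C3 -> 0 <= C -> exists2 C' : R, 0 < C' &
  forall r s N q E : R, 0 < r -> 0 < s -> 0 < N -> omega R d * r ^+ d = N -> r^-1 <= q <= Q ->
  0 <= E -> E <= N / r ^+ 2 * (xs + C * q) ->
  xs / s ^+ 2 * N <= E + xs / s ^+ 2 * (C3 * Num.sqrt (E * N)) ->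
  N * cdim d * r ^+ 2 - d%:R ^+ 2 * rtors d s <= C' * (N * r ^+ 2 * q).
Proof.
move=> xs0 C30 C0; pose c4 := Num.sqrt (xs + C * Q); have c40 : 0 <= c4 by exact: sqrtr_ge0.
pose C6 := C3 * c4 + C / xs; have C60 : 0 <= C6 by rewrite addr_ge0 ?mulr_ge0 // invr_ge0 ltW.
exists (d.+2%:R * C6 + 1); first by rewrite ltr_wpDl // mulr_ge0.
move=> r s N q E r0 s0 N0 vol /andP[q1 q2] E0 hE hKJ.
have q0 : 0 < q by apply: lt_le_trans q1; rewrite invr_gt0.
have rn := lt0r_neq0 r0; have sn := lt0r_neq0 s0; have xn := lt0r_neq0 xs0.
have sqE : Num.sqrt (E * N) <= N / r * c4.
  have -> : N / r * c4 = Num.sqrt ((N / r) ^+ 2 * (xs + C * Q)).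
    by rewrite sqrtrM ?sqr_ge0 // sqrtr_sqr ger0_norm // divr_ge0 // ltW.
  apply: ler_wsqrtr; have -> : (N / r) ^+ 2 * (xs + C * Q) = (N / r ^+ 2 * (xs + C * Q)) * N by field.
  rewrite ler_wpM2r ?(ltW N0) //; apply: le_trans hE _; rewrite ler_wpM2l ?divr_ge0 ?exprn_ge0 ?(ltW N0) ?(ltW r0) //.
  by rewrite lerD2l ler_wpM2l.
pose t := (s / r) ^+ 2; have t0 : 0 < t by rewrite exprn_gt0 // divr_gt0.
have key : xs <= (xs + C * q) * t + xs * (C3 * c4 / r).
  have lp : 0 <= xs / s ^+ 2 by rewrite divr_ge0 ?exprn_ge0 ?(ltW s0) ?(ltW xs0).
  have h1 : xs / s ^+ 2 * N <= N / r ^+ 2 * (xs + C * q) + xs / s ^+ 2 * (C3 * (N / r * c4)).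
    by apply: le_trans hKJ _; apply: lerD => //; rewrite ler_wpM2l // ler_wpM2l.
  have sN : 0 < s ^+ 2 / N by rewrite divr_gt0 // exprn_gt0.
  have := ler_wpM2r (ltW sN) h1.
  have -> : xs / s ^+ 2 * N * (s ^+ 2 / N) = xs by have Nn := lt0r_neq0 N0; field; rewrite sn Nn.
  move/le_trans; apply; rewrite le_eqVlt; apply/orP; left; apply/eqP; rewrite /t.
  by have Nn := lt0r_neq0 N0; field; rewrite sn Nn rn.
have tlow : 1 - C6 * q <= t.
  have [t1|t1] := leP 1 t; first by have := mulr_ge0 C60 (ltW q0); lra.
  have h1 : xs <= xs * t + C * q + xs * (C3 * c4 / r).
    have : C * q * t <= C * q by rewrite ler_piMr ?mulr_ge0 // ltW.
    by move: key; rewrite mulrDl; lra.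
  have h2 : C3 * c4 / r <= C3 * c4 * q by rewrite ler_wpM2l // mulr_ge0.
  have h3 := ler_wpM2l (ltW xs0) h2.
  rewrite -(ler_pM2l xs0); have -> : xs * (1 - C6 * q) = xs - C * q - xs * (C3 * c4 * q).
    by rewrite /C6; field.
  by lra.
pose y := s / r; have y0 : 0 < y by rewrite divr_gt0.
have ylow : 1 - y ^+ d.+2 <= d.+2%:R * C6 * q.
  have rhs0 : 0 <= d.+2%:R * C6 * q by rewrite !mulr_ge0 // ltW.
  have [y1|y1] := leP 1 y; first by apply: le_trans rhs0; rewrite subr_le0 exprn_ege1.
  have t1 : 0 <= t <= 1 by rewrite (ltW t0) exprn_ile1 ?(ltW y0) ?(ltW y1).
  (* Bernoulli is applied to [t = y^2]; for [y < 1] the resulting power [y^(2(d+2))] is at most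
     [y^(d+2)]. *)
  have := bernoulli d.+2 t t1; rewrite /t -/y -exprM mul2n -addnn exprD => h.
  have h2 : y ^+ d.+2 * y ^+ d.+2 <= y ^+ d.+2 by rewrite ler_piMr ?exprn_ge0 ?exprn_ile1 ?(ltW y0) ?(ltW y1).
  have h3 : d.+2%:R * (1 - y ^+ 2) <= d.+2%:R * (C6 * q) by rewrite ler_wpM2l //; rewrite -/t; move: tlow; rewrite /t; lra.
  by rewrite -mulrA; lra.
have -> : d%:R ^+ 2 * rtors d s = N * cdim d * r ^+ 2 * y ^+ d.+2.
  rewrite -vol /rtors /cdim /y expr_div_n -(addn2 d) !exprD; have dn := lt0r_neq0 dp.
  have d2n : ((d + 2)%:R : R) != 0 by rewrite addn2.
  have rd : r ^+ d != 0 by rewrite expf_neq0.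
  move: (r ^+ d) (s ^+ d) ((d + 2)%:R : R) (d%:R : R) rd d2n dn => rd sd a b *.
  by field; do ?[apply/andP; split].
have -> : N * cdim d * r ^+ 2 - N * cdim d * r ^+ 2 * y ^+ d.+2 = N * r ^+ 2 * (cdim d * (1 - y ^+ d.+2)) by ring.
have -> : (d.+2%:R * C6 + 1) * (N * r ^+ 2 * q) = N * r ^+ 2 * (d.+2%:R * C6 * q + q) by ring.
have Nr : 0 <= N * r ^+ 2 by rewrite mulr_ge0 ?exprn_ge0 ?(ltW N0) ?(ltW r0).
apply: ler_wpM2l => //; have V0 : 0 <= d.+2%:R * C6 * q by rewrite !mulr_ge0 // ltW.
have c1 : cdim d <= 1 :> R by rewrite ler_pdivrMr // mul1r ler_nat (leq_trans (leqnSn d)).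
have c00 : 0 <= cdim d :> R by rewrite divr_ge0.
apply: le_trans (ler_wpM2l c00 ylow) _.
have h : cdim d * (d.+2%:R * C6 * q) <= d.+2%:R * C6 * q by rewrite ler_piMl.
by lra.
Qed.

End Assembly.

Section Stability.
Context {R : realType}.
Variable d : nat.
Hypothesis hd : (2 <= d)%N.

Let d0 : (0 < d)%N. Proof. exact: leq_trans hd. Qed.
Let dp : 0 < d%:R :> R. Proof. by rewrite ltr0n. Qed.
Let w0 : 0 < omega R d. Proof. exact: omega_gt0. Qed.

Lemma lball_card_le : exists2 C : R, 0 < C & forall rho : R, 1 <= rho ->
  (#|` lball (rho ^+ 2) : {fset pt d} |%:R : R) <= omega R d * rho ^+ d * (1 + C / rho).
Proof.
have [C C0 hC] := @lball_card R d; exists C => // rho rho1.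
have h5 : 0 <= (1 : R) <= 1 by rewrite ler01 lexx.
have := hC rho 1 rho1 h5; rewrite sqrtr1 expr1n !mulr1 ler_norml => /andP[_ h].
have -> : omega R d * rho ^+ d * (1 + C / rho) = omega R d * rho ^+ d + C * (omega R d * rho ^+ d / rho) by ring.
by lra.
Qed.

Lemma m_lambda_upper (xs : R) : 0 < xs -> (forall x : R, 0 <= x < xs -> 0 < bessel d x) ->
    bessel d xs = 0 ->
  exists C R0 : R, [/\ 0 < C, 1 <= R0 & forall (N : nat) (r : R), (0 < N)%N -> R0 <= r ->
    omega R d * r ^+ d = N%:R ->
    m_lambda R d N <= powR N%:R (- ((d%:R - 2) / d%:R)) * (N%:R * (xs / r ^+ 2 + C / r ^+ 3))].
Proof.
move=> xs0 bpos bxs; have [Ct [Rt [Ct0 Rt1 trial]]] := trial_energy d xs d0 xs0 bpos bxs.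
have [C1 C10 hC1] := lball_card_le.
exists (8 * xs * C1 + 8 * Ct), (Rt + 2 * C1); split; [by rewrite addr_gt0 // !mulr_gt0 | lra |].
(* The radius is shrunk so that the lattice ball, counting error included, has at most [N] points;
   it is then padded to [N]. The change of radius costs only [O(r^-3)]. *)
move=> N r N0 hr vol; pose rho := r - C1.
have hrho : Rt <= rho by rewrite /rho; lra.
have rho1 : 1 <= rho by lra.
have rho0 : 0 < rho by lra. have r0 : 0 < r by rewrite -(subrK C1 r) -/rho; lra.
have [u [u0 S0 hE]] := trial rho hrho; set Y := lball (rho ^+ 2) in u0 S0 hE.
have cY : (#|` Y| <= N)%N.
  rewrite -(ler_nat R) -vol; apply: le_trans (hC1 rho rho1) _.
  rewrite -mulrA ler_wpM2l ?(ltW w0) // -(prednK d0) !exprS.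
  have -> : rho * rho ^+ d.-1 * (1 + C1 / rho) = rho ^+ d.-1 * r.
    have e : r = rho + C1 by rewrite /rho subrK.
    by rewrite e; have h := lt0r_neq0 rho0; clear e hr; clearbody rho; field.
  rewrite mulrC ler_wpM2l ?(ltW r0) // lerXn2r ?nnegrE ?(ltW rho0) ?(ltW r0) //.
  by rewrite /rho gerBl ltW.
have [X [sYX cX]] := extend_fset hd Y (N - #|` Y|); rewrite subnKC // in cX.
have u0X x : x \notin X -> u x = 0 by move=> xX; apply: u0; apply: contra xX; exact: sYX.
have [eE eS] := energy_extend X Y u sYX u0.
apply: le_trans (m_lambda_le N X u N0 cX u0X _) _; first by rewrite eS.
apply: ler_wpM2l; first exact: powR_ge0.
apply: ler_wpM2l => //; rewrite eE eS ler_pdivrMr //; apply: le_trans hE _.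
rewrite ler_wpM2r ?(ltW S0) //.
have rr : r <= 2 * rho by rewrite /rho; lra.
have rn := lt0r_neq0 r0; have rhon := lt0r_neq0 rho0.
have i1 : rho^-1 <= 2 / r by rewrite ler_pdivlMr // mulrC ler_pdivrMr.
have i0 : 0 <= rho^-1 by rewrite invr_ge0 ltW.
have i2 : rho ^- 2 <= 4 / r ^+ 2.
  have -> : 4 / r ^+ 2 = (2 / r) ^+ 2 by field.
  by rewrite -exprVn lerXn2r // nnegrE // (le_trans i0).
have i3 : rho ^- 3 <= 8 / r ^+ 3.
  have -> : 8 / r ^+ 3 = (2 / r) ^+ 3 by field.
  by rewrite -exprVn lerXn2r // nnegrE // (le_trans i0).
have h1 : rho ^- 2 <= r ^- 2 + 8 * C1 / r ^+ 3.
  have -> : rho ^- 2 = r ^- 2 + (r - rho) * (r + rho) / r ^+ 2 * rho ^- 2 by field; rewrite rn rhon.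
  rewrite lerD2l; have -> : r - rho = C1 by rewrite /rho; ring.
  have h2 : (r + rho) / r ^+ 2 <= 2 / r.
    rewrite ler_pdivrMr ?exprn_gt0 //; have -> : 2 / r * r ^+ 2 = 2 * r by field.
    by rewrite /rho; lra.
  have h3 : C1 * (r + rho) / r ^+ 2 * rho ^- 2 = C1 * ((r + rho) / r ^+ 2 * rho ^- 2) by rewrite !mulrA.
  have -> : 8 * C1 / r ^+ 3 = C1 * (2 / r * (4 / r ^+ 2)) by field.
  rewrite h3 ler_wpM2l ?(ltW C10) //; apply: ler_pM => //; last by rewrite invr_ge0 exprn_ge0 // ltW.
  by apply: divr_ge0; [apply: addr_ge0; exact: ltW | rewrite exprn_ge0 // ltW].
have := ler_wpM2l (ltW xs0) h1; have := ler_wpM2l (ltW Ct0) i3.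
rewrite mulrDl; lra.
Qed.

Lemma card_symdiff_le (X : {fset pt d}) (rho : R) :
  (card_symdiff d X [set p | ((dist2 d p 0)%:~R <= rho ^+ 2)%R] <= #|` X| + #|` lball (rho ^+ 2) : {fset pt d} |)%N.
Proof.
have inB p : `[< ((dist2 d p 0)%:~R : R) <= rho ^+ 2 >] = (p \in lball (rho ^+ 2)).
  by rewrite in_lball dist2_sqnorm subr0; exact/asboolP/idP.
have fin : finite_set [set p | (p \in X) != `[< ((dist2 d p 0)%:~R : R) <= rho ^+ 2 >]].
  apply: (@sub_finite_set _ _ [set` (X `|` lball (rho ^+ 2))%fset]) => // p /=.
  by rewrite inB !inE; case: (p \in X); case: (p \in lball _).
apply: (@leq_trans #|` (X `|` lball (rho ^+ 2))%fset|).
  apply/fsubset_leq_card/fsubsetP => p; rewrite in_fset_set // inE /=.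
  by rewrite inB !inE; case: (p \in X); case: (p \in lball _).
by rewrite cardfsU leq_subr.
Qed.

Lemma quantitative_stability (A : R) : exists C R0 : R, [/\ 0 < C, 1 <= R0 &
  forall (N : nat) (X : {fset pt d}) (a : R), (0 < N)%N -> #|` X| = N -> 0 < a -> a <= A ->
    R0 <= rN R d N -> lambdaN R d N X <= m_lambda R d N + a ->
    exists z : pt d, (card_symdiff d X (ball_lattice R d N z))%:R
       <= C * (N%:R * Num.sqrt (a + entries_tot X / N%:R) : R)].
Proof.
have [xs [xs0 bxs bpos]] := bessel_first_zero d d0 : exists xs : R, _.
have [Cm [Rm [Cm0 Rm1 mup]]] := m_lambda_upper xs xs0 bpos bxs.
pose kap := powR (omega R d) (- (2 / d%:R)); have kap0 : 0 < kap by rewrite powR_gt0.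
have c0 : 0 < cdim d :> R by exact: cdim_gt0.
have C30 : 0 <= 72 * d%:R / cdim d :> R by rewrite divr_ge0 ?mulr_ge0 // ltW.
pose Ce := Cm + 2 * kap; have Ce0 : 0 <= Ce by rewrite addr_ge0 ?mulr_ge0 ?(ltW Cm0) ?(ltW kap0).
have [Cd Cd0 deficit] := torsion_deficit d hd xs (72 * d%:R / cdim d) Ce (1 + A) xs0 C30 Ce0.
have [K K0 moment] := @clipped_moment_bound R d hd.
have [Cb Cb0 bath] := bathtub K hd (ltW K0).
have [C1 C10 hC1] := lball_card_le.
(* The 5 covers the entry term [9/2] of the deficit and makes [C9 >= 1]. *)
pose C9 := Cd + 5; have C91 : 1 <= C9 by rewrite /C9; lra.
exists ((Cb + 2 + C1) * Num.sqrt C9), Rm; split => //.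
  by rewrite mulr_gt0 ?sqrtr_gt0 //; lra.
move=> N X a N0 cX a0 aA hr hX.
set r := rN R d N in hr *; have r0 : 0 < r by exact: rN_gt0.
have vol : omega R d * r ^+ d = N%:R by exact: rN_volume.
have volX : omega R d * r ^+ d = #|` X|%:R by rewrite cX.
have Np : 0 < N%:R :> R by rewrite ltr0n.
have X0 : X != fset0 by rewrite -cardfs_gt0 cX.
have r1 : 1 <= r by lra.
pose P : R := entries_tot X / N%:R.
have iso : r^-1 <= P.
  have := isoperimetric X r hd r0 X0 volX; rewrite cX => h.
  by rewrite /P ler_pdivlMr // mulrC ler_pdivrMr // mulrC.
have P0 : 0 < P by apply: lt_le_trans iso; rewrite invr_gt0.
pose eps := C9 * (a + P).
have aP : 0 < a + P by exact: addr_gt0.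
have eps0 : 0 < eps by apply: mulr_gt0 aP; exact: lt_le_trans C91.
have se : Num.sqrt eps = Num.sqrt C9 * Num.sqrt (a + P) by rewrite sqrtrM // (le_trans _ C91).
suff [z hz] : exists z : pt d, (card_symdiff d X (ball_lattice R d N z))%:R <= (Cb + 2 + C1) * (N%:R * Num.sqrt eps).
  by exists z; apply: le_trans hz _; rewrite se -/P le_eqVlt; apply/orP; left; apply/eqP; ring.
(* For [eps > 1] the bound follows from counting [X] and the ball. *)
have [e1|e1] := ltP 1 eps.
  exists 0; apply: le_trans (_ : (N%:R + #|` lball (r ^+ 2) : {fset pt d} |%:R : R) <= _).
    have h := card_symdiff_le X r; rewrite cX in h.
    by rewrite -natrD ler_nat /ball_lattice -/r.
  have s1 : 1 <= Num.sqrt eps by rewrite -[1]sqrtr1 ler_wsqrtr // ltW.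
  have := hC1 r r1; rewrite vol => hl.
  have h2 : N%:R * (1 + C1 / r) <= N%:R * (1 + C1).
    by rewrite ler_wpM2l // lerD2l ler_pdivrMr // ler_peMr // ltW.
  have h3 : N%:R * (2 + C1) <= (2 + C1) * (N%:R * Num.sqrt eps).
    by rewrite mulrC; apply: ler_wpM2l; rewrite ?ler_peMr // addr_ge0 // ltW.
  have h4 : 0 <= Cb * (N%:R * Num.sqrt eps) by rewrite !mulr_ge0 ?sqrtr_ge0 // ltW.
  by lra.
have [u [u0 uge uN hu]] := near_minimizer N X a N0 cX a0 hX.
have mu := mup N r N0 hr vol.
pose q := r^-1 + a.
have hE : energy X u <= N%:R / r ^+ 2 * (xs + Ce * q).
  have rn := lt0r_neq0 r0; have rsq := rN_sqr (R := R) d hd N N0; rewrite -/r -/kap in rsq.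
  have p0 : 0 < powR N%:R (- ((d%:R - 2) / d%:R)) :> R by rewrite powR_gt0.
  move: (powR N%:R _) p0 rsq mu hu => p p0 rsq mu hu.
  have h1 : p * energy X u <= p * (N%:R * (xs / r ^+ 2 + Cm / r ^+ 3)) + 2 * a.
    by apply: le_trans hu _; rewrite lerD2r.
  have ea : 2 * a = p * (N%:R * (2 * kap * a) / r ^+ 2).
    by apply: (mulIf (expf_neq0 2 rn)); rewrite -[RHS]mulrA divfK ?expf_neq0 // rsq; ring.
  rewrite ea -mulrDr ler_pM2l // in h1; apply: le_trans h1 _.
  have -> : N%:R * (xs / r ^+ 2 + Cm / r ^+ 3) + N%:R * (2 * kap * a) / r ^+ 2 =
      N%:R / r ^+ 2 * (xs + (Cm * r^-1 + 2 * kap * a)) by field.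
  rewrite ler_wpM2l ?divr_ge0 ?exprn_ge0 ?(ltW r0) // lerD2l /Ce /q.
  have := mulr_ge0 (ltW Cm0) (ltW a0); have ir : 0 <= r^-1 by rewrite invr_ge0 ltW.
  have := mulr_ge0 (mulr_ge0 (ler0n R 2) (ltW kap0)) ir.
  by rewrite mulrDl !mulrDr; clear -hd; lra.
have uS : 0 < \sum_(x <- X) u x ^+ 2 by rewrite uN.
have [w [s [[w_out wge] s0 es ew kj]]] := kohler_jobin d hd X u xs xs0 bpos bxs u0 uge uS.
rewrite uN in kj.
have q12 : r^-1 <= q <= 1 + A.
  by rewrite /q lerDl (ltW a0) lerD // invf_le1.
have def := deficit r s N%:R q (energy X u) r0 s0 Np vol q12 (energy_ge0 X u) hE kj.
have bP : N%:R * P = entries_tot X by rewrite /P mulrC divfK // lt0r_neq0.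
(* As [energy X w <= \sum w = rtors d s], this multiple makes [d * \sum w' - energy w' / 2] at least
   [d^2 * rtors d s / 2], the quantity in [torsion_deficit]. *)
pose w' x := d%:R * w x.
have hJ : 2^-1 * energy X w' - d%:R * (\sum_(x <- X) w' x)
    + 2^-1 * r ^+ 2 * (#|` X|%:R * cdim d + 9 * entries_tot X) <= #|` X|%:R * r ^+ 2 * eps.
  rewrite energyZ -mulr_sumr cX -es -bP; rewrite -es in ew.
  have h1 : d%:R ^+ 2 * energy X w <= d%:R ^+ 2 * rtors d s by rewrite ler_wpM2l ?sqr_ge0.
  have Nr : 0 <= N%:R * r ^+ 2 by rewrite mulr_ge0 ?sqr_ge0.
  have h2 : Cd * (N%:R * r ^+ 2 * q) <= N%:R * r ^+ 2 * (Cd * (a + P)).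
    by rewrite mulrCA ler_wpM2l // ler_wpM2l ?(ltW Cd0) // /q addrC lerD2l.
  have h3 : N%:R * r ^+ 2 * eps = N%:R * r ^+ 2 * (Cd * (a + P)) + 5 * (N%:R * r ^+ 2 * P) + 5 * (N%:R * r ^+ 2 * a).
    by rewrite /eps /C9; ring.
  have h4 := mulr_ge0 Nr (ltW P0); have h5 := mulr_ge0 Nr (ltW a0).
  have h6 : 0 <= N%:R * r ^+ 2 * (Cd * (a + P)) by exact: mulr_ge0 Nr (mulr_ge0 (ltW Cd0) (ltW aP)).
  by rewrite h3; move: def h1 h2 h4 h5 h6; clear -hd; lra.
have Pe : a + P <= eps by rewrite ler_peMl // ltW.
have PPe : P <= eps by apply: le_trans Pe; rewrite lerDr ltW.
have e01 : 0 <= eps <= 1 by rewrite ltW.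
have be : entries_tot X <= #|` X|%:R * eps.
  by rewrite cX -bP ler_wpM2l.
have w'0 x : x \notin X -> w' x = 0 by move=> /w_out e; rewrite /w' e mulr0.
have w'ge x : 0 <= w' x by rewrite mulr_ge0.
have [z hz] := moment X w' r eps X0 r0 volX w'0 w'ge e01 be hJ.
exists z; have e01' : 0 < eps <= 1 by rewrite eps0.
have re : 1 <= r * eps.
  by rewrite mulrC -ler_pdivrMr // div1r (le_trans iso).
have := bath X r eps z r1 volX e01' re hz; rewrite cX; move/le_trans; apply.
have Ns : 0 <= N%:R * Num.sqrt eps by rewrite mulr_ge0 ?sqrtr_ge0.
by rewrite ler_wpM2r // -addrA lerDl addr_ge0 // ltW.
Qed.

End Stability.

(** * Return to the perimeter, and small radii *)

Section Conclusion.
Context {R : realType}.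
Variable d : nat.
Hypothesis hd : (2 <= d)%N.

Let d0 : (0 < d)%N. Proof. exact: leq_trans hd. Qed.
Let dp : 0 < d%:R :> R. Proof. by rewrite ltr0n. Qed.

Lemma sqrt_powR_inv N : Num.sqrt (powR N%:R (- (d%:R)^-1)) = powR N%:R (- (2 * d%:R)^-1) :> R.
Proof.
have -> : powR N%:R (- (d%:R)^-1) = powR N%:R (- (2 * d%:R)^-1) ^+ 2 :> R.
  rewrite -powR_mulrn ?powR_ge0 // -powRrM; congr powR.
  by have dn := lt0r_neq0 dp; field.
by rewrite sqrtr_sqr ger0_norm ?powR_ge0.
Qed.

Lemma Per_PerN N (X : {fset pt d}) : (0 < N)%N ->
  (Per d X)%:R / N%:R = powR N%:R (- (d%:R)^-1) * PerN R d N X.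
Proof.
move=> N0; have Np : 0 < N%:R :> R by rewrite ltr0n.
rewrite /PerN mulrA -powRD; last by rewrite (gt_eqF Np) implybT.
have -> : - (d%:R)^-1 - (d%:R - 1) / d%:R = -1 :> R by have dn := lt0r_neq0 dp; field.
by rewrite powR_inv1 ?ltW // mulrC.
Qed.

Lemma PerN_ge0 N (X : {fset pt d}) : 0 <= PerN R d N X.
Proof. by rewrite mulr_ge0 ?powR_ge0. Qed.

(** For large radii, subadditivity of the square root separates [a] from the perimeter. For radii
    below [R0] the summand [N^(-1/d) = k / r_N] exceeds [k / R0] and alone pays for the trivial
    count. *)
Lemma ball_distance (A : R) : exists2 C : R, 0 < C &
  forall (N : nat) (X : {fset pt d}) (a : R), (0 < N)%N -> #|` X| = N -> 0 < a -> a <= A ->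
    lambdaN R d N X <= m_lambda R d N + a ->
    exists z : pt d, (card_symdiff d X (ball_lattice R d N z))%:R
       <= C * N%:R * (powR N%:R (- (2 * d%:R)^-1) * Num.sqrt (PerN R d N X)
                      + Num.sqrt a + powR N%:R (- (d%:R)^-1)).
Proof.
have [C [R0 [C0 R01 stab]]] := quantitative_stability d hd A.
pose B : R := #|` lball (R0 ^+ 2) : {fset pt d} |%:R.
pose k := powR (omega R d) (- (d%:R)^-1).
have k0 : 0 < k by rewrite powR_gt0 // omega_gt0.
have R00 : 0 < R0 by lra.
have B0 : 0 < (1 + B) * R0 / k by rewrite divr_gt0 // mulr_gt0 // ltr_wpDr.
exists (C + (1 + B) * R0 / k); first exact: addr_gt0.
move=> N X a N0 cX a0 aA hX; have Np : 0 < N%:R :> R by rewrite ltr0n.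
have p1 := powR_ge0 (N%:R : R) (- (2 * d%:R)^-1); have p2 := powR_ge0 (N%:R : R) (- (d%:R)^-1).
have s1 := sqrtr_ge0 (PerN R d N X); have s2 := sqrtr_ge0 a; have ps := mulr_ge0 p1 s1.
have r0 := rN_gt0 (R := R) d N N0.
have [hr|hr] := leP R0 (rN R d N).
  have [z hz] := stab N X a N0 cX a0 aA hr hX; exists z; apply: le_trans hz _.
  have h1 : Num.sqrt (a + entries_tot X / N%:R) <= Num.sqrt a + powR N%:R (- (2 * d%:R)^-1) * Num.sqrt (PerN R d N X).
    have h2 : entries_tot X / N%:R <= powR N%:R (- (d%:R)^-1) * PerN R d N X.
      by rewrite -Per_PerN // ler_wpM2r ?invr_ge0 // entries_tot_le_Per.
    rewrite -sqrt_powR_inv -sqrtrM //.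
    set x := powR _ _ * _ in h2 *; have x0 : 0 <= x by rewrite mulr_ge0 // PerN_ge0.
    rewrite -(ger0_norm (addr_ge0 s2 (sqrtr_ge0 x))) -sqrtr_sqr ler_wsqrtr // sqrrD !sqr_sqrtr ?(ltW a0) //.
    have := mulr_ge0 s2 (sqrtr_ge0 x); lra.
  rewrite -[leRHS]mulrA; apply: ler_pM.
  - exact: ltW.
  - by rewrite mulr_ge0 ?sqrtr_ge0.
  - by rewrite lerDl ltW.
  by apply: ler_wpM2l => //; lra.
exists 0; apply: le_trans (_ : (1 + B) * N%:R <= _).
  have h := card_symdiff_le d X (rN R d N); rewrite cX in h.
  apply: le_trans (_ : (N%:R + #|` lball (rN R d N ^+ 2) : {fset pt d} |%:R : R) <= _).
    by rewrite -natrD ler_nat.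
  have lB : (#|` lball (rN R d N ^+ 2) : {fset pt d} |%:R : R) <= B.
    rewrite ler_nat; apply/fsubset_leq_card/fsubsetP => p; rewrite !in_lball => /le_trans; apply.
    by rewrite lerXn2r // ?nnegrE ltW.
  have : B <= B * N%:R by rewrite ler_peMr // ler1n.
  by rewrite mulrDl; lra.
have h1 : (1 + B) * N%:R <= (1 + B) * R0 / k * N%:R * powR N%:R (- (d%:R)^-1).
  rewrite powR_inv_rN // -/k.
  have -> : (1 + B) * R0 / k * N%:R * (k / rN R d N) = (1 + B) * N%:R * (R0 / rN R d N).
    by have kn := lt0r_neq0 k0; have rn := lt0r_neq0 r0; field; rewrite kn rn.
  by rewrite ler_peMr ?mulr_ge0 ?addr_ge0 // ler_pdivlMr // mul1r ltW.
apply: le_trans h1 _; apply: ler_pM => //.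
- by rewrite mulr_ge0 // ltW.
- by rewrite ler_wpM2r // lerDr ltW.
by rewrite lerDr addr_ge0.
Qed.

End Conclusion.

Theorem theorem4p1 (R : realType) (d : nat) (hd : (2 <= d)%N) (A : R) :
  (exists2 C : R, 0 < C &
    forall (alpha : nat -> R), (forall N, 0 < alpha N) -> (forall N, alpha N <= A) ->
    forall (N : nat) (X : {fset pt d}), (0 < N)%N -> #|` X| = N ->
      lambdaN R d N X <= m_lambda R d N + alpha N ->
      exists z : pt d,
        (card_symdiff d X (ball_lattice R d N z))%:R
          <= C * N%:R * (powR (N%:R) (- (2 * d%:R)^-1) * Num.sqrt (PerN R d N X)
                         + Num.sqrt (alpha N) + powR (N%:R) (- (d%:R)^-1)))
  /\
  (forall K : R, exists2 C' : R, 0 < C' &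
    forall (alpha : nat -> R) (Xs : nat -> {fset pt d}),
      (forall N, 0 < alpha N) -> (forall N, alpha N <= A) ->
      (forall N, (0 < N)%N -> #|` Xs N| = N) ->
      (forall N, (0 < N)%N -> PerN R d N (Xs N) <= K) ->
      (forall N, (0 < N)%N -> lambdaN R d N (Xs N) <= m_lambda R d N + alpha N) ->
      forall N, (0 < N)%N ->
      exists z : pt d,
        (card_symdiff d (Xs N) (ball_lattice R d N z))%:R
          <= C' * N%:R * (powR (N%:R) (- (2 * d%:R)^-1) + Num.sqrt (alpha N))).
Proof.
have [C C0 hC] := ball_distance d hd A; split.
  exists C => // alpha a0 aA N X N0 cX hX; exact: hC.
(* The 2 absorbs [N^(-1/d) <= N^(-1/(2d))] and the coefficient of [sqrt alpha]. *)
move=> K; exists (C * (Num.sqrt K + 2)); first by rewrite mulr_gt0 // ltr_wpDl ?sqrtr_ge0.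
move=> alpha Xs a0 aA cX PK hX N N0.
have [z hz] := hC N (Xs N) (alpha N) N0 (cX N N0) (a0 N) (aA N) (hX N N0).
exists z; apply: le_trans hz _.
have p1 := powR_ge0 (N%:R : R) (- (2 * d%:R)^-1).
have s2 := sqrtr_ge0 (alpha N); have sK := sqrtr_ge0 K.
have h1 : Num.sqrt (PerN R d N (Xs N)) <= Num.sqrt K by rewrite ler_wsqrtr // PK.
have h2 : powR N%:R (- (d%:R)^-1) <= powR N%:R (- (2 * d%:R)^-1) :> R.
  rewrite ler_powR ?ler1n // lerN2 lef_pV2 ?posrE ?mulr_gt0 ?ltr0n ?(leq_trans _ hd) //.
  by rewrite ler_peMl // ler1n.
have -> : C * (Num.sqrt K + 2) * N%:R = C * N%:R * (Num.sqrt K + 2) by ring.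
rewrite -[leRHS]mulrA ler_wpM2l ?mulr_ge0 ?(ltW C0) //.
have h3 := ler_wpM2l p1 h1; have h4 := mulr_ge0 sK s2.
move: (powR _ _) (powR _ _) p1 h2 h3 (Num.sqrt _) s2 h4 => p q p1 h2 h3 s s2 h4.
by lra.
Qed.
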